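(* Let $\nu$ be an offspring distribution on $\{0,1,2,\dots\}$ with finite mean $m=\sum_{k\ge0}k\,\nu(k)<\infty$, and assume that $$m>2.$$ Then, almost surely on non-extinction, i.e. $P^\nu_*$-a.s., $$h_*>0.$$
   Context: $P^\nu$ governs the Galton-Watson tree $T$ with offspring distribution $\nu$, rooted at the initial ancestor $x_0$, and $P^\nu_*=P^\nu[\,\cdot\,|\,|T|=\infty]$ is its law conditioned on non-extinction. $P^\nu_*$-a.s., $T$ (a locally finite tree with unit weights on edges) is transient. For a transient tree $T$: simple random walk $(X_k)_{k\ge0}$ on $T$ started at $x$ has expectation $E_x$; ${\rm deg}(x)$ is the degree of $x$; the Green function is $g(x,y)=\frac{1}{{\rm deg}(y)}E_x[\sum_{k\ge0}1\{X_k=y\}]$. Under $\mathbb P^G$, $(\varphi_x)_{x\in T}$ is the Gaussian free field on $T$: a centered Gaussian field with covariance $g(\cdot,\cdot)$. $h_*=h_*(T)=\inf\{h\in\mathbb R;\ \mathbb P^G\text{-a.s., all connected components of }\{x\in T;\varphi_x\ge h\}\text{ are finite}\}$, $\inf\emptyset=\infty$. *)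

(* Defs.v *)
From HB Require Import structures.
From mathcomp Require Import all_boot all_order all_algebra finmap.
From mathcomp Require Import all_classical all_reals all_analysis.

Set Implicit Arguments.
Unset Strict Implicit.
Unset Printing Implicit Defensive.

Import Order.TTheory GRing.Theory Num.Theory.
Import numFieldNormedType.Exports.

Local Open Scope classical_set_scope.
Local Open Scope ring_scope.

(* Ulam-Harris labels: [::] is the initial ancestor x_0, and rcons u i is the
   i-th child (counted from 0) of u. *)
Definition vertex := seq nat.

Inductive gw_tree (N : vertex -> nat) : set vertex :=
| gw_root : gw_tree N [::]
| gw_child u i : gw_tree N u -> (i < N u)%N -> gw_tree N (rcons u i).

Definition adj : rel vertex :=
  fun u v => (v == rcons u (last 0%N v)) || (u == rcons v (last 0%N u)).

(* Meaningful when T is locally finite (fset_set of an infinite set is empty);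
   this holds for every gw_tree. *)
Definition deg (T : set vertex) (x : vertex) : nat :=
  #|` fset_set [set y | T y /\ adj x y] |.

Section Probability.
Local Open Scope ereal_scope.

Definition mutually_independent d d' (Omega : measurableType d)
    (E : measurableType d') (R : realType) (P : probability Omega R)
    (I : choiceType) (X : I -> {RV P >-> E}) : Prop :=
  forall (s : seq I) (A : I -> set E), uniq s ->
    (forall i, measurable (A i)) ->
    P (\bigcap_(i in [set` s]) (X i @^-1` A i)) =
    \prod_(i <- s) P (X i @^-1` A i).

Definition cond_prob d (Omega : measurableType d) (R : realType)
    (P : probability Omega R) (A : set Omega) : set Omega -> \bar R :=
  fun B => P (B `&` A) / P A.

Definition mean (R : realType) (nu : probability nat R) : \bar R :=
  \sum_(0 <= k <oo) k%:R%:E * nu [set k].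

(* Constants count as Gaussian; they are treated apart because normal_prob m 0
   is not the Dirac mass at m. *)
Definition gaussian d (Omega : measurableType d) (R : realType)
    (P : probability Omega R) (X : Omega -> R) : Prop :=
  exists m s : R, forall B : set R, measurable B ->
    P (X @^-1` B) = if s == 0%R then \d_m B else normal_prob m s B.

End Probability.

Section Walk.
Local Open Scope ereal_scope.

Definition srw_step (R : realType) (T : set vertex) (x y : vertex) : R :=
  if (y \in T) && adj x y then ((deg T x)%:R^-1)%R else 0%R.

(* Px x is the law P_x under which the process X starts at x. *)
Definition is_srw d (S : measurableType d) (R : realType) (T : set vertex)
    (Px : vertex -> probability S R) (X : nat -> S -> vertex) : Prop :=
  [/\ forall k y, measurable (X k @^-1` [set y]),
      forall x, T x -> Px x (X 0%N @^-1` [set x]) = 1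
    & forall x, T x -> forall (p : nat -> vertex) (n : nat),
        Px x [set w | forall k, (k <= n.+1)%N -> X k w = p k] =
        Px x [set w | forall k, (k <= n)%N -> X k w = p k]
          * (srw_step R T (p n) (p n.+1))%:E].

Definition green d (S : measurableType d) (R : realType) (T : set vertex)
    (Px : vertex -> probability S R) (X : nat -> S -> vertex)
    (x y : vertex) : \bar R :=
  ((deg T y)%:R^-1)%:E *
  \int[Px x]_w (\sum_(0 <= k <oo) (\1_(X k @^-1` [set y]) w)%:E).

End Walk.

Section FreeField.
Local Open Scope ereal_scope.

(* Only the variables phi x with x in T matter. A field with covariance g can
   exist only if g is finite on T, i.e. if T is transient. *)
Definition is_gff d (G : measurableType d) (R : realType) (T : set vertex)
    (g : vertex -> vertex -> \bar R) (PG : probability G R)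
    (phi : vertex -> {RV PG >-> R}) : Prop :=
  [/\ forall (s : seq vertex) (a : vertex -> R), {in s, forall x, T x} ->
        gaussian PG (fun w => \sum_(x <- s) a x * phi x w)%R,
      forall x, T x -> 'E_PG[phi x] = 0
    & forall x y, T x -> T y -> covariance PG (phi x) (phi y) = g x y].

(* Connected component of x in the subgraph induced on A. *)
Definition component (A : set vertex) (x : vertex) : set vertex :=
  [set y | exists p : seq vertex,
     [/\ path adj x p, last x p = y & {in x :: p, forall z, A z}]].

(* As an extended real depending only on the law of (phi x)_{x in T}, this is
   determined by T when phi is the free field of T. *)
Definition hstar d (G : measurableType d) (R : realType) (T : set vertex)
    (PG : probability G R) (phi : vertex -> {RV PG >-> R}) : \bar R :=
  ereal_inf [set h%:E | h in [set h : R |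
    {ae PG, forall w,
      let A := [set x | T x /\ (h <= phi x w)%R] in
      forall x, A x -> finite_set (component A x)}]].

End FreeField.

(* Main.v *)
Require Import Defs.
From HB Require Import structures.
From mathcomp Require Import all_boot all_order all_algebra finmap.
From mathcomp Require Import all_classical all_reals all_analysis.
From mathcomp Require Import measurable_realfun lebesgue_integral_under.
From mathcomp Require Import ring lra zify.

(** Fix a realisation [T] of the tree. For a vertex [y] with parent [u], the innovation
    [psi_y = phi_y - a_y phi_u], with [a_y = G(u,y) / G(u,u) >= 0], is the part of the free field
    at [y] that [u] does not explain. A path that leaves the subtree of [y] passes through [u], so
    [G(x,v) G(u,u) = G(x,u) G(u,v)] whenever [v] lies in this subtree and [x] does not
    ([green_separation]). Hence the innovations are uncorrelated, and, being jointly Gaussian,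
    independent ([gaussian_halfline_independent]). The variance of [psi_y] is the Green function
    at [y] of the walk killed at [u]; it is at least [1 / deg y] ([green_schur_lower]). So if [y]
    has at most [K] children then [psi_y >= h] has probability at least [1/2 - h (K+1)]. Finally
    [phi_u >= h > 0] and [psi_y >= h] give [phi_y >= h], because [a_y >= 0].

    Consequently, below any vertex [v0], the vertices joined to [v0] inside [{phi >= h}] dominate
    the cluster of [v0] in an independent thinning of [T], where a vertex with at most [K]
    children is kept with probability [rho <= 1/2 - h (K+1)] and the others are removed. The
    probability that [v0] is joined to level [n] by kept vertices is a polynomial [perc] of the
    retention probabilities, monotone and multilinear, which makes the comparison immediate
    ([perc_expectation]). If the thinned cluster of [v0] is infinite with positive probability,
    then so is the component of [v0] in [{phi >= h}], and [hstar >= h] ([hstar_lower_bound]).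

    It remains to find such a [v0] almost surely on non-extinction, and here [m > 2] enters: the
    truncated mean [sum_(k <= K) k nu(k)] exceeds [2] for [K] large, so that its product with a
    suitable [rho < 1/2] exceeds [1], and [h > 0] can then be chosen. The thinned Galton-Watson
    tree is supercritical, hence survives with positive annealed probability
    ([annealed_survival_lower_bound]). Let [dies] be the event that the thinning of every subtree
    of [T] dies out almost surely. Its probability and the extinction probability are both fixed
    points in [[0, 1[] of the offspring generating function, which is strictly convex and fixes
    [1] and thus has only one such fixed point ([generating_function_fixed_point_unique]). Since
    extinction implies [dies], the two events agree up to a null set ([dies_extinct_ae]).

    Independence of Gaussian variables comes from Stein's identity: integrating the derivative of
    [f] times the normal density yields a differential equation for the characteristic function,
    so uncorrelated jointly Gaussian variables have a factorised characteristic function, and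
    half-line indicators are limits of trigonometric polynomials ([halfline_orthogonal]). *)

Set Implicit Arguments.
Unset Strict Implicit.
Unset Printing Implicit Defensive.

Import Order.TTheory GRing.Theory Num.Theory.
Import numFieldNormedType.Exports.

Local Open Scope classical_set_scope.
Local Open Scope ring_scope.

(** * Expectation of bounded functions *)

Section BoundedExpectation.
Context d (W : measurableType d) (R : realType) (P : probability W R).

(** Real-valued, so that on bounded functions linearity holds with no side condition about
    infinite values. *)
Definition Ex (f : W -> R) : R := \int[P]_w f w.

Definition bdd (f : W -> R) : Prop :=
  measurable_fun setT f /\ exists M : R, forall w, `|f w| <= M.

Lemma bdd_integrable f : bdd f -> P.-integrable setT (EFin \o f).
Proof.
move=> [mf [M fM]]; apply: (@le_integrable _ _ _ _ _ measurableT _ (EFin \o cst M)).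
- exact/measurable_EFinP.
- move=> w _ /=; rewrite lee_fin (le_trans (fM w))// ler_norm//.
- exact: finite_measure_integrable_cst.
Qed.

Lemma bdd_cst c : bdd (fun=> c).
Proof. by split; [exact: measurable_cst|exists `|c|]. Qed.

Lemma bddD f g : bdd f -> bdd g -> bdd (fun w => f w + g w).
Proof.
move=> [mf [A fA]] [mg [B gB]]; split; first exact: measurable_funD.
by exists (A + B) => w; rewrite (le_trans (ler_normD _ _))// lerD.
Qed.

Lemma bddM f g : bdd f -> bdd g -> bdd (fun w => f w * g w).
Proof.
move=> [mf [A fA]] [mg [B gB]]; split; first exact: measurable_funM.
by exists (A * B) => w; rewrite normrM ler_pM.
Qed.

Lemma bddN f : bdd f -> bdd (fun w => - f w).
Proof.
move=> [mf [A fA]]; split; first exact: measurableT_comp.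
by exists A => w; rewrite normrN.
Qed.

Lemma bddB f g : bdd f -> bdd g -> bdd (fun w => f w - g w).
Proof. by move=> bf bg; apply: bddD => //; exact: bddN. Qed.

Lemma bdd_sum (I : Type) (s : seq I) (F : I -> W -> R) :
  (forall i, bdd (F i)) -> bdd (fun w => \sum_(i <- s) F i w).
Proof.
move=> bF; elim: s => [|i s IH].
  by under eq_fun do rewrite big_nil; exact: bdd_cst.
by under eq_fun do rewrite big_cons; exact: bddD.
Qed.

Lemma bdd_prod (I : Type) (s : seq I) (F : I -> W -> R) :
  (forall i, bdd (F i)) -> bdd (fun w => \prod_(i <- s) F i w).
Proof.
move=> bF; elim: s => [|i s IH].
  by under eq_fun do rewrite big_nil; exact: bdd_cst.
by under eq_fun do rewrite big_cons; exact: bddM.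
Qed.

Lemma bdd_indic (A : set W) : measurable A -> bdd (\1_A : W -> R).
Proof.
move=> mA; split; first exact: measurable_indic.
by exists 1 => w; rewrite indicE; case: (_ \in _); rewrite ?normr1 ?normr0.
Qed.

Lemma eq_Ex f g : f =1 g -> Ex f = Ex g.
Proof. by move=> fg; apply: eq_Rintegral => w _; exact: fg. Qed.

Lemma Ex_cst c : Ex (fun=> c) = c.
Proof.
rewrite /Ex Rintegral_cst// -[RHS]mulr1; congr (_ * _).
by rewrite -[RHS]/(fine 1%E); congr fine; exact: probability_setT.
Qed.

Lemma ExD f g : bdd f -> bdd g -> Ex (fun w => f w + g w) = Ex f + Ex g.
Proof. by move=> bf bg; rewrite /Ex RintegralD//; exact: bdd_integrable. Qed.

Lemma ExZ c f : bdd f -> Ex (fun w => c * f w) = c * Ex f.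
Proof. by move=> bf; rewrite /Ex RintegralZl//; exact: bdd_integrable. Qed.

Lemma ExB f g : bdd f -> bdd g -> Ex (fun w => f w - g w) = Ex f - Ex g.
Proof. by move=> bf bg; rewrite /Ex RintegralB//; exact: bdd_integrable. Qed.

Lemma Ex_sum (I : Type) (s : seq I) (F : I -> W -> R) :
  (forall i, bdd (F i)) -> Ex (fun w => \sum_(i <- s) F i w) = \sum_(i <- s) Ex (F i).
Proof.
move=> bF; elim: s => [|i s IH].
  by rewrite big_nil; under eq_Ex do rewrite big_nil; rewrite Ex_cst.
by rewrite big_cons -IH -ExD//; [apply: eq_Ex => w; rewrite big_cons|exact: bdd_sum].
Qed.

Lemma le_Ex f g : bdd f -> bdd g -> (forall w, f w <= g w) -> Ex f <= Ex g.
Proof. by move=> bf bg fg; apply: le_Rintegral => //; exact: bdd_integrable. Qed.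

Lemma Ex_ge0 f : (forall w, 0 <= f w) -> 0 <= Ex f.
Proof. by move=> f0; apply: Rintegral_ge0. Qed.

Lemma Ex_indic (A : set W) : measurable A -> (Ex \1_A)%:E = P A.
Proof.
move=> mA; rewrite /Ex /Rintegral integral_indic// setIT fineK//.
exact: fin_num_measure.
Qed.

Lemma Ex_dominated (F : nat -> W -> R) (f : W -> R) (M : R) :
  (forall n, measurable_fun setT (F n)) ->
  measurable_fun setT f -> (forall n w, `|F n w| <= M) ->
  {ae P, forall w, F n w @[n --> \oo] --> f w} ->
  Ex (F n) @[n --> \oo] --> Ex f.
Proof.
move=> mF mf FM Ff.
have := @dominated_convergence _ _ _ P setT measurableT
  (fun n => EFin \o F n) (EFin \o f) (EFin \o cst M).
case.
- by move=> n; exact/measurable_EFinP.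
- exact/measurable_EFinP.
- by apply: filterS Ff => w Fw _; apply: cvg_EFin => //; exact: nearW.
- exact: finite_measure_integrable_cst.
- by apply/nearW => w n _; rewrite /= lee_fin.
move=> intf _ FE; suff /fine_cvgP[_] :
  (fun n => \int[P]_w (EFin \o F n) w)%E n @[n --> \oo] --> (Ex f)%:E by exact.
rewrite /Ex /Rintegral fineK//; exact: integrable_fin_num.
Qed.

End BoundedExpectation.

(** * Integration against a density and integrals of derivatives *)

Section Density.
Local Open Scope ereal_scope.
Context d (W : measurableType d) (R : realType) (P : probability W R).
Notation mu := (@lebesgue_measure R).
Variables (X : W -> R) (p : R -> R).
Hypothesis mX : measurable_fun setT X.
Hypothesis p0 : forall x, (0 <= p x)%R.
Hypothesis mp : measurable_fun setT p.
Hypothesis lawX : forall B, measurable B -> P (X @^-1` B) = \int[mu]_(x in B) (p x)%:E.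

Import HBNNSimple.

Lemma density_indic (B : set R) : measurable B ->
  \int[P]_w (\1_B (X w))%:E = \int[mu]_x (\1_B x * p x)%:E.
Proof.
move=> mB.
rewrite -[LHS]/(\int[P]_w (\1_(X @^-1` B) w)%:E).
have mXB : measurable (X @^-1` B) by rewrite -[X in measurable X]setTI; exact: mX.
rewrite integral_indic// setIT; transitivity (P (X @^-1` B)) => //.
rewrite lawX// integral_mkcond/=.
apply: eq_integral => x _; rewrite patchE indicE.
by case: (x \in B); rewrite ?mul1r ?mul0r.
Qed.

Lemma density_nnsfun (f : {nnsfun R >-> R}) :
  \int[P]_w (f (X w))%:E = \int[mu]_x (f x * p x)%:E.
Proof.
have mfr r : measurable (f @^-1` [set r]).
  by rewrite -[X in measurable X]setTI; exact: (measurable_funP f).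
under [LHS]eq_integral do rewrite fimfunE -fsumEFin//.
rewrite [LHS]ge0_integral_fsum//; last 2 first.
  - move=> r; apply/measurable_EFinP/measurable_funM => //.
    by apply: (measurableT_comp _ mX); exact: measurable_indic.
  - by move=> n w _; rewrite EFinM nnfun_muleindic_ge0.
under [RHS]eq_integral.
  move=> x xD; rewrite EFinM fimfunE -fsumEFin// ge0_mule_fsuml; last first.
    by move=> r; rewrite EFinM nnfun_muleindic_ge0.
  over.
rewrite [RHS]ge0_integral_fsum//; last 2 first.
  - by move=> r; apply: emeasurable_funM; apply/measurable_EFinP => //; apply: measurable_funM =>
      //; apply: measurable_indic; exact: mfr.
  - by move=> n x _; rewrite mule_ge0//; [rewrite EFinM nnfun_muleindic_ge0|rewrite lee_fin].
apply: eq_fsbigr => r; rewrite inE /= => -[y _ yr].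
have r0 : (0 <= r)%R by rewrite -yr.
under [LHS]eq_integral do rewrite EFinM.
under [RHS]eq_integral do rewrite -EFinM -mulrA EFinM.
rewrite !ge0_integralZl//; last 3 first.
- by apply/measurable_EFinP/measurable_funM => //; apply: measurable_indic; exact: mfr.
- by move=> x _; rewrite lee_fin mulr_ge0.
- by apply/measurable_EFinP; apply: (measurableT_comp _ mX); apply: measurable_indic; exact: mfr.
by rewrite density_indic.
Qed.

Lemma density_ge0 (f : R -> R) : measurable_fun setT f -> (forall x, 0 <= f x)%R ->
  \int[P]_w (f (X w))%:E = \int[mu]_x (f x * p x)%:E.
Proof.
move=> mf f0.
have mEf : measurable_fun [set: R] (EFin \o f) by exact/measurable_EFinP.
pose f_ := nnsfun_approx measurableT mEf.
have cvf x : (f_ n x)%:E @[n --> \oo] --> (f x)%:E.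
  by apply: (@cvg_nnsfun_approx _ _ _ _ measurableT _ mEf) => // y _; rewrite lee_fin.
have mf_ n : measurable_fun [set: R] (f_ n) by exact: measurable_funP.
have nd x : {homo (fun n => f_ n x) : a b / (a <= b)%N >-> (a <= b)%R}.
  by move=> a b ab; exact/lefP/nd_nnsfun_approx.
transitivity (lim (\int[P]_w (f_ n (X w))%:E @[n --> \oo])).
  rewrite -monotone_convergence//=.
  - by apply: eq_integral => w _; apply/esym/cvg_lim => //=; exact: cvf.
  - by move=> n; apply/measurable_EFinP; exact: measurableT_comp.
  - by move=> n w _; rewrite lee_fin.
  - by move=> w _ a b ab; rewrite lee_fin; exact: nd.
transitivity (lim (\int[mu]_x (f_ n x * p x)%:E @[n --> \oo])).
  by apply: congr_lim; apply/funext => n; exact: density_nnsfun.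
rewrite -monotone_convergence//=.
- apply: eq_integral => x _; apply/cvg_lim => //=.
  under eq_fun do rewrite EFinM.
  by rewrite EFinM; apply: cvgeZr => //; exact: cvf.
- by move=> n; apply/measurable_EFinP; apply: measurable_funM => //; exact: mf_.
- by move=> n x _; rewrite lee_fin mulr_ge0.
- by move=> x _ a b ab; rewrite lee_fin ler_wpM2r//; exact: nd.
Qed.

(** The usual climb from indicators through simple and nonnegative functions. *)
Lemma density_integral (f : R -> R) : measurable_fun setT f ->
  \int[P]_w (f (X w))%:E = \int[mu]_x (f x * p x)%:E.
Proof.
move=> mf; rewrite integralE [RHS]integralE; congr (_ - _).
- transitivity (\int[mu]_x (funrpos f x * p x)%:E).
    rewrite -density_ge0//; first by apply: eq_integral => w _;
      rewrite funeposE /= /funrpos EFin_max.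
    exact: measurable_funrpos.
  apply: eq_integral => x _.
  by rewrite funeposE /funrpos -EFin_max maxr_pMl// mul0r.
- transitivity (\int[mu]_x (funrneg f x * p x)%:E).
    rewrite -density_ge0//; first by apply: eq_integral => w _;
      rewrite funenegE /= /funrneg EFin_max.
    exact: measurable_funrneg.
  apply: eq_integral => x _.
  by rewrite funenegE /funrneg -EFinN -EFin_max maxr_pMl// mul0r mulNr.
Qed.

End Density.

Section DerivIntegral.
Context (R : realType).
Notation mu := (@lebesgue_measure R).

(** On [[- n, n]] the integral is [F n - F (- n)] by the fundamental theorem of calculus, and
    dominated convergence lets [n] tend to infinity. *)
Lemma Rintegral_derive_vanishing (F f : R -> R) :
  (forall x : R, is_derive x 1 F (f x)) -> continuous f ->
  mu.-integrable setT (EFin \o f) ->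
  F n%:R @[n --> \oo] --> 0 -> F (- n%:R) @[n --> \oo] --> 0 ->
  \int[mu]_x f x = 0.
Proof.
move=> dF cf intf Fy FNy.
have cF : continuous F.
  by move=> x; apply: differentiable_continuous; apply/derivable1_diffP; have [] := dF x.
have mf : measurable_fun setT f by exact: continuous_measurable_fun.
pose I (n : nat) : set R := [set` `[(- n%:R : R), n%:R]].
pose g n x := f x * \1_(I n) x.
have mI n : measurable (I n) by exact: measurable_itv.
have gE n : (\int[mu]_x (g n x)%:E = \int[mu]_(x in I n) (f x)%:E)%E.
  rewrite [RHS]integral_mkcond/=; apply: eq_integral => x _.
  by rewrite patchE /g indicE; case: (x \in I n); rewrite ?mulr1 ?mulr0.
have FTC n : (\int[mu]_(x in I n.+1) (f x)%:E = (F n.+1%:R)%:E - (F (- n.+1%:R))%:E)%E.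
  apply: continuous_FTC2.
  - by rewrite gtrN ?ltr0Sn.
  - exact: continuous_subspaceT.
  - split.
    + by move=> x _; have [] := dF x.
    + by apply: cvg_at_right_filter; exact: cF.
    + by apply: cvg_at_left_filter; exact: cF.
  - by move=> x _; rewrite derive1E; apply: derive_val.
have mg n : measurable_fun setT (g n).
  by apply: measurable_funM => //; apply: measurable_indic; exact: mI.
have [|||||] := @dominated_convergence _ _ _ mu setT measurableT
  (fun n => EFin \o g n) (EFin \o f) (EFin \o (fun x => `|f x|)).
- by move=> n; apply/measurable_EFinP; exact: mg.
- exact/measurable_EFinP.
- apply: nearW => x _; apply: cvg_EFin; first exact: nearW.
  apply: cvg_near_cst; exists (Num.truncn `|x|).+1 => // n /= nx.
  rewrite /g indicE mem_set ?mulr1// /I /= in_itv/= -ler_norml.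
  by rewrite (le_trans (ltW (truncnS_gt _)))// ler_nat.
- by move/integrable_norm: intf.
- apply: nearW => x n _; rewrite /= lee_fin /g normrM ler_piMr// indicE.
  by case: (_ \in _); rewrite ?normr1 ?normr0.
move=> _ _ H.
have H1 : ([sequence \int[mu]_x (EFin \o g n) x]_n n.+1 @[n --> \oo] -->
  \int[mu]_x (EFin \o f) x)%E.
  by rewrite (@cvg_shiftS _ (fun n => \int[mu]_x (EFin \o g n) x)%E).
have H2 : ([sequence \int[mu]_x (EFin \o g n) x]_n n.+1 @[n --> \oo] --> 0%:E)%E.
  rewrite [X in X @ _ --> _](_ : _ = EFin \o (fun n => F n.+1%:R - F (- n.+1%:R))); last first.
    by apply/funext => n /=; rewrite gE FTC EFinB.
  apply: cvg_EFin; first exact: nearW.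
  rewrite -[X in _ --> X](subr0 0).
  by apply: cvgB; [rewrite (@cvg_shiftS _ (fun n => F n%:R))|rewrite
    (@cvg_shiftS _ (fun n => F (- n%:R)))].
have -> : (\int[mu]_x f x = fine (\int[mu]_x (EFin \o f) x)%E) by [].
by rewrite (cvg_unique _ H1 H2).
Qed.

End DerivIntegral.

(** * Stein's identity for the normal density *)

Section Stein.
Context (R : realType).
Notation mu := (@lebesgue_measure R).
Variables (m s : R).
Hypothesis s0 : s != 0.
Let p : R -> R := normal_pdf m s.

Let pE x : p x = normal_peak s * expR (- ((x - m) ^+ 2 / (4 * s ^+ 2)) *+ 2).
Proof.
rewrite /p normal_pdfE// /normal_fun; congr (_ * expR _).
by field; rewrite ?pnatr_eq0 ?s0.
Qed.

Let mp : measurable_fun setT p. Proof. exact: measurable_normal_pdf. Qed.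
Let p_ge0 x : 0 <= p x. Proof. exact: normal_pdf_ge0. Qed.

Let q (x : R) := expR (- ((x - m) ^+ 2 / (4 * s ^+ 2))).

Let s2_gt0 : 0 < s ^+ 2. Proof. by rewrite exprn_even_gt0. Qed.

(** With [y = (x - m)^2 / (4 s^2)] the density is [exp (- 2 y)] up to a constant. One of the two
    factors [exp (- y)] absorbs the quadratic weight, since [(1 + y) exp (- y) <= 1]; the other
    remains as the envelope [q]. *)
Let weight_le x : (1 + (x - m) ^+ 2) * p x <= normal_peak s * (1 + 4 * s ^+ 2) * q x.
Proof.
rewrite pE /q; set y := (x - m) ^+ 2 / (4 * s ^+ 2).
have y0 : 0 <= y by rewrite divr_ge0 ?sqr_ge0// mulr_ge0// sqr_ge0.
have -> : (x - m) ^+ 2 = 4 * s ^+ 2 * y by rewrite /y; field; rewrite ?pnatr_eq0 ?s0.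
rewrite mulr2n expRD; set e := expR (- y).
have e0 : 0 < e by exact: expR_gt0.
have ye : (1 + y) * e <= 1.
  by rewrite /e -[leRHS](expRxMexpNx_1 y) ler_wpM2r// ?expR_ge0// expR_ge1Dx.
have pk0 : 0 <= normal_peak s by exact: normal_peak_ge0.
(* Both [e <= 1] and [y * e <= 1] follow from [ye]. *)
have H : (1 + 4 * s ^+ 2 * y) * e <= 1 + 4 * s ^+ 2.
  have := s2_gt0; nra.
rewrite [leLHS](_ : _ = normal_peak s * e * ((1 + 4 * s ^+ 2 * y) * e)); last by ring.
rewrite [leRHS](_ : _ = normal_peak s * e * (1 + 4 * s ^+ 2)); last by ring.
by rewrite ler_wpM2l// mulr_ge0// ltW.
Qed.

(** The envelope [q] is, up to a constant, the normal density with doubled variance. *)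
Let s' := Num.sqrt 2 * s.
Let s'0 : s' != 0. Proof. by rewrite mulf_neq0// sqrtr_eq0 -ltNge. Qed.

Let q_pdf x : normal_pdf m s' x = normal_peak s' * q x.
Proof.
rewrite normal_pdfE// /normal_fun; congr (_ * expR _).
rewrite /s' exprMn sqr_sqrtr//.
by field; rewrite ?pnatr_eq0 ?s0.
Qed.

(** The growth class of test functions below: wide enough for squares, which the variance
    requires, and integrable against the normal density. *)
Definition quadratic (B : R) (g : R -> R) := forall x, `|g x| <= B * (1 + (x - m) ^+ 2).

Lemma quadratic_integrable B g : measurable_fun setT g -> quadratic B g ->
  mu.-integrable setT (EFin \o (fun x => g x * p x)).
Proof.
move=> mg gB.
have pk'0 : 0 < normal_peak s' by exact: normal_peak_gt0.
pose C := `|B| * (normal_peak s * (1 + 4 * s ^+ 2)) / normal_peak s'.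
apply: (@le_integrable _ _ R mu setT measurableT _ (EFin \o (fun x => C * normal_pdf m s' x))).
- by apply/measurable_EFinP; exact: measurable_funM.
- move=> x _ /=; rewrite lee_fin (le_trans _ (ler_norm _))//.
  rewrite q_pdf /C mulrA divfK ?gt_eqF// normrM (ger0_norm (p_ge0 x)).
  rewrite -mulrA; apply: le_trans (ler_wpM2l (normr_ge0 B) (weight_le x)).
  rewrite mulrA ler_wpM2r// (le_trans (gB x))// ler_wpM2r ?ler_norm//.
  by rewrite addr_ge0// sqr_ge0.
- have := integrableZl measurableT C (integrable_normal_pdf m s').
  by apply: eq_integrable => //= x _.
Qed.

(** The envelope [q] absorbs one more factor [|x|], by the same inequality
    [(1 + y) exp (- y) <= 1]. This makes the boundary terms of the integration by parts vanish. *)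
Lemma quadratic_decay B g : quadratic B g ->
  exists E, forall x, `|g x * p x| * `|x| <= E.
Proof.
move=> gB; pose D := `|m| + 1 + 4 * s ^+ 2.
exists (`|B| * (normal_peak s * (1 + 4 * s ^+ 2) * D)) => x.
rewrite normrM (ger0_norm (p_ge0 x)).
have qD : q x * `|x| <= D.
  rewrite /q; set y := (x - m) ^+ 2 / (4 * s ^+ 2).
  have y0 : 0 <= y by rewrite divr_ge0 ?sqr_ge0// mulr_ge0// sqr_ge0.
  have vE : (x - m) ^+ 2 = 4 * s ^+ 2 * y by rewrite /y; field; rewrite ?pnatr_eq0 ?s0.
  set e := expR (- y).
  have e0 : 0 < e by exact: expR_gt0.
  have ye : (1 + y) * e <= 1.
    by rewrite /e -[leRHS](expRxMexpNx_1 y) ler_wpM2r// ?expR_ge0// expR_ge1Dx.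
  have xD : `|x| <= D * (1 + y).
    have h1 : `|x| <= `|m| + `|x - m| by rewrite -[in leLHS](subrKC m x) ler_normD.
    have h2 : `|x - m| <= 1 + (x - m) ^+ 2.
      by rewrite -real_normK ?num_real//; have := normr_ge0 (x - m); nra.
    have := s2_gt0; have := normr_ge0 m; rewrite /D vE in h2 *; nra.
  rewrite mulrC (le_trans (ler_wpM2r (ltW e0) xD))// -mulrA.
  rewrite -[leRHS]mulr1; apply: ler_wpM2l => //.
  by rewrite /D; have := normr_ge0 m; have := s2_gt0; lra.
have pk0 : 0 <= normal_peak s by exact: normal_peak_ge0.
apply: (@le_trans _ _ (`|B| * ((1 + (x - m) ^+ 2) * p x) * `|x|)).
  apply: ler_wpM2r => //; rewrite [leRHS]mulrA; apply: ler_wpM2r => //.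
  by rewrite (le_trans (gB x))// ler_wpM2r ?ler_norm// addr_ge0// sqr_ge0.
rewrite -mulrA ler_wpM2l// (le_trans (ler_wpM2r (normr_ge0 x) (weight_le x)))//.
rewrite -[leLHS]mulrA; apply: ler_wpM2l => //; apply: mulr_ge0 => //.
by have := s2_gt0; lra.
Qed.

Lemma decay_cvg (F : R -> R) : (exists E, forall x, `|F x| * `|x| <= E) ->
  F n%:R @[n --> \oo] --> 0 /\ F (- n%:R) @[n --> \oo] --> 0.
Proof.
move=> [E FE].
suff H (u : nat -> R) : (forall n, `|u n.+1| * n.+1%:R <= E) -> u n @[n --> \oo] --> 0.
  split; apply: H => n; [have := FE n.+1%:R|have := FE (- n.+1%:R)].
    by rewrite [X in _ * X]ger0_norm.
  by rewrite normrN [X in _ * X]ger0_norm.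
move=> uE; rewrite -(cvg_shiftS u); apply/norm_cvg0P.
apply: (@squeeze_cvgr _ _ _ _ (cst 0) (fun n => E * harmonic n)).
- apply: nearW => n; rewrite normr_ge0/= /harmonic ler_pdivlMr//; exact: uE.
- exact: cvg_cst.
- by rewrite -[X in _ --> X](mulr0 E); apply: cvgMr; exact: cvg_harmonic.
Qed.

Let dp (x : R) : is_derive x 1 p (- ((x - m) / s ^+ 2) * p x).
Proof.
have -> : p = (fun x => normal_peak s * expR (- (x - m) ^+ 2 / (s ^+ 2 *+ 2))).
  by rewrite /p normal_pdfE.
rewrite /=.
apply: is_derive_eq; rewrite /GRing.scale/=.
by field; rewrite ?pnatr_eq0 ?s0.
Qed.

(** The density satisfies [p x^`() = - (x - m) / s^2 * p x], so the derivative of [f * p] is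
    [f^`() * p - (x - m) / s^2 * f * p], and it integrates to zero. *)
Lemma stein B (f df : R -> R) : (forall x : R, is_derive x 1 f (df x)) ->
  continuous df -> (forall x, `|f x| <= B * (1 + `|x - m|)) -> (forall x, `|df x| <= B) ->
  s ^+ 2 * \int[mu]_x (df x * p x) = \int[mu]_x ((x - m) * f x * p x).
Proof.
move=> df_ cdf fB dfB.
have cf : continuous f.
  by move=> x; apply: differentiable_continuous; apply/derivable1_diffP; have [] := df_ x.
have mf : measurable_fun setT f by exact: continuous_measurable_fun.
have mdf : measurable_fun setT df by exact: continuous_measurable_fun.
have B0 : 0 <= B by exact: le_trans (dfB 0).
have v1 x : `|x - m| <= 1 + (x - m) ^+ 2.
  by rewrite -real_normK ?num_real//; have := normr_ge0 (x - m); nra.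
have qf : quadratic (2 * B) f.
  move=> x; rewrite (le_trans (fB x))//.
  have := v1 x; have := sqr_ge0 (x - m); nra.
have qdf : quadratic B df.
  by move=> x; rewrite (le_trans (dfB x))// ler_peMr// lerDl sqr_ge0.
have qxf : quadratic (2 * B) (fun x => (x - m) * f x).
  move=> x; rewrite normrM mulrC.
  rewrite (le_trans (ler_wpM2r (normr_ge0 _) (fB x)))//.
  have := v1 x; have -> : (x - m) ^+ 2 = `|x - m| ^+ 2 by rewrite real_normK ?num_real.
  have := normr_ge0 (x - m); nra.
have mx : measurable_fun setT (fun x : R => (x - m) * f x).
  by apply: measurable_funM => //; exact: measurable_funB.
have i1 := quadratic_integrable mdf qdf.
have i2 := quadratic_integrable mx qxf.
have cp : continuous p by exact: continuous_normal_pdf.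
have i3 : mu.-integrable setT (EFin \o (fun x => df x * p x - (s ^+ 2)^-1 * ((x - m) * f x * p x))).
  have := integrableB measurableT i1 (integrableZl measurableT (s ^+ 2)^-1 i2).
  by apply: eq_integrable.
have [Fy FNy] := decay_cvg (quadratic_decay qf).
have := @Rintegral_derive_vanishing R (fun x => f x * p x) _ _ _ i3 Fy FNy.
rewrite RintegralB//; last 1 first.
  by have := integrableZl measurableT (s ^+ 2)^-1 i2; apply: eq_integrable.
rewrite RintegralZl// => H.
have -> : \int[mu]_x (df x * p x) = (s ^+ 2)^-1 * \int[mu]_x ((x - m) * f x * p x).
  apply/eqP; rewrite -subr_eq0; apply/eqP; apply: H.
  - move=> x; have := df_ x; have := dp x => ? ?.
    by apply: is_derive_eq; rewrite /GRing.scale/=; field; rewrite ?s0.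
  - move=> x; apply: cvgB; first by apply: cvgM; [exact: cdf|exact: cp].
    apply: cvgM; first exact: cvg_cst.
    apply: cvgM; last exact: cp.
    apply: cvgM; last exact: cf.
    by apply: cvgB; [exact: cvg_id|exact: cvg_cst].
by rewrite mulrA divff ?mul1r// expf_neq0.
Qed.

End Stein.

(** * Moments, characteristic function and tail of normal variables *)

Section SquareIntegrable.
Context d (W : measurableType d) (R : realType) (P : probability W R).

Definition L2 (f : W -> R) :=
  measurable_fun setT f /\ P.-integrable setT (EFin \o (fun w => f w ^+ 2)).

(** From [2 |f g| <= f^2 + g^2]. *)
Lemma L2_integrableM f g : L2 f -> L2 g -> P.-integrable setT (EFin \o (fun w => f w * g w)).
Proof.
move=> [mf if2] [mg ig2].
apply: (@le_integrable _ _ R P setT measurableT _ (EFin \o (fun w => f w ^+ 2 + g w ^+ 2))).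
- by apply/measurable_EFinP; exact: measurable_funM.
- move=> w _ /=; rewrite lee_fin (le_trans _ (ler_norm _))// normrM.
  rewrite -(@real_normK _ (f w)) ?num_real// -(@real_normK _ (g w)) ?num_real//.
  by have := sqr_ge0 (`|f w| - `|g w|); have := normr_ge0 (f w); have := normr_ge0 (g w); nra.
- by have := integrableD measurableT if2 ig2; apply: eq_integrable.
Qed.

Lemma L2_cst c : L2 (fun=> c).
Proof. by split => //; exact: finite_measure_integrable_cst. Qed.

Lemma L2_integrable f : L2 f -> P.-integrable setT (EFin \o f).
Proof.
move=> f2; have := L2_integrableM f2 (L2_cst 1).
by apply: eq_integrable => //= w _; rewrite mulr1.
Qed.

Lemma L2D f g : L2 f -> L2 g -> L2 (fun w => f w + g w).
Proof.
move=> f2 g2; split; first by apply: measurable_funD; [exact: f2.1|exact: g2.1].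
have h := integrableD measurableT (integrableD measurableT f2.2 g2.2)
  (integrableZl measurableT 2 (L2_integrableM f2 g2)).
move: h; apply: eq_integrable => //= w _; rewrite -EFinM -!EFinD; congr EFin; ring.
Qed.

Lemma L2Z c f : L2 f -> L2 (fun w => c * f w).
Proof.
move=> f2; split; first by apply: measurable_funM => //; exact: f2.1.
have := integrableZl measurableT (c ^+ 2) f2.2.
by apply: eq_integrable => //= w _; rewrite -EFinM exprMn.
Qed.

Lemma L2_sum (I : Type) (s : seq I) (F : I -> W -> R) :
  (forall i, L2 (F i)) -> L2 (fun w => \sum_(i <- s) F i w).
Proof.
move=> F2; elim: s => [|i s IH].
  by under eq_fun do rewrite big_nil; exact: L2_cst.
by under eq_fun do rewrite big_cons; exact: L2D.
Qed.

End SquareIntegrable.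

Section NormalRV.
Context d (W : measurableType d) (R : realType) (P : probability W R).
Notation mu := (@lebesgue_measure R).
Variables (X : W -> R) (m s : R).
Hypothesis mX : measurable_fun setT X.
Hypothesis s0 : s != 0.
Hypothesis lawX : forall B : set R, measurable B -> P (X @^-1` B) = normal_prob m s B.
Notation p := (normal_pdf m s).

Let mp : measurable_fun setT p. Proof. exact: measurable_normal_pdf. Qed.
Let p_ge0 x : 0 <= p x. Proof. exact: normal_pdf_ge0. Qed.

Lemma normal_Ex (f : R -> R) : measurable_fun setT f ->
  Ex P (fun w => f (X w)) = \int[mu]_x (f x * p x).
Proof.
by move=> mf; rewrite /Ex /Rintegral (density_integral mX p_ge0 mp lawX mf).
Qed.

Lemma normal_integrable B (f : R -> R) : measurable_fun setT f -> quadratic m B f ->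
  P.-integrable setT (EFin \o (fun w => f (X w))).
Proof.
move=> mf qf; apply/integrableP; split.
  by apply/measurable_EFinP; exact: measurableT_comp.
have /integrableP[_] := quadratic_integrable s0 mf qf.
apply: le_lt_trans; rewrite le_eqVlt; apply/orP; left; apply/eqP.
transitivity (\int[mu]_x (`|f x| * p x)%:E)%E.
  rewrite -(density_ge0 mX p_ge0 mp lawX)//.
  exact: measurableT_comp.
by apply: eq_integral => x _ /=; rewrite normrM (ger0_norm (p_ge0 x)).
Qed.

Lemma normal_L2 : L2 P X.
Proof.
split=> //; apply: (@normal_integrable (2 + 2 * m ^+ 2) (fun x => x ^+ 2)).
  exact: measurable_funX.
move=> x; rewrite ger0_norm ?sqr_ge0//.
have := sqr_ge0 (x - m); have := sqr_ge0 (x - 2 * m); have := sqr_ge0 (m * (x - m)).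
set a := (m * (x - m)) ^+ 2; set b := (x - m) ^+ 2.
move=> a0 _ b0.
have -> : (2 + 2 * m ^+ 2) * (1 + b) = 2 + 2 * m ^+ 2 + 2 * b + 2 * a by rewrite /a /b; ring.
suff : x ^+ 2 <= 2 * m ^+ 2 + 2 * b by lra.
by have := sqr_ge0 (x - 2 * m); rewrite /b; nra.
Qed.

Let Ep : \int[mu]_x p x = 1.
Proof. by rewrite /Rintegral integral_normal_pdf. Qed.

(** Stein's identity for the constant function [1]. *)
Lemma normal_mean : Ex P X = m.
Proof.
have H : Ex P (fun w => X w - m) = 0.
  rewrite (@normal_Ex (fun x => x - m)); last exact: measurable_funB.
  transitivity (s ^+ 2 * \int[mu]_x (0 * p x)).
    rewrite (@stein R m s s0 1 (cst 1) (cst 0)).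
    - by apply: eq_Rintegral => x _; rewrite mulr1.
    - by move=> x; exact: cst_continuous.
    - by move=> x; rewrite /= normr1 mul1r lerDl.
    - by move=> x; rewrite /= normr0.
  under eq_Rintegral do rewrite mul0r.
  by rewrite Rintegral_cst// mul0r mulr0.
move: H; rewrite /Ex RintegralB//; first last.
- exact: finite_measure_integrable_cst.
- exact: L2_integrable normal_L2.
- by rewrite -/(Ex P (cst m)) -/(Ex P X) Ex_cst => /eqP; rewrite subr_eq0 => /eqP.
Qed.

(** Stein's identity for [x - m]. *)
Lemma normal_variance : Ex P (fun w => (X w - m) ^+ 2) = s ^+ 2.
Proof.
rewrite (@normal_Ex (fun x => (x - m) ^+ 2)); last first.
  by apply: measurable_funX; exact: measurable_funB.
have dx (x : R) : is_derive x 1 (fun x : R => x - m) (cst 1 x).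
  by apply: is_derive_eq; rewrite subr0.
transitivity (s ^+ 2 * \int[mu]_x (1 * p x)).
  rewrite (stein s0 dx (B := 1))//.
  - by move=> x; exact: cst_continuous.
  - by move=> x; rewrite mul1r lerDr.
  - by move=> x; rewrite normr1.
by under eq_Rintegral do rewrite mul1r; rewrite Ep mulr1.
Qed.

Lemma normal_atom h : P (X @^-1` [set h]) = 0%E.
Proof. by rewrite lawX//; exact: integral_set1. Qed.

End NormalRV.

Section CenteredNormalRV.
Context d (W : measurableType d) (R : realType) (P : probability W R).
Notation mu := (@lebesgue_measure R).
Variables (X : W -> R) (s : R).
Hypothesis mX : measurable_fun setT X.
Hypothesis s0 : s != 0.
Hypothesis lawX : forall B : set R, measurable B -> P (X @^-1` B) = normal_prob 0 s B.
Notation p := (normal_pdf 0 s).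

Lemma normal_stein B (f df : R -> R) : (forall x : R, is_derive x 1 f (df x)) ->
  continuous df -> (forall x, `|f x| <= B) -> (forall x, `|df x| <= B) ->
  s ^+ 2 * Ex P (fun w => df (X w)) = Ex P (fun w => X w * f (X w)).
Proof.
move=> dff cdf fB dfB.
have cf : continuous f.
  by move=> x; apply: differentiable_continuous; apply/derivable1_diffP; have [] := dff x.
rewrite (normal_Ex mX lawX (f := df)); last exact: continuous_measurable_fun.
rewrite (normal_Ex mX lawX (f := fun x => x * f x)); last first.
  by apply: measurable_funM => //; exact: continuous_measurable_fun.
rewrite (stein s0 dff cdf _ dfB).
  by apply: eq_Rintegral => x _; rewrite subr0.
move=> x; rewrite (le_trans (fB x))// ler_peMr ?lerDl//.
exact: le_trans (normr_ge0 _) (fB x).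
Qed.

Let intX : P.-integrable setT (EFin \o X).
Proof. exact: L2_integrable (normal_L2 mX s0 lawX). Qed.

(** Differentiation under the expectation is allowed because the derivative in [t] is bounded by
    the integrable variable [|X|]. *)
Lemma is_derive_Ex (g dg : R -> R) : (forall x : R, is_derive x 1 g (dg x)) ->
  measurable_fun setT dg ->
  (forall x, `|g x| <= 1) -> (forall x, `|dg x| <= 1) ->
  forall t : R, is_derive t 1 (fun t => Ex P (fun w => g (t * X w)))
    (Ex P (fun w => X w * dg (t * X w))).
Proof.
move=> dgg mdg g1 dg1 t.
have mg : measurable_fun setT g.
  apply: continuous_measurable_fun => x; apply: differentiable_continuous.
  by apply/derivable1_diffP; have [] := dgg x.
have dE (u : R) w : is_derive u 1 (fun u => g (u * X w)) (X w * dg (u * X w)).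
  have h := dgg (u * X w).
  rewrite mulrC.
  apply: (@is_derive1_comp _ g (fun u => u * X w)).
  by apply: is_derive_eq; rewrite scaler0 ?add0r ?addr0 /GRing.scale/= mulr1.
pose f (u : R) (w : W) := g (u * X w).
have tI : (`]t - 1, t + 1[%classic : set R) t by rewrite /= in_itv/= gtrBl ltr01 ltrDl ltr01.
have If (u : R) : (`]t - 1, t + 1[%classic : set R) u -> P.-integrable setT (EFin \o f u).
  move=> _; apply: bdd_integrable; split; last by exists 1 => w; exact: g1.
  by apply: measurableT_comp => //; exact: measurable_funM.
have Df (u : R) w : (`]t - 1, t + 1[%classic : set R) u -> setT w -> derivable (f ^~ w) u 1.
  by move=> _ _; have [] := dE u w.
have Gf (u : R) w : (`]t - 1, t + 1[%classic : set R) u -> setT w -> `|partial1of2 f u w| <= `|X w|.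
  move=> _ _; rewrite partial1of2E; have [_ ->] := dE u w.
  by rewrite normrM ler_piMr.
have intG : P.-integrable setT (EFin \o (fun w => `|X w|)) by exact: integrable_norm intX.
apply: DeriveDef.
  exact: (derivable_under_integral measurableT tI If Df (fun w => normr_ge0 (X w)) intG Gf).
rewrite -derive1E.
rewrite (differentiation_under_integral measurableT tI If Df (fun w => normr_ge0 (X w)) intG Gf).
by apply: eq_Rintegral => w _; rewrite partial1of2E; have [_ ->] := dE t w.
Qed.

Let Ecos t := Ex P (fun w => cos (t * X w)).
Let Esin t := Ex P (fun w => sin (t * X w)).

(** The derivative is [- E (X sin (t X))], which Stein's identity turns into
    [- s^2 t E (cos (t X))]. *)
Let dEcos (t : R) : is_derive t 1 Ecos (- (s ^+ 2 * t * Ecos t)).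
Proof.
have := @is_derive_Ex cos (fun x => - sin x) _ _ _ _ t.
rewrite -/Ecos => H; apply: (is_derive_eq (H _ _ _ _)).
- by apply: measurableT_comp => //; apply: continuous_measurable_fun; exact: continuous_sin.
- by move=> x; rewrite ler_norml cos_geN1 cos_le1.
- by move=> x; rewrite normrN ler_norml sin_geN1 sin_le1.
have H2 := @normal_stein (1 + `|t|) (fun x => - sin (t * x)) (fun x => - (t * cos (t * x))) _ _ _ _.
rewrite -(H2 _).
- under eq_Ex do rewrite -mulNr.
  rewrite ExZ; last first.
    split; last by exists 1 => w; rewrite ler_norml cos_geN1 cos_le1.
    apply: measurableT_comp; first by apply: continuous_measurable_fun; exact: continuous_cos.
    exact: measurable_funM.
  by rewrite -/(Ecos t); ring.
- move=> x; apply: is_derive_eq; rewrite /GRing.scale/=; ring.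
- move=> x; apply: cvgN; apply: cvgM; first exact: cvg_cst.
  apply: continuous_comp; last exact: continuous_cos.
  by apply: cvgM; [exact: cvg_cst|exact: cvg_id].
- move=> x; rewrite normrN (@le_trans _ _ 1)// ?lerDl//.
  by rewrite ler_norml sin_geN1 sin_le1.
- move=> x; rewrite normrN normrM (@le_trans _ _ `|t|)// ?lerDr//.
  by rewrite ler_piMr// ler_norml cos_geN1 cos_le1.
Qed.

Let dEsin (t : R) : is_derive t 1 Esin (- (s ^+ 2 * t * Esin t)).
Proof.
have := @is_derive_Ex sin cos _ _ _ _ t.
rewrite -/Esin => H; apply: (is_derive_eq (H _ _ _ _)).
- by apply: continuous_measurable_fun; exact: continuous_cos.
- by move=> x; rewrite ler_norml sin_geN1 sin_le1.
- by move=> x; rewrite ler_norml cos_geN1 cos_le1.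
have H2 := @normal_stein (1 + `|t|) (fun x => cos (t * x)) (fun x => - (t * sin (t * x))) _ _ _ _.
rewrite -(H2 _).
- under eq_Ex do rewrite -mulNr.
  rewrite ExZ; last first.
    split; last by exists 1 => w; rewrite ler_norml sin_geN1 sin_le1.
    apply: measurableT_comp; first by apply: continuous_measurable_fun; exact: continuous_sin.
    exact: measurable_funM.
  by rewrite -/(Esin t); ring.
- move=> x; apply: is_derive_eq; rewrite /GRing.scale/=; ring.
- move=> x; apply: cvgN; apply: cvgM; first exact: cvg_cst.
  apply: continuous_comp; last exact: continuous_sin.
  by apply: cvgM; [exact: cvg_cst|exact: cvg_id].
- move=> x; rewrite (@le_trans _ _ 1)// ?lerDl//.
  by rewrite ler_norml cos_geN1 cos_le1.
- move=> x; rewrite normrN normrM (@le_trans _ _ `|t|)// ?lerDr//.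
  by rewrite ler_piMr// ler_norml sin_geN1 sin_le1.
Qed.

(** The product of a solution with [exp (s^2 t^2 / 2)] has zero derivative. *)
Lemma gaussian_ode (y : R -> R) : (forall t : R, is_derive t 1 y (- (s ^+ 2 * t * y t))) ->
  forall t, y t = y 0 * expR (- (s ^+ 2 * t ^+ 2 / 2)).
Proof.
move=> dy t.
pose z (u : R) := y u * expR (s ^+ 2 * u ^+ 2 / 2).
have dz (u : R) : is_derive u 1 z 0.
  by have := dy u => ?; apply: is_derive_eq; rewrite /GRing.scale/=; field.
have := is_derive_0_is_cst t 0 dz; rewrite /z expr0n/= mulr0 mul0r expR0 mulr1 => <-.
by rewrite -mulrA expRxMexpNx_1 mulr1.
Qed.

Lemma normal_cos : Ex P (fun w => cos (X w)) = expR (- (s ^+ 2 / 2)).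
Proof.
have := gaussian_ode dEcos 1; rewrite expr1n mulr1 /Ecos.
under eq_Ex do rewrite mul1r.
under [in X in _ = X -> _]eq_Ex do rewrite mul0r cos0.
by rewrite Ex_cst mul1r.
Qed.

Lemma normal_sin : Ex P (fun w => sin (X w)) = 0.
Proof.
have := gaussian_ode dEsin 1; rewrite expr1n mulr1 /Esin.
under eq_Ex do rewrite mul1r.
under [in X in _ = X -> _]eq_Ex do rewrite mul0r sin0.
by rewrite Ex_cst mul0r.
Qed.

(** By symmetry the positive half-line has mass [1/2], and the interval [[0, h[] has mass at
    most its length times the maximum of the density. *)
Lemma normal_tail h : 0 <= h ->
  ((1 / 2 - h * normal_peak s)%:E <= P (X @^-1` `[h, +oo[))%E.
Proof.
move=> h0; rewrite lawX//.
pose I0 : set R := [set` `[(0 : R), +oo[].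
have half : normal_prob 0 s I0 = (1/2)%:E.
  have := @ge0_symfun_integralT R p (@normal_pdf_ge0 R 0 s) (@continuous_normal_pdf R 0 s s0).
  rewrite integral_normal_pdf -set_itvcy -/(normal_prob 0 s I0) => H.
  have /H : p =1 p \o -%R.
    by move=> x; rewrite /= !normal_pdfE// /normal_fun !subr0 sqrrN.
  have : normal_prob 0 s I0 \is a fin_num by apply: fin_num_measure; exact: measurable_itv.
  case: (normal_prob 0 s I0) => //= r _ [] ?.
  by congr EFin; lra.
have -> : (1 / 2 - h * normal_peak s)%:E = (normal_prob 0 s I0 - (h * normal_peak s)%:E)%E.
  by rewrite half.
rewrite leeBlDr//.
have hsub : I0 = `[0, h[%classic `|` `[h, +oo[%classic :> set R.
  by rewrite /I0 -itv_bndbnd_setU.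
rewrite hsub (le_trans (measureU2 _ _ _))//= addeC leeD2l//.
rewrite /normal_prob.
apply: (@le_trans _ _ (\int[mu]_(x in `[0%R, h[) (normal_peak s)%:E)%E).
  apply: ge0_le_integral => //=.
  - by move=> x _; rewrite lee_fin normal_pdf_ge0.
  - by apply/measurable_EFinP; apply: measurable_funTS; exact: measurable_normal_pdf.
  - by move=> x _; rewrite lee_fin normal_pdf_ub.
rewrite integral_cst//= lebesgue_measure_itv/= lte_fin muleC.
case: ltP => _; first by rewrite oppr0 adde0.
by rewrite mul0e lee_fin mulr_ge0// normal_peak_ge0.
Qed.

End CenteredNormalRV.

(** * Centered Gaussian variables and trigonometric polynomials *)

Section AeEx.
Context d (W : measurableType d) (R : realType) (P : probability W R).

Lemma ae_eq_Ex (f g : W -> R) : measurable_fun setT f -> measurable_fun setT g ->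
  {ae P, forall w, f w = g w} -> Ex P f = Ex P g.
Proof.
move=> mf mg fg; congr fine; apply: ae_eq_integral => //; try exact/measurable_EFinP.
by apply: filterS fg => w /= -> _.
Qed.

End AeEx.

Section GaussianRV.
Context d (W : measurableType d) (R : realType) (P : probability W R).
Variables (X : W -> R).
Hypothesis mX : measurable_fun setT X.
Hypothesis gX : gaussian P X.

Lemma dirac_ae (m : R) : (forall B : set R, measurable B -> P (X @^-1` B) = \d_m B) ->
  {ae P, forall w, X w = m}.
Proof.
move=> H; exists (X @^-1` (~` [set m])); split.
- by rewrite -[X in measurable X]setTI; apply: mX => //; exact: measurableC.
- have := H (~` [set m]) (measurableC (measurable_set1 m)).
  by rewrite diracE memNset /=; last by move=> /(_ erefl).
- by move=> w.
Qed.

Lemma gaussian_L2 : L2 P X.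
Proof.
have [m [s H]] := gX.
have [s0|s0] := eqVneq s 0; last first.
  by apply: (normal_L2 mX s0 (m := m)) => B mB; rewrite H// (negbTE s0).
have Xm : {ae P, forall w, X w = m}.
  by apply: dirac_ae => B mB; rewrite H// s0 eqxx.
split => //; apply/integrableP; split; first by apply/measurable_EFinP; exact: measurable_funX.
rewrite (ae_eq_integral (fun=> (m ^+ 2)%:E))//.
- rewrite integral_cst// [X in (_ * X)%E](_ : _ = 1%E) ?mule1 ?ltry//.
  exact: probability_setT.
- by apply: measurableT_comp => //; apply/measurable_EFinP; exact: measurable_funX.
- by apply: filterS Xm => w Xw _ /=; rewrite Xw ger0_norm ?sqr_ge0.
Qed.

Hypothesis X0 : Ex P X = 0.

Let v := Ex P (fun w => X w ^+ 2).

(** A Gaussian variable may be degenerate; the two cases are separated here once and for all, so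
    that the formulas below hold for every variance [v]. *)
Lemma centered_gaussian_cases : {ae P, forall w, X w = 0} /\ v = 0 \/
  exists s : R, [/\ s != 0, v = s ^+ 2 &
    forall B : set R, measurable B -> P (X @^-1` B) = normal_prob 0 s B].
Proof.
have [m [s H]] := gX.
have [s0|s0] := eqVneq s 0; last first.
  have H' B : measurable B -> P (X @^-1` B) = normal_prob m s B.
    by move=> mB; rewrite H// (negbTE s0).
  have m0 : m = 0 by rewrite -X0 (normal_mean mX s0 H').
  right; exists s; split => //; last by rewrite -m0.
  by rewrite -(normal_variance mX s0 H') m0; apply: eq_Ex => w; rewrite subr0.
have Xm : {ae P, forall w, X w = m}.
  by apply: dirac_ae => B mB; rewrite H// s0 eqxx.
have m0 : m = 0 by rewrite -X0 (ae_eq_Ex _ _ Xm)// Ex_cst.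
left; split; first by rewrite -m0.
rewrite /v (@ae_eq_Ex _ _ _ P _ (fun=> 0)) ?Ex_cst//; first exact: measurable_funX.
by apply: filterS Xm => w ->; rewrite m0 expr0n.
Qed.

Lemma gaussian_cos : Ex P (fun w => cos (X w)) = expR (- (v / 2)).
Proof.
have [[Xae ->]|[s [s0 -> H]]] := centered_gaussian_cases; last exact: normal_cos.
rewrite mul0r oppr0 expR0 (@ae_eq_Ex _ _ _ P _ (fun=> 1)) ?Ex_cst//.
  by apply: measurableT_comp => //; apply: continuous_measurable_fun; exact: continuous_cos.
by apply: filterS Xae => w ->; rewrite cos0.
Qed.

Lemma gaussian_sin : Ex P (fun w => sin (X w)) = 0.
Proof.
have [[Xae _]|[s [s0 _ H]]] := centered_gaussian_cases; last exact: (normal_sin mX s0).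
rewrite (@ae_eq_Ex _ _ _ P _ (fun=> 0)) ?Ex_cst//.
  by apply: measurableT_comp => //; apply: continuous_measurable_fun; exact: continuous_sin.
by apply: filterS Xae => w ->; rewrite sin0.
Qed.

Lemma gaussian_atom h : 0 < v -> P (X @^-1` [set h]) = 0%E.
Proof.
move=> v0; have [[_ v00]|[s [s0 _ H]]] := centered_gaussian_cases.
  by rewrite v00 ltxx in v0.
exact: (normal_atom H).
Qed.

Lemma gaussian_tail h : 0 < v -> 0 <= h ->
  ((1 / 2 - h * (Num.sqrt (v * pi *+ 2))^-1)%:E <= P (X @^-1` `[h, +oo[))%E.
Proof.
move=> v0 h0; have [[_ v00]|[s [s0 -> H]]] := centered_gaussian_cases.
  by rewrite v00 ltxx in v0.
exact: (normal_tail s0 H).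
Qed.

End GaussianRV.

Section Trig.
Context (R : realType).

(** The real span of the functions [cos (t x)] and [sin (t x)]. *)
Inductive trig : (R -> R) -> Prop :=
| trig_cos t : trig (fun x => cos (t * x))
| trig_sin t : trig (fun x => sin (t * x))
| trig_add f g : trig f -> trig g -> trig (fun x => f x + g x)
| trig_scale c f : trig f -> trig (fun x => c * f x).

(** Products of cosines and sines are linearised by the addition formulas. *)
Lemma trig_mul f g : trig f -> trig g -> trig (fun x => f x * g x).
Proof.
move=> tf tg; elim: tf => {f} [t|t|f1 f2 _ IH1 _ IH2|c f _ IH]; last 2 first.
- by under eq_fun do rewrite mulrDl; exact: trig_add.
- by under eq_fun do rewrite -mulrA; exact: trig_scale.
- elim: tg => {g} [u|u|g1 g2 _ IH1 _ IH2|c g _ IH]; last 2 first.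
  + by under eq_fun do rewrite mulrDr; exact: trig_add.
  + by under eq_fun do rewrite mulrCA; exact: trig_scale.
  + have -> : (fun x => cos (t * x) * cos (u * x)) =
      (fun x => 2^-1 * (cos ((t + u) * x) + cos ((t - u) * x))).
      by apply/funext => x; rewrite !mulrDl (mulNr u) cosD cosB; field.
    by apply: trig_scale; apply: trig_add; exact: trig_cos.
  + have -> : (fun x => cos (t * x) * sin (u * x)) =
      (fun x => 2^-1 * (sin ((t + u) * x) + (-1) * sin ((t - u) * x))).
      by apply/funext => x; rewrite !mulrDl (mulNr u) sinD sinB; field.
    by apply: trig_scale; apply: trig_add; [|apply: trig_scale]; exact: trig_sin.
- elim: tg => {g} [u|u|g1 g2 _ IH1 _ IH2|c g _ IH]; last 2 first.
  + by under eq_fun do rewrite mulrDr; exact: trig_add.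
  + by under eq_fun do rewrite mulrCA; exact: trig_scale.
  + have -> : (fun x => sin (t * x) * cos (u * x)) =
      (fun x => 2^-1 * (sin ((t + u) * x) + sin ((t - u) * x))).
      by apply/funext => x; rewrite !mulrDl (mulNr u) sinD sinB; field.
    by apply: trig_scale; apply: trig_add; exact: trig_sin.
  + have -> : (fun x => sin (t * x) * sin (u * x)) =
      (fun x => 2^-1 * (cos ((t - u) * x) + (-1) * cos ((t + u) * x))).
      by apply/funext => x; rewrite !mulrDl (mulNr u) cosB cosD; field.
    by apply: trig_scale; apply: trig_add; [|apply: trig_scale]; exact: trig_cos.
Qed.

(** An odd cubic with fixed points [- 1], [0] and [1], increasing on [[- 1, 1]] and repelled by
    [0]: its iterates converge there to the sign. It turns a sine into an approximate square
    wave without leaving the algebra of trigonometric polynomials. *)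
Definition sharpen (s : R) : R := (3 * s - s ^+ 3) / 2.

Lemma sharpen_itv s : 0 <= s <= 1 -> s <= sharpen s <= 1.
Proof.
move=> /andP[s0 s1].
have h1 : 0 <= s * (1 - s) * (1 + s) by rewrite !mulr_ge0//; lra.
have h2 : 0 <= (1 - s) ^+ 2 * (2 + s) by rewrite mulr_ge0 ?sqr_ge0//; lra.
by rewrite /sharpen; apply/andP; split; lra.
Qed.

Lemma iter_sharpen_itv s k : 0 <= s <= 1 -> s <= iter k sharpen s <= 1.
Proof.
move=> s01; elim: k => [|k /andP[IH1 IH2]] /=; first by rewrite lexx; case/andP: s01.
have /andP[s0 s1] := s01.
have /sharpen_itv/andP[a b] : 0 <= iter k sharpen s <= 1 by rewrite (le_trans s0).
by rewrite b andbT (le_trans IH1).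
Qed.

(** As [1 - sharpen u = (1 - u) * ((1 - u) * (1 + u / 2))], the second factor is at most
    [1 - u / 2 <= 1 - s / 2] when [u >= s]. *)
Lemma iter_sharpen_rate s k : 0 <= s <= 1 -> 1 - iter k sharpen s <= (1 - s / 2) ^+ k.
Proof.
move=> s01; elim: k => [|k IH] /=; first by rewrite expr0 gerBl; case/andP: s01.
have /andP[s0 s1] := s01.
have /andP[a b] := iter_sharpen_itv k s01.
rewrite exprS; set u := iter k sharpen s in IH a b *.
apply: (@le_trans _ _ ((1 - s / 2) * (1 - u))); last by rewrite ler_wpM2l//; lra.
have -> : 1 - sharpen u = (1 - u) * ((1 - u) * (1 + u / 2)) by rewrite /sharpen; field.
rewrite mulrC; apply: ler_wpM2r; first by lra.
by have := sqr_ge0 u; lra.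
Qed.

Lemma iter_sharpenN s k : iter k sharpen (- s) = - iter k sharpen s.
Proof. by elim: k => //= k ->; rewrite /sharpen; field. Qed.

Lemma iter_sharpen_cvg s : `|s| <= 1 -> iter k sharpen s @[k --> \oo] --> Num.sg s.
Proof.
move=> s1.
have pos u : 0 < u -> u <= 1 -> iter k sharpen u @[k --> \oo] --> (1 : R).
  move=> u0 u1; have u01 : 0 <= u <= 1 by rewrite ltW.
  apply: (@squeeze_cvgr _ _ _ _ (fun k => 1 - (1 - u / 2) ^+ k) (cst 1)).
  - apply: nearW => k; have := iter_sharpen_rate k u01.
    by have /andP[_ ->] := iter_sharpen_itv k u01; rewrite andbT; lra.
  - rewrite -[X in _ --> X](subr0 1); apply: cvgB; first exact: cvg_cst.
    by apply: cvg_expr; rewrite ltr_norml; apply/andP; split; lra.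
  - exact: cvg_cst.
case: (ltgtP s 0) => s0.
- rewrite ltr0_sg//; have -> : (fun k => iter k sharpen s) = (fun k => - iter k sharpen (- s)).
    by apply/funext => k; rewrite iter_sharpenN opprK.
  by apply: cvgN; apply: pos; [rewrite oppr_gt0|rewrite -(ltr0_norm s0)].
- by rewrite gtr0_sg//; apply: pos => //; rewrite -(gtr0_norm s0).
- rewrite s0 sgr0; have -> : (fun k => iter k sharpen (0:R)) = cst 0; last exact: cvg_cst.
  by apply/funext => k; elim: k => //= k ->; rewrite /sharpen; field.
Qed.

Lemma iter_sharpen_norm s k : `|s| <= 1 -> `|iter k sharpen s| <= 1.
Proof.
move=> s1; wlog s0 : s s1 / 0 <= s.
  move=> H; case: (leP 0 s) => [s0|/ltW sN]; first exact: H s1 s0.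
  by rewrite -normrN -iter_sharpenN; apply: H; rewrite ?normrN ?oppr_ge0.
have s01 : 0 <= s <= 1 by rewrite s0 -(ger0_norm s0).
have /andP[a b] := iter_sharpen_itv k s01.
by rewrite ger0_norm// (le_trans s0).
Qed.

(** The sine of [a * (x - h)] is a trigonometric polynomial in [x], and [sharpen] is a
    polynomial. *)
Lemma trig_square_wave (a h : R) k : trig (fun x => iter k sharpen (sin (a * (x - h)))).
Proof.
elim: k => [|k IH] /=.
  have -> : (fun x => sin (a * (x - h))) =
    (fun x => cos (a * h) * sin (a * x) + (- sin (a * h)) * cos (a * x)).
    by apply/funext => x; rewrite mulrBr sinB; ring.
  by apply: trig_add; apply: trig_scale; [exact: trig_sin|exact: trig_cos].
set f := (fun x => iter k sharpen (sin (a * (x - h)))) in IH.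
have -> : (fun x => sharpen (iter k sharpen (sin (a * (x - h))))) =
  (fun x => 3 / 2 * f x + (- 2^-1) * (f x * (f x * f x))).
  by apply/funext => x; rewrite /sharpen -/(f x); field.
by apply: trig_add; apply: trig_scale => //; do 2 apply: trig_mul => //.
Qed.

End Trig.

(** * Half-line events of uncorrelated jointly Gaussian variables *)

Section HalfLines.
Context d (W : measurableType d) (R : realType) (P : probability W R).

Lemma trig_bdd (f : R -> R) (X : W -> R) : measurable_fun setT X -> trig f ->
  bdd (fun w => f (X w)).
Proof.
move=> mX; elim=> {f} [t|t|f g _ bf _ bg|c f _ bf].
- split; last by exists 1 => w; rewrite ler_norml cos_geN1 cos_le1.
  apply: (@measurableT_comp _ _ _ _ _ _ (@cos R)); last exact: measurable_funM.
  by apply: continuous_measurable_fun; exact: continuous_cos.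
- split; last by exists 1 => w; rewrite ler_norml sin_geN1 sin_le1.
  apply: (@measurableT_comp _ _ _ _ _ _ (@sin R)); last exact: measurable_funM.
  by apply: continuous_measurable_fun; exact: continuous_sin.
- exact: bddD.
- by apply: bddM => //; exact: bdd_cst.
Qed.

Variables (Y X : W -> R).
Hypothesis bY : bdd Y.
Hypothesis mX : measurable_fun setT X.
Hypothesis Ycos : forall t, Ex P (fun w => Y w * cos (t * X w)) = 0.
Hypothesis Ysin : forall t, Ex P (fun w => Y w * sin (t * X w)) = 0.

Lemma trig_orthogonal f : trig f -> Ex P (fun w => Y w * f (X w)) = 0.
Proof.
elim=> {f} [//|//|f g tf f0 tg g0|c f tf f0].
- under eq_Ex do rewrite mulrDr.
  by rewrite ExD ?f0 ?g0 ?addr0//; apply: bddM => //; exact: trig_bdd.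
- under eq_Ex do rewrite mulrCA.
  by rewrite ExZ ?f0 ?mulr0//; apply: bddM => //; exact: trig_bdd.
Qed.

Let sgf (x : R) : R := \1_`]0, +oo[ x - \1_`]-oo, 0[ x.

Let sgfE x : sgf x = Num.sg x.
Proof.
rewrite /sgf !indicE !mem_setE !in_itv/= andbT.
by case: (ltgtP x 0) => x0; rewrite ?(ltr0_sg x0) ?(gtr0_sg x0) ?x0 ?sgr0 ?subr0 ?sub0r.
Qed.

Let msg : measurable_fun setT (Num.sg : R -> R).
Proof.
rewrite (_ : Num.sg = sgf); last by apply/funext => x; rewrite sgfE.
by apply: measurable_funB; apply: measurable_indic.
Qed.

Let sg_le1 (x : R) : `|Num.sg x| <= 1.
Proof. by rewrite normr_sg; case: eqP. Qed.

Let sin_norm (x : R) : `|sin x| <= 1.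
Proof. by rewrite ler_norml sin_geN1 sin_le1. Qed.

Let msin : measurable_fun setT (@sin R).
Proof. by apply: continuous_measurable_fun; exact: continuous_sin. Qed.

Let mYg (g : R -> R) : measurable_fun setT g -> measurable_fun setT (fun w => Y w * g (X w)).
Proof. by move=> mg; apply: measurable_funM; [exact: bY.1|exact: measurableT_comp]. Qed.

(** The square wave [sg (sin u)] is the bounded pointwise limit of the iterates
    [iter k sharpen (sin u)]. *)
Lemma square_wave_orthogonal a h : Ex P (fun w => Y w * Num.sg (sin (a * (X w - h)))) = 0.
Proof.
have [M YM] := bY.2.
pose F k w := Y w * iter k (@sharpen R) (sin (a * (X w - h))).
have mF k : measurable_fun setT (F k).
  by apply: (bddM bY _).1; exact: (trig_bdd mX (trig_square_wave a h k)).
have H : Ex P (F k) @[k --> \oo] --> Ex P (fun w => Y w * Num.sg (sin (a * (X w - h)))).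
  apply: (@Ex_dominated _ _ _ P F _ M) => //.
  - apply: (mYg (g := fun x => Num.sg (sin (a * (x - h))))).
    apply: measurableT_comp => //; apply: measurableT_comp => //.
    by apply: measurable_funM => //; exact: measurable_funB.
  - move=> k w; rewrite normrM (le_trans _ (YM w))// ler_piMr// iter_sharpen_norm//.
  - apply: nearW => w; rewrite /F; apply: cvgM; first exact: cvg_cst.
    by exact: iter_sharpen_cvg.
apply/esym; apply: (cvg_unique _ _ H) => //.
rewrite (_ : (fun k => Ex P (F k)) = cst 0); last first.
  by apply/funext => k; exact: (trig_orthogonal (trig_square_wave a h k)).
exact: cvg_cst.
Qed.

(** A square wave of period tending to infinity is eventually equal to the sign at each point. *)
Lemma sg_orthogonal h : Ex P (fun w => Y w * Num.sg (X w - h)) = 0.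
Proof.
have [M YM] := bY.2.
pose F (k : nat) w := Y w * Num.sg (sin (k.+1%:R^-1 * (X w - h))).
have mF k : measurable_fun setT (F k).
  apply: (mYg (g := fun x => Num.sg (sin (k.+1%:R^-1 * (x - h))))).
  apply: measurableT_comp => //; apply: measurableT_comp => //.
  by apply: measurable_funM => //; exact: measurable_funB.
have H : Ex P (F k) @[k --> \oo] --> Ex P (fun w => Y w * Num.sg (X w - h)).
  apply: (@Ex_dominated _ _ _ P F _ M) => //.
  - apply: (mYg (g := fun x => Num.sg (x - h))).
    by apply: measurableT_comp => //; exact: measurable_funB.
  - by move=> k w; rewrite normrM (le_trans _ (YM w))// ler_piMr.
  - apply: nearW => w; rewrite /F; apply: cvgM; first exact: cvg_cst.
    apply: cvg_near_cst.
    exists (Num.truncn `|X w - h|) => // n /= nh; set x := X w - h in nh *.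
    have xn : `|x| < n.+1%:R.
      by rewrite (lt_le_trans (truncnS_gt _))// ler_nat ltnS.
    have pi1 : 1 < pi :> R by rewrite (lt_le_trans _ (pi_ge2 R))// ltr1n.
    have pos (u : R) : 0 < u -> u < n.+1%:R -> 0 < sin (n.+1%:R^-1 * u).
      move=> u0 un; apply: sin_gt0_pi; apply/andP; split; first by rewrite mulr_gt0.
      by rewrite (lt_trans _ pi1)// mulrC ltr_pdivrMr// mul1r.
    case: (ltgtP x 0) => x0.
    + have : 0 < sin (n.+1%:R^-1 * - x).
        by apply: pos; [rewrite oppr_gt0|rewrite -(ltr0_norm x0)].
      by rewrite mulrN sinN oppr_gt0 => sx; rewrite !ltr0_sg.
    + by rewrite !gtr0_sg//; apply: pos => //; rewrite -(gtr0_norm x0).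
    + by rewrite x0 mulr0 sin0.
apply/esym; apply: (cvg_unique _ _ H) => //.
rewrite (_ : (fun k => Ex P (F k)) = cst 0); last first.
  by apply/funext => k; exact: square_wave_orthogonal.
exact: cvg_cst.
Qed.

(** A bounded variable orthogonal to all [cos (t X)] and [sin (t X)] is orthogonal to the
    half-line indicator [(1 + sg (X - h)) / 2]; the two differ only where [X = h]. *)
Lemma halfline_orthogonal h : P (X @^-1` [set h]) = 0%E ->
  Ex P (fun w => Y w * \1_(X @^-1` `[h, +oo[) w) = 0.
Proof.
move=> Xh.
have bsg : bdd (fun w => Num.sg (X w - h)).
  split; last by exists 1.
  by apply: measurableT_comp => //; exact: measurable_funB.
have mI : measurable (X @^-1` `[h, +oo[).
  by rewrite -[X in measurable X]setTI; exact: mX.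
transitivity (Ex P (fun w => Y w * (2^-1 * (1 + Num.sg (X w - h))))).
  apply: ae_eq_Ex.
  - by apply: (bddM bY _).1; exact: bdd_indic.
  - apply: (bddM bY _).1; apply: bddM; first exact: bdd_cst.
    by apply: bddD => //; exact: bdd_cst.
  - exists (X @^-1` [set h]); split => //.
      by rewrite -[X in measurable X]setTI; exact: mX.
    move=> w /=; apply: contra_notP => /eqP Xwh; congr (_ * _).
    rewrite indicE /=; case: (ltgtP (X w) h) Xwh => // Xwh _.
      rewrite memNset ?ltr0_sg ?subr_lt0//=; first by rewrite subrr mulr0.
      by rewrite in_itv/= leNgt Xwh.
    rewrite mem_set ?gtr0_sg ?subr_gt0//=; first by rewrite mulVf.
    by rewrite in_itv/= (ltW Xwh).
under eq_Ex do rewrite mulrCA mulrDr mulr1.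
rewrite ExZ; last by apply: bddD => //; exact: bddM.
rewrite ExD//; last exact: bddM.
have := Ycos 0; under eq_Ex do rewrite mul0r cos0 mulr1.
by move=> ->; rewrite sg_orthogonal addr0 mulr0.
Qed.

End HalfLines.

Section Independence.
Context d (W : measurableType d) (R : realType) (P : probability W R).
Variables (I : eqType) (D : pred I) (psi : I -> W -> R) (v : I -> R) (h : R).
Hypothesis mpsi : forall i, measurable_fun setT (psi i).
Hypothesis joint_cos : forall (s : seq I) (t : I -> R), uniq s -> all D s ->
  Ex P (fun w => cos (\sum_(i <- s) t i * psi i w)) =
  expR (- ((\sum_(i <- s) t i ^+ 2 * v i) / 2)).
Hypothesis joint_sin : forall (s : seq I) (t : I -> R), uniq s -> all D s ->
  Ex P (fun w => sin (\sum_(i <- s) t i * psi i w)) = 0.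
Hypothesis atom : forall i, D i -> P (psi i @^-1` [set h]) = 0%E.

Let e i : W -> R := \1_(psi i @^-1` `[h, +oo[).

Let be i : bdd (e i).
Proof. by apply: bdd_indic; rewrite -[X in measurable X]setTI; exact: mpsi. Qed.

Let mL s t : measurable_fun setT (fun w => \sum_(i <- s) t i * psi i w).
Proof.
elim: s => [|i s IH]; first by under eq_fun do rewrite big_nil; exact: measurable_cst.
by under eq_fun do rewrite big_cons; apply: measurable_funD => //; exact: measurable_funM.
Qed.

Let bcos f : measurable_fun setT f -> bdd (fun w : W => cos (f w : R)).
Proof.
by move=> mf; have := trig_bdd mf (trig_cos 1); under eq_fun do rewrite mul1r.
Qed.

Let bsin f : measurable_fun setT f -> bdd (fun w : W => sin (f w : R)).
Proof.
by move=> mf; have := trig_bdd mf (trig_sin 1); under eq_fun do rewrite mul1r.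
Qed.

Let upd (t : I -> R) i x j := if j == i then x else t j.

Let upd_eq t i x : upd t i x i = x. Proof. by rewrite /upd eqxx. Qed.

Let upd_sum (V : nmodType) (F : I -> R -> V) s t i x : i \notin s ->
  \sum_(j <- s) F j (upd t i x j) = \sum_(j <- s) F j (t j).
Proof.
move=> si; rewrite big_seq [RHS]big_seq; apply: eq_bigr => j js.
by rewrite /upd; case: eqP => // ji; rewrite -ji js in si.
Qed.

(** The exponentials are replaced by indicators one variable at a time. With [Z] the product of
    the indicators already introduced and [L] the remaining linear combination, the variable
    [Z cos L - c], with [c] the expectation of [Z cos L], is orthogonal to [cos (x psi_i)] and
    [sin (x psi_i)] for every [x], hence to the indicator for [psi_i] by [halfline_orthogonal].
    Keeping the exponentials of the variables not yet treated is what lets the induction go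
    through. *)
Lemma joint_mixed s1 s2 t : uniq (s1 ++ s2) -> all D (s1 ++ s2) ->
  Ex P (fun w => \prod_(i <- s1) e i w * cos (\sum_(i <- s2) t i * psi i w)) =
  \prod_(i <- s1) Ex P (e i) * expR (- ((\sum_(i <- s2) t i ^+ 2 * v i) / 2)) /\
  Ex P (fun w => \prod_(i <- s1) e i w * sin (\sum_(i <- s2) t i * psi i w)) = 0.
Proof.
elim: s1 s2 t => [|i s1 IH] s2 t.
  rewrite cat0s => us2 Ds2; split.
    by rewrite big_nil mul1r -joint_cos//; apply: eq_Ex => w; rewrite big_nil mul1r.
  by rewrite -[RHS](joint_sin t us2 Ds2); apply: eq_Ex => w; rewrite big_nil mul1r.
rewrite cat_cons => us Ds.
have us' : uniq (s1 ++ i :: s2) by rewrite -cat_rcons -cats1 -catA uniq_catCA.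
have Ds' : all D (s1 ++ i :: s2) by move: Ds; rewrite /= !all_cat /= => /and3P[-> -> ->].
have Di : D i by case/andP: Ds.
have is2 : i \notin s2 by move: us; rewrite /= mem_cat negb_or => /andP[/andP[_ ->]].
pose Z w := \prod_(i <- s1) e i w.
pose L w := \sum_(i <- s2) t i * psi i w.
pose V := \sum_(i <- s2) t i ^+ 2 * v i.
pose pr := \prod_(i <- s1) Ex P (e i).
have bZ : bdd Z by apply: bdd_prod.
have mL' : measurable_fun setT L by exact: mL.
have mt x : measurable_fun setT (fun w => x * psi i w) by exact: measurable_funM.
have Hc x : Ex P (fun w => Z w * cos (x * psi i w + L w)) = pr * expR (- ((x ^+ 2 * v i + V) / 2)).
  have [+ _] := IH (i :: s2) (upd t i x) us' Ds'.
  rewrite big_cons (@upd_sum _ (fun j y => y ^+ 2 * v j))// upd_eq => <-.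
  apply: eq_Ex => w; rewrite big_cons (@upd_sum _ (fun j y => y * psi j w))//.
  by rewrite upd_eq.
have Hs x : Ex P (fun w => Z w * sin (x * psi i w + L w)) = 0.
  have [_ <-] := IH (i :: s2) (upd t i x) us' Ds'.
  apply: eq_Ex => w; rewrite big_cons (@upd_sum _ (fun j y => y * psi j w))//.
  by rewrite upd_eq.
have H1c x : Ex P (fun w => cos (x * psi i w)) = expR (- (x ^+ 2 * v i / 2)).
  have := @joint_cos [:: i] (fun=> x); rewrite /= Di => /(_ isT isT).
  by rewrite big_seq1 => <-; apply: eq_Ex => w; rewrite big_seq1.
have H1s x : Ex P (fun w => sin (x * psi i w)) = 0.
  have := @joint_sin [:: i] (fun=> x); rewrite /= Di => /(_ isT isT) <-.
  by apply: eq_Ex => w; rewrite big_seq1.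
have bc x : bdd (fun w => Z w * cos (x * psi i w + L w)).
  by apply: bddM => //; apply: bcos; exact: measurable_funD.
have bs x : bdd (fun w => Z w * sin (x * psi i w + L w)).
  by apply: bddM => //; apply: bsin; exact: measurable_funD.
(* The expectation of [Z cos L]. *)
pose c := pr * expR (- (V / 2)).
have bYc : bdd (fun w => Z w * cos (L w) - c).
  by apply: bddB; [apply: bddM => //; exact: bcos|exact: bdd_cst].
have bYs : bdd (fun w => Z w * sin (L w)) by apply: bddM => //; exact: bsin.
split.
  have Y0 : Ex P (fun w => (Z w * cos (L w) - c) * e i w) = 0.
    apply: halfline_orthogonal => //; last exact: atom.
    - move=> x.
      transitivity (Ex P (fun w => 2^-1 * (Z w * cos (x * psi i w + L w) + Z w * cos
        (- x * psi i w + L w)) - c * cos (x * psi i w))).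
        by apply: eq_Ex => w; rewrite mulNr !cosD cosN sinN; field.
      rewrite ExB; [|by apply: bddM; [exact: bdd_cst|exact: bddD]|by apply: bddM;
        [exact: bdd_cst|exact: bcos]].
      rewrite !ExZ; [|exact: bddD|exact: bcos].
      rewrite ExD// !Hc H1c sqrrN /c.
      rewrite [in X in X - _](_ : - ((x ^+ 2 * v i + V) / 2) = - (V / 2) + - (x ^+ 2 * v i / 2));
        last by field.
      by rewrite expRD; field.
    - move=> x.
      transitivity (Ex P (fun w => 2^-1 * (Z w * sin (x * psi i w + L w) - Z w * sin
        (- x * psi i w + L w)) - c * sin (x * psi i w))).
        by apply: eq_Ex => w; rewrite mulNr !sinD cosN sinN; field.
      rewrite ExB; [|by apply: bddM; [exact: bdd_cst|exact: bddB]|by apply: bddM;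
        [exact: bdd_cst|exact: bsin]].
      rewrite !ExZ; [|exact: bddB|exact: bsin].
      by rewrite ExB// !Hs H1s; ring.
  move: Y0; under eq_Ex do rewrite mulrBl.
  rewrite ExB; [|by apply: bddM => //; apply: bddM => //; exact: bcos|by apply: bddM => //;
    exact: bdd_cst].
  rewrite ExZ// => /eqP; rewrite subr_eq0 => /eqP H.
  rewrite big_cons -mulrA (mulrC (Ex P (e i))) -H.
  by apply: eq_Ex => w; rewrite big_cons mulrC mulrA [LHS]mulrC mulrA mulrC mulrA mulrAC.
have Y0 : Ex P (fun w => (Z w * sin (L w)) * e i w) = 0.
  apply: halfline_orthogonal => //; last exact: atom.
  - move=> x.
    transitivity (Ex P (fun w => 2^-1 * (Z w * sin (x * psi i w + L w) + Z w * sin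
      (- x * psi i w + L w)))).
      by apply: eq_Ex => w; rewrite mulNr !sinD cosN sinN; field.
    by rewrite ExZ; [rewrite ExD// !Hs; ring|exact: bddD].
  - move=> x.
    transitivity (Ex P (fun w => 2^-1 * (Z w * cos (- x * psi i w + L w) - Z w * cos
      (x * psi i w + L w)))).
      by apply: eq_Ex => w; rewrite mulNr !cosD cosN sinN; field.
    by rewrite ExZ; [rewrite ExB// !Hc sqrrN; ring|exact: bddB].
rewrite -[RHS]Y0; apply: eq_Ex => w; rewrite big_cons -/(Z w) -/(L w); ring.
Qed.

Lemma gaussian_halfline_independent s : uniq s -> all D s ->
  Ex P (fun w => \prod_(i <- s) e i w) = \prod_(i <- s) Ex P (e i).
Proof.
move=> us Ds; have := @joint_mixed s [::] (fun=> 0); rewrite cats0 => /(_ us Ds)[+ _].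
rewrite big_nil mul0r oppr0 expR0 mulr1 => <-.
by apply: eq_Ex => w; rewrite big_nil cos0 mulr1.
Qed.

End Independence.

(** * Percolation polynomials of trees *)

Section Tree.

Lemma gw_tree_rcons c u i : gw_tree c (rcons u i) <-> gw_tree c u /\ (i < c u)%N.
Proof.
split; last by case=> tu iu; exact: gw_child.
move e : (rcons u i) => v tv; case: tv e => [|u' i' tu' iu'].
  by move/(congr1 size); rewrite size_rcons.
by move/rcons_inj => [-> ->].
Qed.

Definition subtree (T : Type) (i : nat) (c : vertex -> T) : vertex -> T :=
  fun u => c (i :: u).

Lemma gw_tree_cons c i u :
  gw_tree c (i :: u) <-> (i < c [::])%N /\ gw_tree (subtree i c) u.
Proof.
elim/last_ind: u => [|u j IH].
  rewrite -[[:: i]]/(rcons [::] i) gw_tree_rcons.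
  by split=> [[]|[]] // *; split => //; exact: gw_root.
by rewrite -rcons_cons !gw_tree_rcons IH; split=> [[[]]|[? []]].
Qed.

Lemma gw_tree_cat c u v : gw_tree c u ->
  gw_tree c (u ++ v) <-> gw_tree (fun v => c (u ++ v)) v.
Proof.
move=> tu; elim/last_ind: v => [|v i IH].
  by rewrite cats0; split => // _; exact: gw_root.
by rewrite -rcons_cat !gw_tree_rcons IH.
Qed.

Lemma gw_tree_prefix c u v : prefix u v -> gw_tree c v -> gw_tree c u.
Proof.
move=> /prefixP[w ->]; elim/last_ind: w => [|w i IH]; first by rewrite cats0.
by rewrite -rcons_cat gw_tree_rcons => -[/IH].
Qed.

End Tree.

Section Perc.
Context (R : realType).
Implicit Types (e : vertex -> R) (c : vertex -> nat).

(** When [e u] is the probability that [u] is kept, independently of the other vertices,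
    [perc n e c] is the probability that the root is joined to level [n] by kept vertices. When
    [e] takes the values [0] and [1], it is the indicator of this event. *)
Fixpoint perc (n : nat) e c : R :=
  if n is n'.+1
  then e [::] * (1 - \prod_(i < c [::]) (1 - perc n' (subtree i e) (subtree i c)))
  else e [::].

Lemma perc_itv n e c : (forall u, 0 <= e u <= 1) -> 0 <= perc n e c <= 1.
Proof.
elim: n e c => [|n IH] e c e01 //=.
have /andP[e0 e1] := e01 [::].
have H : 0 <= \prod_(i < c [::]) (1 - perc n (subtree i e) (subtree i c)) <= 1.
  apply/andP; split.
    apply: prodr_ge0 => i _; have /andP[] := IH (subtree i e) (subtree i c)
      (fun u => e01 (nat_of_ord i :: u)).
    by move=> _; rewrite subr_ge0.
  apply: prodr_ile1 => i _; have /andP[a b] :=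
    IH (subtree i e) (subtree i c) (fun u => e01 (nat_of_ord i :: u)).
  by rewrite subr_ge0 b gerBl.
case/andP: H => a b; apply/andP; split; first by rewrite mulr_ge0// subr_ge0.
by rewrite mulr_ile1// ?subr_ge0// gerBl.
Qed.

Lemma le_perc n e e' c : (forall u, 0 <= e u) -> (forall u, e u <= e' u) ->
  (forall u, e' u <= 1) -> perc n e c <= perc n e' c.
Proof.
elim: n e e' c => [|n IH] e e' c e0 ee' e1 //=.
have h01 i : 0 <= perc n (subtree i e) (subtree i c) <= 1.
  by apply: perc_itv => u; rewrite e0 (le_trans (ee' _) (e1 _)).
have h01' i : 0 <= perc n (subtree i e') (subtree i c) <= 1.
  by apply: perc_itv => u; rewrite e1 (le_trans (e0 _) (ee' _)).
apply: ler_pM => //.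
  rewrite subr_ge0; apply: prodr_ile1 => i _.
  by have /andP[a b] := h01 i; rewrite subr_ge0 b gerBl.
rewrite lerB// ler_prod// => i _; rewrite subr_ge0; have /andP[_ ->] := h01' i.
by rewrite lerB// IH// => u; [exact: e0|exact: ee'|exact: e1].
Qed.

Lemma perc_decr n e c : (forall u, 0 <= e u <= 1) -> perc n.+1 e c <= perc n e c.
Proof.
elim: n e c => [|n IH] e c e01.
  have /andP[e0 e1] := e01 [::]; rewrite /= ler_piMr// gerBl prodr_ge0// => i _.
  by rewrite subr_ge0; case/andP: (e01 [:: nat_of_ord i]).
have /andP[e0 e1] := e01 [::].
rewrite [leLHS]/= [leRHS]/=; apply: ler_wpM2l => //; rewrite lerB// ler_prod// => i _.
have /andP[_ a] := @perc_itv n (subtree i e) (subtree i c) (fun u => e01 _).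
by rewrite subr_ge0 a lerB// IH// => u; exact: e01.
Qed.

(** Recovers an actual path of kept vertices from the polynomial. *)
Lemma perc_path n e c : perc n e c != 0 ->
  exists u, [/\ size u = n, gw_tree c u & forall p, prefix p u -> e p != 0].
Proof.
elim: n e c => [|n IH] e c /=.
  move=> e0; exists [::]; split => //; first exact: gw_root.
  by move=> p; rewrite prefixs0 => /eqP ->.
rewrite mulf_eq0 negb_or => /andP[e0 H].
have [i Hi] : exists i : 'I_(c [::]), perc n (subtree i e) (subtree i c) != 0.
  apply/existsP; apply: contraNT H => /existsPn H.
  rewrite big1 ?subrr// => i _; have /negPn/eqP -> := H i; exact: subr0.
have [u [su tu eu]] := IH _ _ Hi.
exists (nat_of_ord i :: u); split; first by rewrite /= su.
  by apply/gw_tree_cons; split.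
case=> // j p; rewrite prefix_cons => /andP[/eqP -> pu]; exact: eu.
Qed.

End Perc.

Section PercExpectation.
Context d (W : measurableType d) (R : realType) (P : probability W R).
Variables (D : vertex -> Prop) (e : vertex -> W -> R).
Hypothesis be : forall u, bdd (e u).
Hypothesis indep : forall s, uniq s -> (forall u, u \in s -> D u) ->
  Ex P (fun w => \prod_(u <- s) e u w) = \prod_(u <- s) Ex P (e u).

(** The labels in a product are distinct because independence evaluates the expectation of a
    product only when no factor is repeated; [S] records which labels occur. *)
Inductive multilinear (S : pred vertex) : (W -> R) -> Prop :=
| ml_prod s : uniq s -> all S s -> (forall u, u \in s -> D u) ->
    multilinear S (fun w => \prod_(u <- s) e u w)
| ml_add f g : multilinear S f -> multilinear S g -> multilinear S (fun w => f w + g w)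
| ml_scale a f : multilinear S f -> multilinear S (fun w => a * f w).

Lemma multilinear_bdd S f : multilinear S f -> bdd f.
Proof.
elim=> {f} [s _ _ _|f g _ bf _ bg|a f _ bf]; first exact: bdd_prod.
  exact: bddD.
by apply: bddM => //; exact: bdd_cst.
Qed.

Lemma multilinear_eq S f g : f =1 g -> multilinear S f -> multilinear S g.
Proof. by move=> /funext ->. Qed.

Lemma multilinear_cst S a : multilinear S (fun=> a).
Proof.
rewrite (_ : (fun=> a) = (fun w => a * \prod_(u <- [::]) e u w)).
  by apply: ml_scale; exact: ml_prod.
by apply/funext => w; rewrite big_nil mulr1.
Qed.

Lemma multilinear_sub (S S' : pred vertex) f : {subset S <= S'} ->
  multilinear S f -> multilinear S' f.
Proof.
move=> SS'; elim=> {f} [s us Ss Ds|f g _ bf _ bg|a f _ bf].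
- by apply: ml_prod => //; apply/allP => u /(allP Ss) /SS'.
- exact: ml_add.
- exact: ml_scale.
Qed.

(** Disjointness of the label sets keeps every product free of squares, so that each expectation
    factorises. *)
Lemma multilinearM (S S' : pred vertex) f g : [predI S & S'] =1 pred0 ->
  multilinear S f -> multilinear S' g ->
  multilinear [predU S & S'] (fun w => f w * g w) /\
  Ex P (fun w => f w * g w) = Ex P f * Ex P g.
Proof.
move=> SS' mf mg; have bg := multilinear_bdd mg.
elim: mf => {f} [s us Ss Ds|f1 f2 m1 [IH1 E1] m2 [IH2 E2]|a f m1 [IH E1]].
- elim: mg {bg} => {g} [s' us' Ss' Ds'|f1 f2 m1 [IH1 E1] m2 [IH2 E2]|a f m1 [IH E1]].
  + have uss : uniq (s ++ s').
      rewrite cat_uniq us us' andbT/=; apply/hasPn => u us2; apply/negP => us1.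
      by have := SS' u; rewrite /= !unfold_in (allP Ss _ us1) (allP Ss' _ us2).
    have Dss u : u \in s ++ s' -> D u by rewrite mem_cat => /orP[/Ds|/Ds'].
    have E : (fun w => \prod_(u <- s) e u w * \prod_(u <- s') e u w) =
      (fun w => \prod_(u <- s ++ s') e u w) by apply/funext => w; rewrite big_cat.
    split; last by rewrite E !indep// big_cat.
    rewrite E; apply: ml_prod => //; rewrite all_cat; apply/andP; split.
      by apply/allP => u us1; apply/orP; left; exact: (allP Ss).
    by apply/allP => u us1; apply/orP; right; exact: (allP Ss').
  + have bf := @bdd_prod _ W R _ s _ be.
    have b1 := multilinear_bdd m1; have b2 := multilinear_bdd m2.
    split; first by apply: (multilinear_eq _ (ml_add IH1 IH2)) => w; rewrite mulrDr.
    under eq_Ex do rewrite mulrDr.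
    by rewrite [LHS]ExD; [rewrite E1 E2 ExD// mulrDr|exact: bddM|exact: bddM].
  + have bf := @bdd_prod _ W R _ s _ be.
    have b1 := multilinear_bdd m1.
    split; first by apply: (multilinear_eq _ (ml_scale a IH)) => w; rewrite mulrCA.
    under eq_Ex do rewrite mulrCA.
    by rewrite [LHS]ExZ; [rewrite E1 ExZ//; ring|exact: bddM].
- have b1 := multilinear_bdd m1; have b2 := multilinear_bdd m2.
  split; first by apply: (multilinear_eq _ (ml_add IH1 IH2)) => w; rewrite mulrDl.
  under eq_Ex do rewrite mulrDl.
  by rewrite [LHS]ExD; [rewrite E1 E2 ExD// mulrDl|exact: bddM|exact: bddM].
- have b1 := multilinear_bdd m1.
  split; first by apply: (multilinear_eq _ (ml_scale a IH)) => w; rewrite mulrA.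
  under eq_Ex do rewrite -mulrA.
  by rewrite [LHS]ExZ; [rewrite E1 ExZ//; ring|exact: bddM].
Qed.

Variable c : vertex -> nat.

(** The factors of [perc] that belong to different children involve disjoint subtrees, and none
    of them involves the root. *)
Lemma perc_expectation n u :
  (forall v, gw_tree (fun v => c (u ++ v)) v -> D (u ++ v)) ->
  multilinear (prefix u) (fun w => perc n (fun v => e (u ++ v) w) (fun v => c (u ++ v))) /\
  Ex P (fun w => perc n (fun v => e (u ++ v) w) (fun v => c (u ++ v))) =
  perc n (fun v => Ex P (e (u ++ v))) (fun v => c (u ++ v)).
Proof.
elim: n u => [|n IH] u Du /=.
  rewrite cats0; split => //.
  have := @ml_prod (prefix u) [:: u]; rewrite /= prefix_refl => /(_ isT isT).
  under eq_fun do rewrite big_seq1; apply=> v; rewrite inE => /eqP ->.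
  by rewrite -(cats0 u); apply: Du; exact: gw_root.
rewrite cats0.
have shE (T : Type) (f : vertex -> T) i : subtree i (fun v => f (u ++ v)) =
  (fun v => f (rcons u i ++ v)).
  by apply/funext => v; rewrite /subtree cat_rcons.
have {}IH (i : nat) : (i < c u)%N ->
  multilinear (prefix (rcons u i)) (fun w => perc n (subtree i (fun v => e (u ++ v) w))
    (subtree i (fun v => c (u ++ v)))) /\
  Ex P (fun w => perc n (subtree i (fun v => e (u ++ v) w)) (subtree i (fun v => c (u ++ v)))) =
  perc n (subtree i (fun v => Ex P (e (u ++ v)))) (subtree i (fun v => c (u ++ v))).
  move=> ic; have := IH (rcons u i) _.
  have -> : (fun w => perc n (fun v => e (rcons u i ++ v) w) (fun v => c (rcons u i ++ v))) =
     (fun w => perc n (subtree i (fun v => e (u ++ v) w)) (subtree i (fun v => c (u ++ v)))).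
    by apply/funext => w; rewrite (shE _ (fun v => e v w)) (shE _ c).
  rewrite -(shE _ c) -(shE _ (fun v => Ex P (e v))); apply => v tv.
  rewrite cat_rcons; apply: Du; apply/gw_tree_cons; rewrite cats0; split => //.
pose f (i : nat) (w : W) := 1 - perc n (subtree i (fun v => e (u ++ v) w))
  (subtree i (fun v => c (u ++ v))).
pose x (i : nat) : R := 1 - perc n (subtree i (fun v => Ex P (e (u ++ v))))
  (subtree i (fun v => c (u ++ v))).
have Hf (i : nat) : (i < c u)%N -> multilinear (prefix (rcons u i)) (f i) /\ Ex P (f i) = x i.
  move=> /IH[m E]; split.
    have := ml_add (multilinear_cst (prefix (rcons u i)) 1) (ml_scale (-1) m).
    by congr multilinear; apply/funext => w; rewrite mulN1r.
  rewrite /f ExB ?Ex_cst ?E//; first exact: bdd_cst.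
  exact: multilinear_bdd m.
pose S k : pred vertex := fun v => has (fun i => prefix (rcons u i) v) (iota 0 k).
have Hprod k : (k <= c u)%N -> multilinear (S k) (fun w => \prod_(i < k) f i w) /\
    Ex P (fun w => \prod_(i < k) f i w) = \prod_(i < k) x i.
  elim: k => [_|k IHk kc].
    rewrite big_ord0; under eq_fun do rewrite big_ord0;
    by split; [exact: multilinear_cst|rewrite Ex_cst].
  have [m1 E1] := IHk (ltnW kc); have [m2 E2] := Hf k kc.
  have [|m E] := multilinearM _ m1 m2.
    move=> v /=; apply/negP => /andP[/hasP[i]]; rewrite mem_iota add0n => /andP[_ ik].
    move=> /prefixP[y ->]; rewrite !cat_rcons => /prefixP[z].
    rewrite cat_rcons => /eqP; rewrite eqseq_cat// eqxx /= => /eqP[ei _].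
    by rewrite ei ltnn in ik.
  under eq_fun do rewrite big_ord_recr;
  rewrite big_ord_recr /= E E1 E2; split => //.
  apply: multilinear_sub m => v /orP[/hasP[i ik vi]|vk]; apply/hasP.
    by exists i => //; move: ik; rewrite !mem_iota => /(leq_trans _); apply.
  by exists k => //; rewrite mem_iota /=.
have [m E] := Hprod _ (leqnn _).
have me : multilinear (pred1 u) (e u).
  have := @ml_prod (pred1 u) [:: u]; rewrite /= eqxx => /(_ isT isT).
  under eq_fun do rewrite big_seq1; apply=> v; rewrite inE => /eqP ->.
  by rewrite -(cats0 u); apply: Du; exact: gw_root.
have m1 : multilinear (S (c u)) (fun w => 1 - \prod_(i < c u) f i w).
  have := ml_add (multilinear_cst (S (c u)) 1) (ml_scale (-1) m).
  by congr multilinear; apply/funext => w; rewrite mulN1r.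
have [|mm EE] := multilinearM _ me m1.
  move=> v /=; apply/negP => /andP[/eqP -> /hasP[i _]].
  by move=> /size_prefix; rewrite size_rcons ltnn.
split.
  apply: multilinear_sub mm => v; rewrite !inE => /orP[/eqP ->|/hasP[i _]].
    by rewrite -topredE /= prefix_refl.
  by apply: prefix_trans; exact: prefix_rcons.
rewrite EE ExB ?Ex_cst ?E//; [exact: bdd_cst|exact: multilinear_bdd m].
Qed.

End PercExpectation.

(** * The measurable space of offspring configurations *)

(** An offspring number for every label, whether or not the label belongs to the tree; this
    makes the subtree at a label a shift of the configuration. *)
Definition config := vertex -> nat.

Definition cylinder (s : seq vertex) (B : vertex -> set nat) : set config :=
  [set c | forall u, u \in s -> B u (c u)].

Definition cylinders : set (set config) :=
  [set F | exists s B, F = cylinder s B].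

Definition configT := g_sigma_algebraType cylinders.

Lemma cylindersI : setI_closed cylinders.
Proof.
move=> _ _ [s [B ->]] [s' [B' ->]].
exists (s ++ s'), (fun u => [set k | (u \in s -> B u k) /\ (u \in s' -> B' u k)]).
apply/seteqP; split=> [c [cB cB'] u _|c H].
  by split=> [/cB|/cB'].
split=> u us; have [] := H u; rewrite ?mem_cat ?us ?orbT//.
  by move=> + _; exact.
by move=> _; exact.
Qed.

Lemma measurable_cylinder s B : measurable (cylinder s B : set configT).
Proof. by apply: sub_sigma_algebra; exists s, B. Qed.

Lemma measurable_coord u : measurable_fun setT (fun c : configT => c u).
Proof.
move=> _ B _; rewrite setTI.
have -> : (fun c : configT => c u) @^-1` B = cylinder [:: u] (fun=> B).
  apply/seteqP; split=> c /=; first by move=> cB v; rewrite inE => /eqP ->.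
  by apply; rewrite inE.
exact: measurable_cylinder.
Qed.

Lemma measurable_config d (W : measurableType d) (Phi : W -> configT) :
  (forall u, measurable_fun setT (fun w => Phi w u)) -> measurable_fun setT Phi.
Proof.
move=> mPhi; apply: (@measurability _ _ W configT setT Phi cylinders) => //.
move=> _ [_ [s [B ->]] <-]; rewrite setTI.
elim: s => [|u s IH].
  by rewrite (_ : _ @^-1` _ = setT)//; apply/seteqP; split.
rewrite (_ : _ @^-1` _ = (fun w => Phi w u) @^-1` (B u) `&` Phi @^-1` (cylinder s B)).
  by apply: measurableI => //; rewrite -[X in measurable X]setTI; exact: mPhi.
apply/seteqP; split=> w /=.
  by move=> H; split=> [|v vs]; apply: H; rewrite inE ?eqxx// vs orbT.
by move=> [Hu Hs] v; rewrite inE => /orP[/eqP ->//|/Hs].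
Qed.

Lemma measurable_subtree i : measurable_fun setT (@subtree nat i : configT -> configT).
Proof. by apply: measurable_config => u; exact: measurable_coord. Qed.

Lemma measurable_subconfig u :
  measurable_fun setT ((fun c v => c (u ++ v)) : configT -> configT).
Proof. by apply: measurable_config => v; exact: measurable_coord. Qed.

Lemma measurable_by_root d (T : measurableType d) (g : nat -> configT -> T) :
  (forall k, measurable_fun setT (g k)) -> measurable_fun setT (fun c : configT => g (c [::]) c).
Proof.
move=> mg _ B mB; rewrite setTI.
rewrite (_ : _ @^-1` _ = \bigcup_k ((fun c : configT => c [::]) @^-1` [set k] `&` g k @^-1` B)).
  apply: bigcupT_measurable => k; apply: measurableI.
    by rewrite -[X in measurable X]setTI; exact: measurable_coord.
  by rewrite -[X in measurable X]setTI; exact: mg.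
apply/seteqP; split=> c /=; first by move=> H; exists (c [::]).
by move=> [k _ [<-]].
Qed.

Section Extension.
Context d (W : measurableType d) (R : realType) (P : probability W R)
  (Q : probability configT R).
Variables (Phi : W -> configT) (Y : W -> R).
Hypothesis mPhi : measurable_fun setT Phi.
Hypothesis bY : bdd Y.

Let mpre F : measurable F -> measurable (Phi @^-1` F).
Proof. by move=> mF; rewrite -[X in measurable X]setTI; exact: mPhi. Qed.

Hypothesis cylE : forall s B,
  Ex P (fun w => \1_(cylinder s B) (Phi w) * Y w) = Ex Q \1_(cylinder s B) * Ex P Y.

Let bF F : measurable F -> bdd (fun w => \1_F (Phi w) : R).
Proof. by move=> mF; exact: (bdd_indic R (mpre mF)). Qed.

(** The sets that satisfy the product formula form a Dynkin system, and the cylinders are stable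
    under intersection. *)
Lemma extend_measurable (F : set configT) : measurable F ->
  Ex P (fun w => \1_F (Phi w) * Y w) = Ex Q \1_F * Ex P Y.
Proof.
have [M YM] := bY.2.
pose PP (S : set configT) := Ex P (fun w => \1_S (Phi w) * Y w) = Ex Q \1_S * Ex P Y.
apply: (@dynkin_induction _ configT cylinders PP) => //; rewrite /PP.
- exact: cylindersI.
- have := cylE [::] (fun=> setT); rewrite (_ : cylinder _ _ = setT)//.
  by apply/seteqP; split.
- by move=> _ [s [B ->]]; exact: cylE.
- move=> S mS HS.
  have E (c : configT) : \1_(~` S) c = 1 - \1_S c :> R.
    by rewrite !indicE in_setC; case: (c \in S); rewrite ?subrr ?subr0.
  under eq_Ex do rewrite E mulrBl mul1r.
  under [X in _ = X * _]eq_Ex do rewrite E.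
  rewrite ExB//; last by apply: bddM => //; exact: bF.
  rewrite HS ExB ?Ex_cst; [by ring|exact: bdd_cst|exact: bdd_indic].
- move=> {}F mF tF HF.
  have mU n : measurable (\bigcup_(k < n) F k) by exact: bigcup_measurable.
  have HU n : Ex P (fun w => \1_(\bigcup_(k < n) F k) (Phi w) * Y w) =
      Ex Q \1_(\bigcup_(k < n) F k) * Ex P Y.
    elim: n => [|n IH].
      rewrite bigcup_mkord big_ord0 indic0.
      under eq_Ex do rewrite mul0r.
      by rewrite Ex_cst (_ : Ex Q _ = 0) ?mul0r//; exact: Ex_cst.
    have E (c : configT) : \1_(\bigcup_(k < n.+1) F k) c =
        \1_(\bigcup_(k < n) F k) c + \1_(F n) c :> R.
      rewrite !bigcup_mkord big_ord_recr /= -!bigcup_mkord !indicE in_setU.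
      case Fn : (c \in F n); rewrite ?orbT ?orbF ?addr0//.
      rewrite memNset ?add0r// => -[k /= kn Fk].
      move: Fn => /set_mem Fn; have := tF k n I I (ex_intro _ c (conj Fk Fn)).
      by move=> kE; rewrite kE ltnn in kn.
    under eq_Ex do rewrite E mulrDl.
    under [X in _ = X * _]eq_Ex do rewrite E.
    rewrite !ExD ?IH ?HF ?mulrDl//; try exact: bdd_indic.
      by apply: bddM => //; exact: bF.
    by apply: bddM => //; exact: bF.
  have cvI (c : configT) : \1_(\bigcup_(k < n) F k) c @[n --> \oo] --> (\1_(\bigcup_k F k) c : R).
    apply: cvg_near_cst; case: (pselect ((\bigcup_k F k) c)) => [[k _ Fk]|nF].
      exists k.+1 => // n /= kn; rewrite !indicE !mem_set//; first by exists k.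
      by exists k.
    by apply: nearW => n; rewrite !indicE !memNset// => -[k _ Fk]; apply: nF; exists k.
  have l1 : Ex P (fun w => \1_(\bigcup_(k < n) F k) (Phi w) * Y w) @[n --> \oo] -->
      Ex P (fun w => \1_(\bigcup_k F k) (Phi w) * Y w).
    apply: (@Ex_dominated _ _ _ P _ _ M).
    - by move=> n; apply: (bddM (bF (mU n)) bY).1.
    - by apply: (bddM (bF _) bY).1; exact: bigcup_measurable.
    - by move=> n w; rewrite normrM (le_trans _ (YM w))// ler_piMl// indicE; case: (_ \in _);
        rewrite ?normr1 ?normr0.
    - by apply: nearW => w; apply: cvgM; [exact: cvI|exact: cvg_cst].
  have l2 : Ex Q \1_(\bigcup_(k < n) F k) * Ex P Y @[n --> \oo] -->
    Ex Q \1_(\bigcup_k F k) * Ex P Y.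
    apply: cvgM; last exact: cvg_cst.
    apply: (@Ex_dominated _ _ _ Q _ _ 1).
    - by move=> n; exact: measurable_indic.
    - by apply: measurable_indic; exact: bigcup_measurable.
    - by move=> n w; rewrite indicE; case: (_ \in _); rewrite ?normr1 ?normr0.
    - exact: nearW.
  apply: (cvg_unique _ l1) => //.
  by rewrite (funext HU).
Qed.

(** For [x >= 0], the integer part of [x], truncated at [n], as a sum of indicators. *)
Let step (n : nat) (x : R) : R := \sum_(j < n) (j.+1%:R <= x)%R%:R.

Let step_bound n x : 0 <= x -> (n%:R <= x -> step n x = n%:R) /\
  (x <= n%:R -> x - 1 <= step n x <= x).
Proof.
move=> x0; elim: n => [|n [IH1 IH2]].
  by rewrite /step big_ord0; split => // xn; apply/andP; split; lra.
rewrite /step big_ord_recr /= -/(step n x); split=> [nx|xn].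
  rewrite nx IH1; first by rewrite -natr1.
  by rewrite (le_trans _ nx)// ler_nat.
rewrite -natr1 in xn.
have [nx|nx] := leP n.+1%:R x; rewrite -natr1 in nx.
  by rewrite IH1 /= ?mulr1n; [apply/andP; split; lra|lra].
rewrite addr0; have [xn'|xn'] := leP x n%:R; first exact: IH2.
by rewrite IH1; [apply/andP; split; lra|lra].
Qed.

(** A function with values in [[0, 1]] is a uniform limit of finite combinations of indicators
    of its superlevel sets. *)
Lemma extend_Ex (f : configT -> R) : measurable_fun setT f -> (forall c, 0 <= f c <= 1) ->
  Ex P (fun w => f (Phi w) * Y w) = Ex Q f * Ex P Y.
Proof.
move=> mf f01; have [M YM] := bY.2.
pose A n (j : nat) : set configT := [set c | j.+1%:R <= n.+1%:R * f c].
have mA n j : measurable (A n j).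
  rewrite (_ : A n j = (fun c => n.+1%:R * f c) @^-1` `[j.+1%:R, +oo[); last first.
    by apply/seteqP; split=> c; rewrite /A /= in_itv/= andbT.
  rewrite -[X in measurable X]setTI.
  have : measurable_fun setT (fun c => n.+1%:R * f c) by exact: measurable_funM.
  by apply.
pose g n (c : configT) : R := \sum_(j < n.+1) n.+1%:R^-1 * \1_(A n j) c.
have gE n c : g n c = n.+1%:R^-1 * step n.+1 (n.+1%:R * f c).
  rewrite /g -mulr_sumr; congr (_ * _); apply: eq_bigr => j _.
  rewrite indicE; have -> // : (c \in A n j) = (j.+1%:R <= n.+1%:R * f c).
  by apply/idP/idP; rewrite inE.
have g_bound n c : f c - n.+1%:R^-1 <= g n c <= f c.
  have /andP[f0 f1] := f01 c.
  have [_] := @step_bound n.+1 (n.+1%:R * f c) (mulr_ge0 (ler0n _ _) f0).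
  rewrite ler_piMr// => /(_ isT) /andP[a b]; rewrite gE; apply/andP; split.
    rewrite -[leLHS](mulKf (x := n.+1%:R))// ler_wpM2l ?invr_ge0// mulrBr mulfV//.
  by rewrite ler_pdivrMl// b.
have bA n j : bdd (\1_(A n j) : configT -> R) by exact: bdd_indic.
have bg n : bdd (g n) by apply: bdd_sum => j; apply: bddM => //; exact: bdd_cst.
have gcv c : g n c @[n --> \oo] --> f c.
  apply: (@squeeze_cvgr _ _ _ _ (fun n => f c - n.+1%:R^-1) (cst (f c))).
  - by apply: nearW => n; exact: g_bound.
  - rewrite -[X in _ --> X]subr0; apply: cvgB; first exact: cvg_cst.
    exact: cvg_harmonic.
  - exact: cvg_cst.
have g1 n c : `|g n c| <= 1.
  rewrite ger0_norm; last by apply: sumr_ge0 => j _; rewrite mulr_ge0// ?invr_ge0 ?indicE.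
  by have /andP[_ /le_trans] := g_bound n c; apply; case/andP: (f01 c).
have Hg n : Ex P (fun w => g n (Phi w) * Y w) = Ex Q (g n) * Ex P Y.
  transitivity (Ex P (fun w => \sum_(j < n.+1) n.+1%:R^-1 * (\1_(A n j) (Phi w) * Y w))).
    by apply: eq_Ex => w; rewrite /g mulr_suml; apply: eq_bigr => j _; rewrite mulrA.
  have bAY j : bdd (fun w => \1_(A n j) (Phi w) * Y w) by apply: bddM => //; exact: bF.
  rewrite Ex_sum; last by move=> j; apply: bddM => //; exact: bdd_cst.
  rewrite /g Ex_sum; last by move=> j; apply: bddM => //; exact: bdd_cst.
  rewrite mulr_suml; apply: eq_bigr => j _.
  by rewrite !ExZ// extend_measurable// mulrA.
have l1 : Ex P (fun w => g n (Phi w) * Y w) @[n --> \oo] --> Ex P (fun w => f (Phi w) * Y w).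
  apply: (@Ex_dominated _ _ _ P _ _ M).
  - by move=> n; apply: measurable_funM; [exact: (measurableT_comp (bg n).1)|exact: bY.1].
  - by apply: measurable_funM; [exact: measurableT_comp|exact: bY.1].
  - by move=> n w; rewrite normrM (le_trans _ (YM w))// ler_piMl.
  - by apply: nearW => w; apply: cvgM; [exact: gcv|exact: cvg_cst].
have l2 : Ex Q (g n) * Ex P Y @[n --> \oo] --> Ex Q f * Ex P Y.
  apply: cvgM; last exact: cvg_cst.
  apply: (@Ex_dominated _ _ _ Q _ _ 1) => //.
  - by move=> n; exact: (bg n).1.
  - by apply: nearW.
apply: (cvg_unique _ l1) => //.
by rewrite (funext Hg).
Qed.

End Extension.

(** * Independence of subtrees and fixed points of the generating function *)

Lemma indic_mul_iff (R : pzRingType) (T U V : Type) (A : set T) (B : set U) (C : set V) x y z :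
  (A x /\ B y <-> C z) -> \1_A x * \1_B y = \1_C z :> R.
Proof.
move=> H; rewrite !indicE -natrM mulnb.
have -> // : (x \in A) && (y \in B) = (z \in C).
by apply/andP/idP => [[]|]; rewrite !inE; [move=> a b; apply/H|move/H].
Qed.

Section GWIndependence.
Context (R : realType) (Q : probability configT R) (nu : probability nat R).
Hypothesis Qcyl : forall s B, uniq s ->
  (Q (cylinder s B) = \prod_(u <- s) nu (B u))%E.

Let nuR (B : set nat) : R := fine (nu B).

Let ExQcyl s B : uniq s -> Ex Q \1_(cylinder s B) = \prod_(u <- s) nuR (B u).
Proof.
move=> us; apply: EFin_inj; rewrite Ex_indic ?Qcyl//; last exact: measurable_cylinder.
elim: s {us} => [|u s IH]; first by rewrite !big_nil.
by rewrite !big_cons IH EFinM fineK// fin_num_measure.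
Qed.

(** The label lies outside the subtrees of the first [j] children of the root; the root itself
    qualifies. *)
Definition avoids (j : nat) (u : vertex) := if u is i :: _ then (j <= i)%N else true.

(** A cylinder of the subtree of child [j] is a cylinder of the whole configuration on labels
    starting with [j], none of which is in [s]. The second conclusion absorbs it into the
    cylinder on [s], which lets [subtrees_indep] proceed child by child. *)
Lemma cylinder_indep j s B s' B' : uniq s -> all (avoids j.+1) s ->
  Ex Q (fun c => \1_(cylinder s' B') (subtree j c) * \1_(cylinder s B) c) =
  Ex Q \1_(cylinder s' B') * Ex Q \1_(cylinder s B) /\
  exists s2 B2, [/\ uniq s2, all (avoids j) s2 &
   forall c, \1_(cylinder s' B') (subtree j c) * \1_(cylinder s B) c = \1_(cylinder s2 B2) c :> R].
Proof.
move=> us /allP as_.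
have -> : cylinder s' B' = cylinder (undup s') B'.
  by apply/seteqP; split=> c H u us'; apply: H; move: us'; rewrite mem_undup.
have us' := undup_uniq s'; move: (undup s') us' => {}s' us'.
pose s2 := map (cons j) s' ++ s.
pose B2 u := if u is i :: u' then (if i == j then B' u' else B u) else B u.
have u2 : uniq s2.
  rewrite cat_uniq map_inj_uniq; last by move=> x y [].
  rewrite us' us andbT /=; apply/hasPn => u /as_ au; apply/negP => /mapP[v _ uv].
  by rewrite uv /= ltnn in au.
have B2s u : u \in s -> B2 u = B u.
  by move=> /as_; case: u => //= i u; case: eqP => // ->; rewrite ltnn.
have E (c : configT) : \1_(cylinder s' B') (subtree j c) * \1_(cylinder s B) c =
  \1_(cylinder s2 B2) c :> R.
  apply: indic_mul_iff; split.
    move=> [H1 H2] u; rewrite mem_cat => /orP[/mapP[v vs ->]|us2].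
      by rewrite /= eqxx; exact: H1.
    by rewrite B2s//; exact: H2.
  move=> H; split=> u uu.
    have /= := H (j :: u); rewrite eqxx; apply.
    by rewrite mem_cat map_f.
  by rewrite -B2s//; apply: H; rewrite mem_cat uu orbT.
split; last first.
  exists s2, B2; split => //; rewrite all_cat; apply/andP; split.
    by apply/allP => _ /mapP[v _ ->] /=.
  by apply/allP => u /as_; case: u => //= i _ /ltnW.
rewrite (@eq_Ex _ _ _ Q _ _ E) !ExQcyl// big_cat big_map; congr (_ * _).
  by apply: eq_bigr => u _; rewrite /= eqxx.
by rewrite big_seq [RHS]big_seq; apply: eq_bigr => u us2; rewrite B2s.
Qed.

(** The children are removed in decreasing order. The factor of child [j] is replaced by its
    expectation with [extend_Ex], which only needs cylinders. *)
Lemma subtrees_indep (f : configT -> R) j s B : measurable_fun setT f ->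
  (forall c, 0 <= f c <= 1) -> uniq s -> all (avoids j) s ->
  Ex Q (fun c => \prod_(i < j) f (subtree i c) * \1_(cylinder s B) c) =
  Ex Q f ^+ j * Ex Q \1_(cylinder s B).
Proof.
move=> mf f01; have bf i : bdd (fun c : configT => f (subtree i c)).
  split; first exact: (measurableT_comp mf (measurable_subtree i)).
  by exists 1 => c; have /andP[a b] := f01 (subtree i c); rewrite ger0_norm.
have bcyl s' B' : bdd (\1_(cylinder s' B') : configT -> R).
  by apply: bdd_indic; exact: measurable_cylinder.
have bpr k : bdd (fun c : configT => \prod_(i < k) f (subtree i c)).
  by apply: bdd_prod => i; exact: bf.
elim: j s B => [|j IH] s B us as_.
  by rewrite expr0 mul1r; apply: eq_Ex => c; rewrite big_ord0 mul1r.
have as' : all (avoids j) s by apply/allP => u /(allP as_); case: u => //= i _ /ltnW.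
pose Y (c : configT) : R := \prod_(i < j) f (subtree i c) * \1_(cylinder s B) c.
have bY : bdd Y by exact: bddM.
transitivity (Ex Q (fun c => f (subtree j c) * Y c)).
  by apply: eq_Ex => c; rewrite big_ord_recr /= /Y; ring.
rewrite (@extend_Ex _ _ _ Q Q (@subtree nat j) Y (measurable_subtree j) bY _ f mf f01).
  by rewrite /Y IH// exprS mulrA.
move=> s' B'; have [E [s2 [B2 [us2 as2 E2]]]] := @cylinder_indep j s B s' B' us as_.
transitivity (Ex Q (fun c => \prod_(i < j) f (subtree i c) * \1_(cylinder s2 B2) c)).
  by apply: eq_Ex => c; rewrite -E2 /Y mulrCA.
by rewrite IH// /Y IH// -(@eq_Ex _ _ _ Q _ _ E2) E mulrCA.
Qed.

Lemma subtrees_indep_root (f : configT -> R) k : measurable_fun setT f ->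
  (forall c, 0 <= f c <= 1) ->
  Ex Q (fun c => \prod_(i < k) f (subtree i c) * \1_[set c | c [::] = k] c) =
  Ex Q f ^+ k * nuR [set k].
Proof.
move=> mf f01.
have E : [set c | c [::] = k] = cylinder [:: [::]] (fun=> [set k]).
  by apply/seteqP; split=> c /=; [move=> ck u; rewrite inE => /eqP ->|apply; rewrite inE].
by rewrite E subtrees_indep//= ExQcyl// big_seq1.
Qed.

Lemma measurable_root k : measurable ([set c | c [::] = k] : set configT).
Proof.
rewrite (_ : [set c | _] = (fun c : configT => c [::]) @^-1` [set k])//.
by rewrite -[X in measurable X]setTI; exact: measurable_coord.
Qed.

(** Conditionally on the root having [k] children, a property inherited from the subtrees has
    probability [q ^+ k] when [q] is its probability. The partial sums are the probabilities of
    [F] with fewer than [n] children. *)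
Lemma hereditary_fixed_point (F : set configT) : measurable F ->
  (forall c, F c <-> forall i, (i < c [::])%N -> F (subtree i c)) ->
  (\sum_(k < n) nuR [set nat_of_ord k] * Ex Q \1_F ^+ k) @[n --> \oo] --> Ex Q \1_F.
Proof.
move=> mF HF.
have bF : bdd (\1_F : configT -> R) by exact: bdd_indic.
have E n (c : configT) : \1_F c * \1_[set c | (c [::] < n)%N] c =
  \sum_(k < n) (\prod_(i < k) \1_F (subtree i c) * \1_[set c | c [::] = k :> nat] c) :> R.
  have prodE k : c [::] = k -> \prod_(i < k) \1_F (subtree i c) = \1_F c :> R.
    move=> ck; rewrite [RHS]indicE; have [/set_mem Fc|/negP nF] := boolP (c \in F).
      by rewrite big1// => i _; rewrite indicE mem_set//; apply: (HF c).1; rewrite ?ck.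
    apply/eqP; rewrite prodf_seq_eq0; apply/hasP.
    have /existsNP[i /not_implyP[ic Fi]] : ~ forall i, (i < c [::])%N -> F (subtree i c).
      by move=> /HF Fc; apply: nF; exact: mem_set.
    rewrite ck in ic; exists (Ordinal ic); first exact: mem_index_enum.
    by rewrite /= indicE memNset.
  have [cn|cn] := ltnP (c [::]) n.
    rewrite (bigD1 (Ordinal cn))//= [in X in _ + X]big1 ?addr0.
      by rewrite prodE//; congr (_ * _); rewrite !indicE !mem_set.
    move=> i /eqP ic; rewrite [X in _ * X]indicE memNset ?mulr0//= => cE; apply: ic.
    by apply/val_inj.
  rewrite [X in _ * X]indicE memNset ?mulr0 /=; last by apply/negP; rewrite -leqNgt.
  rewrite big1// => i _; rewrite [X in _ * X]indicE memNset ?mulr0//= => cE.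
  by have := ltn_ord i; rewrite -cE ltnNge cn.
have mT n : measurable ([set c | (c [::] < n)%N] : set configT).
  rewrite (_ : [set c | (c [::] < n)%N] = (fun c : configT => c [::]) @^-1` [set k | (k < n)%N])//.
  by rewrite -[X in measurable X]setTI; exact: measurable_coord.
have bprod (k : nat) : bdd (fun c : configT =>
  \prod_(i < k) \1_F (subtree i c) * \1_[set c | c [::] = k] c : R).
  apply: bddM; last by apply: bdd_indic; exact: measurable_root.
  apply: bdd_prod => i; split; first exact: (measurableT_comp bF.1 (measurable_subtree i)).
  by exists 1 => c; rewrite indicE; case: (_ \in _); rewrite ?normr1 ?normr0.
have S n : Ex Q (fun c => \1_F c * \1_[set c | (c [::] < n)%N] c) =
  \sum_(k < n) nuR [set nat_of_ord k] * Ex Q \1_F ^+ k.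
  rewrite (@eq_Ex _ _ _ Q _ _ (E n)) Ex_sum; last by move=> k; exact: bprod.
  apply: eq_bigr => k _; rewrite [RHS]mulrC.
  apply: (@subtrees_indep_root _ k bF.1) => c.
  by rewrite indicE; case: (_ \in _); rewrite ?lexx ler01.
rewrite -(funext S).
apply: (@Ex_dominated _ _ _ Q _ _ 1).
- by move=> n; apply: (bddM bF _).1; exact: bdd_indic.
- exact: bF.1.
- move=> n c; rewrite !indicE -natrM mulnb; case: (_ && _); by rewrite ?normr1 ?normr0.
- apply: nearW => c; apply: cvg_near_cst; exists (c [::]).+1 => // n /= cn.
  by rewrite [X in _ * X]indicE mem_set ?mulr1.
Qed.

End GWIndependence.

(** If [e < x], the three fixed points [e], [x] and [1] are one too many for a strictly convex
    function. The gap [g k], scaled by [1 - e], between the chord of [y ^+ k] over [[e, 1]],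
    taken at [x], and [x ^+ k] satisfies [g (k+1) = x g k + (1 - x) (x - e) (1 - e ^+ k)], so it
    is nonnegative and positive for [k > 1]; yet the [a k]-average of [g] vanishes when all
    three points are fixed. *)
Lemma generating_function_fixed_point_unique (R : realType) (a : nat -> R) (e x : R) :
  (forall k, 0 <= a k) -> (exists2 k, (1 < k)%N & 0 < a k) ->
  0 <= e -> e <= x -> x < 1 ->
  (\sum_(k < n) a k) @[n --> \oo] --> (1 : R) ->
  (\sum_(k < n) a k * e ^+ k) @[n --> \oo] --> e ->
  (\sum_(k < n) a k * x ^+ k) @[n --> \oo] --> x ->
  e = x.
Proof.
move=> a0 [k0 k01 ak0] e0 ex x1 c1 ce cx; apply/eqP; rewrite eq_le ex /=.
rewrite leNgt; apply/negP => lt_ex.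
pose g k := (1 - x) * e ^+ k + (x - e) - (1 - e) * x ^+ k.
have gS k : g k.+1 = x * g k + (1 - x) * (x - e) * (1 - e ^+ k).
  by rewrite /g !exprS; ring.
have e1 k : e ^+ k <= 1 by rewrite exprn_ile1// (le_trans ex)// ltW.
have x0 : 0 < x by exact: le_lt_trans lt_ex.
have c0 : 0 < (1 - x) * (x - e) by rewrite mulr_gt0 ?subr_gt0.
have g0 k : 0 <= g k.
  elim: k => [|k IH]; first by rewrite /g !expr0; lra.
  have h1 : 0 <= x * g k by rewrite mulr_ge0// ltW.
  have h2 : 0 <= (1 - x) * (x - e) * (1 - e ^+ k).
    by rewrite mulr_ge0 ?subr_ge0//; exact: ltW.
  by rewrite gS addr_ge0.
have gk0 : 0 < g k0.
  case: k0 k01 {ak0} => // k k1; rewrite gS ltr_wpDl//.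
    by rewrite mulr_ge0// ltW.
  rewrite mulr_gt0// subr_gt0 exprn_ilt1//; last exact: lt_trans lt_ex x1.
  by case: k k1.
have H : \sum_(k < n) a k * g k @[n --> \oo] --> (1 - x) * e + (x - e) * 1 - (1 - e) * x.
  have -> : (fun n => \sum_(k < n) a k * g k) =
    (fun n => (1 - x) * (\sum_(k < n) a k * e ^+ k) + (x - e) * (\sum_(k < n) a k) - (1 - e) *
      (\sum_(k < n) a k * x ^+ k)).
    apply/funext => n; rewrite !mulr_sumr -big_split /= -sumrB; apply: eq_bigr => k _.
    by rewrite /g; ring.
  by apply: cvgB; [apply: cvgD|]; apply: cvgM => //; exact: cvg_cst.
have L : a k0 * g k0 <= (1 - x) * e + (x - e) * 1 - (1 - e) * x.
  rewrite -(cvg_lim _ H)//; apply: limr_ge; first by apply/cvg_ex; eexists; exact: H.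
  exists k0.+1 => // n /= kn.
  rewrite (bigD1 (Ordinal kn))//= lerDl sumr_ge0// => i _.
  by rewrite mulr_ge0.
have : 0 < a k0 * g k0 by rewrite mulr_gt0.
by lra.
Qed.

(** * Survival of the thinned Galton-Watson tree *)

Section Thinning.
Context (R : realType).
Variable r : nat -> R.
Hypothesis r01 : forall k, 0 <= r k <= 1.

(** The conditional probability, given the tree, that the root is joined to level [n] when a
    vertex with [k] children is kept with probability [r k]. *)
Definition theta n (c : config) : R := perc n (r \o c) c.

Lemma theta_itv n c : 0 <= theta n c <= 1.
Proof. by apply: perc_itv => u; exact: r01. Qed.

Lemma theta_nonincreasing c : nonincreasing_seq (theta ^~ c).
Proof. by apply/nonincreasing_seqP => n; apply: perc_decr => u; exact: r01. Qed.

Definition theta_lim (c : config) : R := lim (theta n c @[n --> \oo]).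

Lemma theta_cvg c : theta n c @[n --> \oo] --> theta_lim c.
Proof.
apply: nonincreasing_is_cvgn; first exact: theta_nonincreasing.
by exists 0 => _ [n _ <-]; case/andP: (theta_itv n c).
Qed.

Lemma theta_lim_ge0 c : 0 <= theta_lim c.
Proof.
apply: limr_ge; first by apply/cvg_ex; eexists; exact: theta_cvg.
by apply: nearW => n; case/andP: (theta_itv n c).
Qed.

Lemma theta_lim_le n c : theta_lim c <= theta n c.
Proof.
apply: nonincreasing_cvgn_ge; first exact: theta_nonincreasing.
by apply/cvg_ex; eexists; exact: theta_cvg.
Qed.

Lemma thetaS n c : theta n.+1 c =
  r (c [::]) * (1 - \prod_(i < c [::]) (1 - theta n (subtree i c))).
Proof. by []. Qed.

(** If the cluster of no child can be infinite, neither can that of the root, which has finitely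
    many children. *)
Lemma theta_lim0 c : (forall i, (i < c [::])%N -> theta_lim (subtree i c) = 0) -> theta_lim c = 0.
Proof.
move=> H.
have cvP k : (forall i, (i < k)%N -> theta_lim (subtree i c) = 0) ->
    \prod_(i < k) (1 - theta n (subtree i c)) @[n --> \oo] --> (1 : R).
  elim: k => [_|k IH H0].
    by under eq_fun do rewrite big_ord0; exact: cvg_cst.
  rewrite (_ : (fun n => _) = (fun n => \prod_(i < k) (1 - theta n (subtree i c)) *
    (1 - theta n (subtree k c)))); last first.
    by apply/funext => n; rewrite big_ord_recr.
  rewrite -[X in _ --> X](mulr1 1); apply: cvgM; first by apply: IH => i ik; apply: H0; exact: ltnW.
  rewrite -[X in _ --> X](subr0 1); apply: cvgB; first exact: cvg_cst.
  by rewrite -(H0 k (ltnSn k)); exact: theta_cvg.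
have cvS : theta n.+1 c @[n --> \oo] --> theta_lim c.
  by rewrite (@cvg_shiftS _ (theta ^~ c)); exact: theta_cvg.
suff c0 : theta n.+1 c @[n --> \oo] --> (0 : R) by exact: (cvg_unique _ cvS c0).
rewrite -[X in _ --> X](mulr0 (r (c [::]))); apply: cvgM; first exact: cvg_cst.
rewrite -[X in _ --> X](subrr 1); apply: cvgB; first exact: cvg_cst.
exact: cvP.
Qed.

Lemma measurable_theta n : measurable_fun setT (theta n : configT -> R).
Proof.
elim: n => [|n IH].
  exact: (measurableT_comp (f := r) _ (measurable_coord [::])).
apply: (@measurable_by_root _ _ (fun k c => r k *
  (1 - \prod_(i < k) (1 - theta n (subtree i c))))) => k.
apply: measurable_funM => //; apply: measurable_funB => //.
elim: k => [|k IHk].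
  rewrite (_ : (fun x : configT => _) = cst 1); first exact: measurable_cst.
  by apply/funext => c; rewrite big_ord0.
rewrite (_ : (fun x : configT => _) = (fun x =>
  \prod_(i < k) (1 - theta n (subtree i x)) * (1 - theta n (subtree k x)))); last first.
  by apply/funext => c; rewrite big_ord_recr.
apply: measurable_funM => //.
by apply: measurable_funB => //; exact: (measurableT_comp IH (measurable_subtree k)).
Qed.

Lemma measurable_theta_lim : measurable_fun setT (theta_lim : configT -> R).
Proof.
by apply: (measurable_fun_cvg measurable_theta) => c _; exact: theta_cvg.
Qed.

(** All subtrees are required to die out, not only the whole tree: when [r] vanishes at the
    number of children of the root, the whole thinned tree dies although a subtree may survive.
    In this form the property is inherited from the subtrees. *)
Definition dies : set configT :=
  [set c | forall u, gw_tree c u -> theta_lim (fun v => c (u ++ v)) = 0].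

(** Extinction, in a form that involves each vertex separately and is therefore measurable. *)
Definition bounded_height : set configT :=
  [set c | exists n, forall u, gw_tree c u -> (size u < n)%N].

Lemma dies_hereditary c : dies c <-> forall i, (i < c [::])%N -> dies (subtree i c).
Proof.
split=> [H i ic u tu|H].
  by apply: (H (i :: u)); apply/gw_tree_cons.
have H0 i u : (i < c [::])%N -> gw_tree (subtree i c) u -> theta_lim (fun v => c (i :: u ++ v)) = 0.
  by move=> /H; apply.
case=> [|i u] tu; last by have /gw_tree_cons[ic tu'] := tu; exact: H0.
by apply: theta_lim0 => i ic; apply: (H0 i [::] ic); exact: gw_root.
Qed.

Lemma bounded_height_hereditary c :
  bounded_height c <-> forall i, (i < c [::])%N -> bounded_height (subtree i c).
Proof.
split=> [[n H] i ic|H].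
  by exists n => u tu; apply: ltnW; apply: (H (i :: u)); apply/gw_tree_cons.
have /choice[f Hf] : forall i, exists n, (i < c [::])%N -> forall u, gw_tree (subtree i c) u ->
  (size u < n)%N.
  by move=> i; have [/H[n Hn]|_] := ltnP i (c [::]); [exists n|exists 0%N].
exists (\max_(i < c [::]) f i).+1; case=> [//|i u] /gw_tree_cons[ic tu] /=.
rewrite ltnS; apply: (leq_trans (Hf i ic u tu)).
exact: (leq_bigmax (Ordinal ic)).
Qed.

Lemma measurable_gw_tree u : measurable ([set c | gw_tree c u] : set configT).
Proof.
elim/last_ind: u => [|u i IH].
  by rewrite (_ : [set c | _] = setT)//; apply/seteqP; split => // c _; exact: gw_root.
rewrite (_ : [set c | _] = [set c | gw_tree c u] `&` (fun c : configT => c u) @^-1`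
  [set k | (i < k)%N]).
  by apply: measurableI => //; rewrite -[X in measurable X]setTI; exact: measurable_coord.
by apply/seteqP; split=> c /gw_tree_rcons.
Qed.

Lemma measurable_bigcap_vertex (F : vertex -> set configT) :
  (forall u, measurable (F u)) -> measurable (\bigcap_u F u).
Proof.
move=> mF.
rewrite (_ : \bigcap_u F u = \bigcap_k (if choice.unpickle k is Some u then F u else setT)).
  by apply: bigcapT_measurable => k; case: choice.unpickle.
apply/seteqP; split=> c H.
  by move=> k _; case: choice.unpickle => // u; exact: H.
by move=> u _; have := H (choice.pickle u) I; rewrite choice.pickleK.
Qed.

Lemma measurable_dies : measurable dies.
Proof.
rewrite (_ : dies = \bigcap_u (~` [set c | gw_tree c u] `|` (theta_lim \o (fun c v => c (u ++ v)))
  @^-1` [set 0])).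
  apply: measurable_bigcap_vertex => u; apply: measurableU.
    by apply: measurableC; exact: measurable_gw_tree.
  rewrite -[X in measurable X]setTI.
  exact: (measurableT_comp measurable_theta_lim (measurable_subconfig u)).
apply/seteqP; split=> c H u.
  by move=> _; case: (pselect (gw_tree c u)) => tu; [right; exact: H|left].
by move=> tu; have [|] := H u I.
Qed.

Lemma measurable_bounded_height : measurable bounded_height.
Proof.
rewrite (_ : bounded_height = \bigcup_n \bigcap_u
  (~` [set c | gw_tree c u] `|` [set _ | (size u < n)%N])).
  apply: bigcupT_measurable => n; apply: measurable_bigcap_vertex => u; apply: measurableU.
    by apply: measurableC; exact: measurable_gw_tree.
  case: (ltnP (size u) n) => H.
    by rewrite (_ : [set _ | _] = setT)//; apply/seteqP; split.
  by rewrite (_ : [set _ | _] = set0)//; apply/seteqP; split.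
apply/seteqP; split=> [c [n H]|c [n _ H]]; exists n => //.
  by move=> u _; case: (pselect (gw_tree c u)) => tu; [right; exact: H|left].
by move=> u tu; have [|] := H u I.
Qed.

Lemma bounded_height_dies : bounded_height `<=` dies.
Proof.
move=> c [n H] u tu; apply/eqP; rewrite eq_le theta_lim_ge0 andbT.
rewrite (le_trans (theta_lim_le n _))//.
rewrite le_eqVlt; apply/orP; left; apply: contraT => /perc_path[v [sv tv _]].
have /H : gw_tree c (u ++ v) by apply/(gw_tree_cat _ tu).
by rewrite size_cat sv ltnNge leq_addl.
Qed.

End Thinning.

Lemma bounded_height_finite c : bounded_height c -> finite_set (gw_tree c).
Proof.
move=> [n]; elim: n c => [|n IH] c H; first by have := H [::] (gw_root c).
apply: (@sub_finite_set _ _ ([set [::]] `|` \bigcup_(i in `I_(c [::]))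
  (cons i @` gw_tree (subtree i c)))).
  case=> [|i u] tu; first by left.
  by right; have /gw_tree_cons[ic tu'] := tu; exists i => //; exists u.
rewrite finite_setU; split; first exact: finite_set1.
apply: bigcup_finite => // i ic; apply: finite_image; apply: IH => u tu.
by apply: (H (i :: u)); apply/gw_tree_cons.
Qed.

Section GWSurvival.
Context (R : realType) (Q : probability configT R) (nu : probability nat R).
Hypothesis Qcyl : forall s B, uniq s ->
  (Q (cylinder s B) = \prod_(u <- s) nu (B u))%E.
Variables (rho : R) (K : nat).
Hypothesis rho01 : 0 < rho <= 1.
Let a k : R := fine (nu [set k]).
Hypothesis supercritical : 1 < rho * \sum_(k < K.+1) k%:R * a k.
Let r (k : nat) : R := if (k <= K)%N then rho else 0.

Let r01 k : 0 <= r k <= 1.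
Proof. by rewrite /r; case: ifP => _; rewrite ?lexx ?ler01//; case/andP: rho01 => /ltW ->. Qed.

Let a0 k : 0 <= a k. Proof. exact: fine_ge0. Qed.

Let t n := Ex Q (theta r n).

Let btheta n : bdd (theta r n : configT -> R).
Proof.
split; first exact: measurable_theta.
by exists 1 => c; have /andP[x0 x1] := theta_itv r01 n c; rewrite ger0_norm.
Qed.

Let t01 n : 0 <= t n <= 1.
Proof.
apply/andP; split; first by apply: Ex_ge0 => c; case/andP: (theta_itv r01 n c).
rewrite -(Ex_cst Q 1); apply: le_Ex => //; first exact: bdd_cst.
by move=> c; case/andP: (theta_itv r01 n c).
Qed.

Let Ex_root k : Ex Q \1_[set c | c [::] = k] = a k.
Proof.
have := @subtrees_indep_root R Q nu Qcyl (cst 1) k; rewrite Ex_cst expr1n mul1r -/(a k) => <-//.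
  by apply: eq_Ex => c; rewrite big1 ?mul1r.
by move=> c; rewrite /= ler01 lexx.
Qed.

Let by_root n (g : nat -> configT -> R) c :
  \sum_(k < n) (g k c * \1_[set c | c [::] = k :> nat] c) =
  if (c [::] < n)%N then g (c [::]) c else 0.
Proof.
have [cn|cn] := ltnP (c [::]) n.
  rewrite (bigD1 (Ordinal cn))//= big1 ?addr0.
    by rewrite indicE mem_set// mulr1.
  move=> i /eqP ic; rewrite indicE memNset ?mulr0//= => cE; apply: ic.
  by apply/val_inj.
rewrite big1// => i _; rewrite indicE memNset ?mulr0//= => cE.
by have := ltn_ord i; rewrite -cE ltnNge cn.
Qed.

Let bI k : bdd (\1_[set c | c [::] = k] : configT -> R).
Proof. by apply: bdd_indic; exact: measurable_root. Qed.

Lemma annealed_root : t 0 = \sum_(k < K.+1) rho * a k.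
Proof.
transitivity (Ex Q (fun c => \sum_(k < K.+1) rho * \1_[set c | c [::] = k :> nat] c)).
  by apply: eq_Ex => c; rewrite (@by_root _ (fun _ _ => rho)) /theta /= /r ltnS.
rewrite Ex_sum; last by move=> k; apply: bddM; [exact: bdd_cst|exact: (bI k)].
by apply: eq_bigr => k _; rewrite ExZ ?Ex_root//; exact: (bI k).
Qed.

(** One generation of the thinned tree: the root has [k] children with probability [a k], is
    kept with probability [rho] if [k <= K], and is joined to level [n.+1] unless all the
    independent subtrees fail to reach level [n]. *)
Lemma annealed_step n : t n.+1 = \sum_(k < K.+1) rho * (a k * (1 - (1 - t n) ^+ k)).
Proof.
pose f (c : configT) : R := 1 - theta r n c.
have bf : bdd f by apply: bddB => //; exact: bdd_cst.
have f01 c : 0 <= f c <= 1.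
  by have /andP[x0 x1] := theta_itv r01 n c; rewrite /f subr_ge0 x1 gerBl x0.
have Ef : Ex Q f = 1 - t n by rewrite /f ExB ?Ex_cst//; exact: bdd_cst.
pose g (k : nat) (c : configT) : R := rho * (1 - \prod_(i < k) f (subtree i c)).
have bprod (k : nat) : bdd (fun c : configT =>
  \prod_(i < k) f (subtree i c) * \1_[set c | c [::] = k] c).
  apply: bddM => //; apply: bdd_prod => i.
  split; first exact: (measurableT_comp bf.1 (measurable_subtree i)).
  by exists 1 => c; have /andP[x0 x1] := f01 (subtree i c); rewrite ger0_norm.
transitivity (Ex Q (fun c => \sum_(k < K.+1) rho *
  (\1_[set c | c [::] = k :> nat] c - \prod_(i < k) f (subtree i c) *
  \1_[set c | c [::] = k :> nat] c))).
  apply: eq_Ex => c.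
  transitivity (\sum_(k < K.+1) g k c * \1_[set c | c [::] = k :> nat] c); last first.
    by apply: eq_bigr => k _; rewrite /g -mulrA mulrBl mul1r.
  by rewrite by_root thetaS /r ltnS /g /f; case: ifP; rewrite ?mul0r.
rewrite Ex_sum; last first.
  by move=> k; apply: bddM; [exact: bdd_cst|apply: bddB; [exact: (bI k)|exact: (bprod k)]].
apply: eq_bigr => k _; rewrite ExZ; last by apply: bddB; [exact: (bI k)|exact: (bprod k)].
congr (_ * _); rewrite ExB; [|exact: (bI k)|exact: (bprod k)].
rewrite Ex_root (subtrees_indep_root Qcyl k bf.1 f01) Ef -/(a k); ring.
Qed.

(** A second-order Bernoulli inequality. *)
Lemma expr_onem_le (x : R) k : 0 <= x <= 1 -> (1 - x) ^+ k <= 1 - k%:R * x + k%:R ^+ 2 * x ^+ 2.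
Proof.
move=> /andP[x0 x1]; elim: k => [|k IH]; first by rewrite expr0 mul0r; lra.
rewrite exprS -natr1; set y := k%:R in IH *; have y0 : 0 <= y by exact: ler0n.
apply: (@le_trans _ _ ((1 - x) * (1 - y * x + y ^+ 2 * x ^+ 2)));
  first by rewrite ler_wpM2l// subr_ge0.
have : 0 <= x ^+ 2 * (y + 1) by rewrite mulr_ge0 ?sqr_ge0// addr_ge0.
have : 0 <= y ^+ 2 * x ^+ 3 by rewrite mulr_ge0 ?exprn_ge0.
lra.
Qed.

(** By [annealed_step] and [expr_onem_le], the step function is at least
    [rho m tau - rho C tau^2] at [tau], where [m] and [C] are the truncated first and second
    moments. As [rho m > 1], this is at least [tau] for [tau] small, so a lower bound [tau] is
    passed on from one generation to the next. *)
Lemma annealed_survival_lower_bound : exists2 tau, 0 < tau & forall n, tau <= t n.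
Proof.
pose m := \sum_(k < K.+1) k%:R * a k; have sc : 1 < rho * m by exact: supercritical.
have /andP[rho0 rho1] := rho01.
have m0 : 0 < m by rewrite -(pmulr_rgt0 _ rho0) (lt_trans _ sc).
pose s := \sum_(k < K.+1) a k.
have s0 : 0 < s.
  rewrite lt_neqAle sumr_ge0 ?andbT//; apply: contraTneq m0 => s0.
  rewrite -leNgt /m big1// => k _; have /eqP := esym s0; rewrite psumr_eq0//.
  by move=> /allP/(_ k (mem_index_enum _)) /eqP ->; rewrite mulr0.
pose C := \sum_(k < K.+1) k%:R ^+ 2 * a k.
have C0 : 0 <= C by apply: sumr_ge0 => k _; rewrite mulr_ge0 ?sqr_ge0.
(* The second entry is where [rho m tau - rho C tau^2 >= tau] still holds; the added [1] avoids
   a case distinction when [C] is zero. *)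
pose tau := Num.min (t 0) ((rho * m - 1) / (rho * C + 1)).
have rC : 0 < rho * C + 1 by rewrite ltr_wpDl// mulr_ge0// ltW.
have tau0 : 0 < tau.
  rewrite lt_min annealed_root -mulr_sumr mulr_gt0//= divr_gt0//.
  by rewrite subr_gt0.
exists tau => //; elim=> [|n IH]; first by rewrite ge_min lexx.
have tau1 : tau <= 1 by rewrite (le_trans IH)//; case/andP: (t01 n).
rewrite annealed_step.
apply: (@le_trans _ _ (\sum_(k < K.+1) rho * (a k * (k%:R * tau - k%:R ^+ 2 * tau ^+ 2))));
  last first.
  apply: ler_sum => k _; apply: ler_wpM2l; first exact: ltW.
  apply: ler_wpM2l => //.
  have : (1 - t n) ^+ k <= (1 - tau) ^+ k.
    by rewrite lerXn2r ?nnegrE ?lerB ?subr_ge0//; case/andP: (t01 n).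
  have := @expr_onem_le tau k; rewrite (ltW tau0) tau1 => /(_ isT); lra.
have -> : \sum_(k < K.+1) rho * (a k * (k%:R * tau - k%:R ^+ 2 * tau ^+ 2)) =
  rho * m * tau - rho * C * tau ^+ 2.
  rewrite /m /C !mulr_sumr !mulr_suml -sumrB; apply: eq_bigr => k _; ring.
have tauC : tau * (rho * C + 1) <= rho * m - 1 by rewrite -ler_pdivlMr// ge_min lexx orbT.
have : tau * (tau * (rho * C + 1)) <= tau * (rho * m - 1) by rewrite ler_wpM2l// ltW.
have := sqr_ge0 tau; lra.
Qed.

(** Extinction and dying are inherited from the subtrees, so their probabilities are fixed
    points of the offspring generating function; the larger one is less than [1] because the
    annealed survival probability of the thinned tree does not tend to [0]. *)
Lemma dies_extinct_ae : Q (dies r `\` bounded_height) = 0%E.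
Proof.
have mD := @measurable_dies R r r01.
have mE := measurable_bounded_height.
have bD : bdd (\1_(dies r) : configT -> R) by exact: bdd_indic.
have bE : bdd (\1_bounded_height : configT -> R) by exact: bdd_indic.
have aT : (\sum_(k < n) a k) @[n --> \oo] --> (1 : R).
  have := @hereditary_fixed_point R Q nu Qcyl setT measurableT _.
  rewrite indicT Ex_cst => /(_ (fun c => conj (fun _ _ _ => I) (fun _ => I))).
  by under eq_fun do under eq_bigr do rewrite expr1n mulr1.
have le_ED : Ex Q \1_bounded_height <= Ex Q \1_(dies r).
  apply: le_Ex => // c; rewrite !indicE ler_nat.
  by case: (boolP (c \in bounded_height)) => //; rewrite inE => /(bounded_height_dies r01) H;
    rewrite mem_set.
have lt1 : Ex Q \1_(dies r) < 1.
  rewrite lt_neqAle; apply/andP; split; last first.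
    by rewrite -(Ex_cst Q 1); apply: le_Ex => //; exact: bdd_cst.
  apply/negP => /eqP D1.
  have [tau tau0 taut] := annealed_survival_lower_bound.
  have D1' : {ae Q, forall c, theta r n c @[n --> \oo] --> (0 : R)}.
    exists (~` dies r); split; first exact: measurableC.
      have := Ex_indic Q (measurableC mD).
      have -> : Ex Q \1_(~` dies r) = 0.
        rewrite -(subrr 1) -{2}D1 -{1}(Ex_cst Q 1) -ExB//; last exact: bdd_cst.
        by apply: eq_Ex => c; rewrite !indicE in_setC; case: (_ \in _); rewrite ?subrr ?subr0.
      by move=> <-.
    move=> c; apply: contra_not => Dc.
    by have := Dc [::] (gw_root c); move=> <-; exact: theta_cvg.
  have : t n @[n --> \oo] --> Ex Q (cst (0 : R)).
    apply: (@Ex_dominated _ _ _ Q _ _ 1) => //.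
      by move=> n; exact: (btheta n).1.
    by move=> n c; have /andP[x0 x1] := theta_itv r01 n c; rewrite ger0_norm.
  rewrite Ex_cst => t0.
  have : tau <= 0.
    rewrite -(cvg_lim _ t0)//; apply: limr_ge; first by apply/cvg_ex; eexists; exact: t0.
    by apply: nearW => n.
  by rewrite leNgt tau0.
have [k1 k2 ak] : exists2 k, (1 < k)%N & 0 < a k.
  apply: contrapT => H; suff : rho * \sum_(k < K.+1) k%:R * a k <= 1 by rewrite leNgt supercritical.
  have H' (k : nat) : (1 < k)%N -> a k = 0.
    move=> k1; apply/eqP; rewrite eq_le a0 andbT leNgt; apply/negP => ak; apply: H; by exists k.
  have /andP[rho0 rho1] := rho01.
  apply: mulr_ile1 => //; [exact: ltW|by apply: sumr_ge0 => k _; rewrite mulr_ge0|].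
  apply: (@le_trans _ _ (\sum_(k < K.+1) a k)).
    apply: ler_sum => k _; case: (ltnP 1 k) => k1; first by rewrite H'// mulr0.
    by rewrite ler_piMl// lern1.
  rewrite -(cvg_lim _ aT)//; apply: limr_ge; first by apply/cvg_ex; eexists; exact: aT.
  exists K.+1 => // n /= Kn; rewrite (big_ord_widen n a Kn)
    [leRHS](bigID (fun k : 'I_n => (k < K.+1)%N))/= lerDl.
  by apply: sumr_ge0.
have E0 : Ex Q \1_bounded_height = Ex Q \1_(dies r).
  apply: (@generating_function_fixed_point_unique R a) => //.
  - by exists k1.
  - by apply: Ex_ge0 => c; rewrite indicE.
  - exact: (hereditary_fixed_point Qcyl mE bounded_height_hereditary).
  - exact: (hereditary_fixed_point Qcyl mD (dies_hereditary r01)).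
have mDE : measurable (dies r `\` bounded_height) by exact: measurableD.
rewrite -(Ex_indic Q mDE); congr EFin.
transitivity (Ex Q (fun c => \1_(dies r) c - \1_bounded_height c)); last by rewrite ExB// E0 subrr.
apply: eq_Ex => c; rewrite !indicE in_setD.
have [|_] := boolP (c \in bounded_height); last by rewrite subr0 andbT.
by rewrite inE => /(bounded_height_dies r01) H; rewrite mem_set// andbF subrr.
Qed.

End GWSurvival.

(** * Green function of the walk on a tree *)

Section Neighbours.
Variable c : vertex -> nat.
Notation T := (gw_tree c).

Definition parent (x : vertex) : vertex := take (size x).-1 x.

Lemma parent_rcons u i : parent (rcons u i) = u.
Proof. by rewrite /parent size_rcons -cats1 take_size_cat. Qed.

Definition children (x : vertex) : seq vertex := [seq rcons x i | i <- iota 0 (c x)].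

Definition neighbours (x : vertex) : seq vertex :=
  if x is [::] then children x else parent x :: children x.

Lemma neighbours_rcons u i : neighbours (rcons u i) = u :: children (rcons u i).
Proof. by rewrite -{2}(parent_rcons u i); case: u. Qed.

Lemma children_tree x y : T x -> y \in children x -> T y.
Proof. by move=> Tx /mapP[i]; rewrite mem_iota /= => ic ->; exact: gw_child. Qed.

Lemma mem_neighbours x y : T x -> (y \in neighbours x) <-> T y /\ adj x y.
Proof.
have mch z i : (rcons z i \in children z) = (i < c z)%N.
  by rewrite mem_map ?mem_iota//; exact: rcons_injl || (move=> a b /rcons_inj[]).
move=> Tx; split.
  have ch z : T z -> y \in children z -> T y /\ adj z y.
    move=> Tz yz; split; first exact: children_tree yz.
    by have /mapP[i _ ->] := yz; rewrite /adj last_rcons eqxx.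
  case/lastP: x Tx => [|u i] Tx; first exact: ch.
  rewrite neighbours_rcons inE => /orP[/eqP ->|]; last exact: ch.
  by have /gw_tree_rcons[Tu _] := Tx; rewrite /adj last_rcons eqxx orbT.
move=> [Ty /orP[/eqP yE|/eqP xE]].
  rewrite yE in Ty *; have /gw_tree_rcons[_ yc] := Ty.
  have : rcons x (last 0%N y) \in children x by rewrite mch.
  by case: (x) => //= a s; rewrite inE => ->; rewrite orbT.
by rewrite xE neighbours_rcons mem_head.
Qed.

Lemma neighbours_uniq x : uniq (neighbours x).
Proof.
have uch z : uniq (children z) by rewrite map_inj_uniq ?iota_uniq// => a b /rcons_inj[].
case/lastP: x => [|u i]; first exact: uch.
rewrite neighbours_rcons /= uch andbT; apply/mapP => -[j _ /(congr1 size)].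
by rewrite !size_rcons => /eqP; rewrite eqn_leq [X in _ && X]ltnNge leqnSn andbF.
Qed.

Lemma deg_neighbours x : T x -> deg T x = size (neighbours x).
Proof.
move=> Tx; rewrite /deg.
have -> : [set y | T y /\ adj x y] = [set` [fset y in neighbours x]%fset].
  apply/seteqP; split=> y /=; first by move/(mem_neighbours _ Tx); rewrite inE.
  by rewrite inE => /(mem_neighbours _ Tx).
by rewrite set_fsetK card_fseq undup_id ?neighbours_uniq.
Qed.

Lemma size_neighbours_rcons u i : size (neighbours (rcons u i)) = (c (rcons u i)).+1.
Proof. by rewrite neighbours_rcons /= size_map size_iota. Qed.

Lemma size_neighbours_root : size (neighbours [::]) = c [::].
Proof. by rewrite /= size_map size_iota. Qed.

End Neighbours.

Section Walk.
Context d (S : measurableType d) (R : realType).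
Variables (c : vertex -> nat) (Px : vertex -> probability S R) (X : nat -> S -> vertex).
Notation T := (gw_tree c).
Hypothesis srw : is_srw T Px X.
Variables (x : vertex).
Hypothesis Tx : T x.

Let mX k y : measurable (X k @^-1` [set y]). Proof. by have [+ _ _] := srw; apply. Qed.

Let prob (A : set S) : R := Ex (Px x) \1_A.

(** Sums over vertices or over trajectories are taken along a numbering [K] of them. *)
Lemma countable_split (K : S -> nat) (A : set S) :
  (forall k, measurable (K @^-1` [set k])) -> measurable A ->
  (Px x A = \sum_(k <oo) Px x (A `&` K @^-1` [set k]))%E.
Proof.
move=> mK mA; have mAK k : measurable (A `&` K @^-1` [set k]) by exact: measurableI.
have AE : A = \bigcup_k (A `&` K @^-1` [set k]).
  apply/seteqP; split=> [w Aw|w [k _ []]//].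
  by exists (K w).
rewrite {1}AE measure_semi_bigcup//; last by rewrite -AE.
by move=> i j _ _ [w [[_ <-] [_ <-]]].
Qed.

Let mpath n (p : nat -> vertex) : measurable [set w | forall k, (k <= n)%N -> X k w = p k].
Proof.
rewrite (_ : [set w | _] = \bigcap_(k in `I_n.+1) (X k @^-1` [set p k])).
  by apply: fin_bigcap_measurable => // k _; exact: mX.
by apply/seteqP; split=> w H k /=; [rewrite ltnS; exact: H|move=> kn; exact: (H k)].
Qed.

(** The hypothesis on the walk prescribes the transition given a whole trajectory; the sum is
    over the countably many trajectories up to time [n] that end in [z]. *)
Lemma markov_property n z y :
  Px x (X n @^-1` [set z] `&` X n.+1 @^-1` [set y]) =
  (Px x (X n @^-1` [set z]) * (srw_step R T z y)%:E)%E.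
Proof.
pose K w := choice.pickle [seq X k w | k <- iota 0 n.+1].
have fiber w0 : K @^-1` [set K w0] = [set w | forall k, (k <= n)%N -> X k w = X k w0].
  apply/seteqP; split=> w /=.
    move=> /(pcan_inj choice.pickleK)/eq_in_map H k kn; apply: H.
    by rewrite mem_iota.
  move=> H; congr choice.pickle; apply/eq_in_map => k; rewrite mem_iota add0n ltnS => /andP[_].
  exact: H.
have mK k : measurable (K @^-1` [set k]).
  case: (pselect (exists w0, K w0 = k)) => [[w0 <-]|nk].
    by rewrite fiber; exact: mpath.
  rewrite (_ : _ @^-1` _ = set0)//; apply/seteqP; split=> // w /= Kw.
  by apply: nk; exists w.
rewrite (countable_split mK); last by apply: measurableI; exact: mX.
rewrite [X in (X * _)%E](countable_split mK); last exact: mX.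
rewrite muleC -nneseriesZl//; apply: eq_eseriesr => k _.
rewrite muleC; case: (pselect (exists w0, K w0 = k)) => [[w0 <-]|nk]; last first.
  rewrite (_ : K @^-1` _ = set0) ?setI0 ?measure0 ?mul0e//.
  by apply/seteqP; split=> // w /= Kw; apply: nk; exists w.
rewrite fiber; case: (eqVneq (X n w0) z) => [<-|nz]; last first.
  have E : X n @^-1` [set z] `&` [set w | forall k, (k <= n)%N -> X k w = X k w0] = set0.
    by apply/seteqP; split=> // w [/= Xz /(_ n (leqnn n))]; rewrite Xz => zE; rewrite zE eqxx in nz.
  by rewrite setIAC E set0I measure0 mul0e.
pose p k := if (k <= n)%N then X k w0 else y.
have [_ _ /(_ x Tx p n)] := srw; rewrite {3 4}/p leqnn ltnn.
have -> : [set w | forall k, (k <= n)%N -> X k w = p k] =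
    X n @^-1` [set X n w0] `&` [set w | forall k, (k <= n)%N -> X k w = X k w0].
  apply/seteqP; split=> [w H|w [_ H] j kn]; last by rewrite /p kn H.
  have H' j : (j <= n)%N -> X j w = X j w0 by move=> kn; rewrite H// /p kn.
  by split => //=; exact: H'.
move=> <-; congr (Px x _); apply/seteqP; split=> w.
  move=> [[_ /= Xy] H] j; rewrite leq_eqVlt ltnS => /orP[/eqP ->|kn]; first by rewrite Xy /p ltnn.
  by rewrite /p kn H.
move=> H; have H' j : (j <= n)%N -> X j w = X j w0.
  by move=> kn; rewrite H ?(leq_trans kn)// /p kn.
by split=> //; split=> /=; [exact: H'|rewrite H// /p ltnn].
Qed.

Let pickle_fiber n k : measurable ((fun w => choice.pickle (X n w)) @^-1` [set k]).
Proof.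
case: (pselect (exists w0, choice.pickle (X n w0) = k)) => [[w0 <-]|nk].
  rewrite (_ : _ @^-1` _ = X n @^-1` [set X n w0]) //.
  by apply/seteqP; split=> w /=; [move/(pcan_inj choice.pickleK)|move=> ->].
rewrite (_ : _ @^-1` _ = set0)//; apply/seteqP; split=> // w /= Kw.
by apply: nk; exists w.
Qed.

Lemma null_by_position n (A : set S) : measurable A ->
  (forall z, Px x (A `&` X n @^-1` [set z]) = 0%E) -> Px x A = 0%E.
Proof.
move=> mA A0; rewrite (countable_split (pickle_fiber n) mA).
apply: eseries0 => k _ _.
case: (pselect (exists w0, choice.pickle (X n w0) = k)) => [[w0 <-]|nk].
  rewrite -(A0 (X n w0)); congr (Px x (_ `&` _)).
  by apply/seteqP; split=> w /=; [move/(pcan_inj choice.pickleK)|move=> ->].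
rewrite (_ : _ @^-1` _ = set0) ?setI0 ?measure0//.
by apply/seteqP; split=> // w /= Kw; apply: nk; exists w.
Qed.

Lemma walk_in_tree n z : ~ T z -> Px x (X n @^-1` [set z]) = 0%E.
Proof.
elim: n z => [|n IH] z Tz.
  have [_ /(_ x Tx) X0 _] := srw.
  apply/eqP; rewrite eq_le measure_ge0 andbT.
  have : (Px x (X 0%N @^-1` [set x] `|` X 0%N @^-1` [set z]) <= 1)%E by exact: probability_le1
    (measurableU _ _ _ _).
  rewrite measureU//.
    by rewrite [X in (X + _)%E]X0 -{2}(adde0 1%E) leeD2lE.
  by apply/seteqP; split=> // w [/= Xx Xz]; apply: Tz; rewrite -Xz Xx.
apply: (@null_by_position n) => // z'; rewrite setIC markov_property.
by rewrite /srw_step memNset ?mule0.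
Qed.

Definition occupation n y : R := prob (X n @^-1` [set y]).

Lemma occupation_ge0 n y : 0 <= occupation n y.
Proof. by apply: Ex_ge0 => w; rewrite indicE. Qed.

Lemma occupation0 y : occupation 0 y = (y == x)%:R.
Proof.
have [_ /(_ x Tx) X0 _] := srw.
apply: EFin_inj; rewrite /occupation /prob Ex_indic//.
case: eqP => [->|yx]; first exact: X0.
apply/eqP; rewrite eq_le measure_ge0 andbT.
have : (Px x (X 0%N @^-1` [set x] `|` X 0%N @^-1` [set y]) <= 1)%E by exact: probability_le1
  (measurableU _ _ _ _).
rewrite measureU//.
  by rewrite [X in (X + _)%E]X0 -{2}(adde0 1%E) leeD2lE.
by apply/seteqP; split=> // w [/= Xx Xz]; apply: yx; rewrite -Xz Xx.
Qed.

(** Decomposition according to the position before the last step, which is a neighbour of [y] up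
    to a null event. The edge set being symmetric, the sum runs over the neighbours of [y]. *)
Lemma occupationS n y : T y ->
  occupation n.+1 y = \sum_(z <- neighbours c y) occupation n z / (deg T z)%:R.
Proof.
move=> Ty.
have bI (A : set S) : measurable A -> bdd (\1_A : S -> R) by exact: bdd_indic.
have mI2 z : measurable (X n @^-1` [set z] `&` X n.+1 @^-1` [set y]) by exact: measurableI.
pose rest : set S := X n.+1 @^-1` [set y] `\` (\bigcup_(z in [set` neighbours c y]) X n @^-1`
  [set z]).
have mU : measurable (\bigcup_(z in [set` neighbours c y]) X n @^-1` [set z]).
  by apply: fin_bigcup_measurable => // z _; exact: mX.
have mrest : measurable rest by exact: measurableD.
have rest0 : Px x rest = 0%E.
  apply: (@null_by_position n) => // z.
  have [zy|zy] := boolP (z \in neighbours c y).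
    rewrite (_ : _ `&` _ = set0) ?measure0//; apply/seteqP; split=> // w [[_ nz] /= Xz].
    by apply: nz; exists z.
  apply/eqP; rewrite eq_le measure_ge0 andbT.
  have sub : rest `&` X n @^-1` [set z] `<=` X n @^-1` [set z] `&` X n.+1 @^-1` [set y].
    by move=> w [[? _] ?].
  have le_rest : (Px x (rest `&` X n @^-1` [set z]) <=
    Px x (X n @^-1` [set z] `&` X n.+1 @^-1` [set y]))%E.
    by apply: le_measure sub; rewrite ?inE//; exact: measurableI.
  rewrite (le_trans le_rest)// markov_property.
  case: (pselect (T z)) => Tz; last first.
    by rewrite walk_in_tree// mul0e.
  rewrite /srw_step; case: ifP => [/andP[_ zy']|_]; last by rewrite mule0.
  exfalso; move/negP: zy; apply; apply/(mem_neighbours _ Ty); split => //.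
  by move: zy'; rewrite /adj orbC.
have E w : \1_(X n.+1 @^-1` [set y]) w =
    \sum_(z <- neighbours c y) \1_(X n @^-1` [set z] `&` X n.+1 @^-1` [set y]) w + \1_rest w :> R.
  have [Xy|Xy] := pselect (X n.+1 w = y); last first.
    rewrite indicE memNset// big1 ?add0r; first by rewrite indicE memNset// => -[].
    by move=> z _; rewrite indicE memNset// => -[].
  have [Xn|Xn] := boolP (X n w \in neighbours c y).
    have nrest : ~ rest w by move=> [_]; apply; exists (X n w).
    rewrite (bigD1_seq (X n w))//= ?neighbours_uniq// big1 ?addr0.
      by rewrite [\1_rest w]indicE (memNset nrest) addr0 !indicE !mem_set.
    by move=> z /eqP zX; rewrite indicE memNset// => -[/= Xz _]; apply: zX.
  have yrest : rest w by split => // -[z zy /= Xz]; move/negP: Xn; apply; rewrite Xz.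
  rewrite big1_seq; first by rewrite add0r !indicE !mem_set.
  by move=> z /andP[_ zy]; rewrite indicE memNset// => -[/= Xz _]; move/negP: Xn; apply; rewrite Xz.
rewrite /occupation /prob (eq_Ex _ E) ExD; last 2 first.
- by apply: bdd_sum => z; exact: bI.
- exact: bI.
rewrite Ex_sum; last by move=> z; exact: bI.
have -> : Ex (Px x) \1_rest = 0 by apply: EFin_inj; rewrite Ex_indic.
rewrite addr0 big_seq [RHS]big_seq; apply: eq_bigr => z /(mem_neighbours _ Ty)[Tz yz].
apply: EFin_inj; rewrite Ex_indic// markov_property EFinM Ex_indic//; congr (_ * _)%E.
rewrite /srw_step mem_set//=.
by have -> : adj z y by move: yz; rewrite /adj orbC.
Qed.

(** The contribution of the times before [n] to the Green function. It satisfies an exact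
    recursion in [n], which makes minimality of the Green function provable by induction. *)
Definition green_upto n y : R := (\sum_(k < n) occupation k y) / (deg T y)%:R.

Lemma green_uptoS n y : T y -> (0 < deg T y)%N ->
  (deg T y)%:R * green_upto n.+1 y = (y == x)%:R + \sum_(z <- neighbours c y) green_upto n z.
Proof.
move=> Ty dy; rewrite /green_upto mulrC divfK ?pnatr_eq0 -?lt0n//.
rewrite big_ord_recl occupation0; congr (_ + _).
under eq_bigr do rewrite /= occupationS//.
by rewrite exchange_big; apply: eq_bigr => z _; rewrite mulr_suml.
Qed.

Lemma green_series y : green T Px X x y =
  ((deg T y)%:R^-1%:E * \sum_(k <oo) (occupation k y)%:E)%E.
Proof.
rewrite /green; congr (_ * _)%E.
rewrite integral_nneseries//; last by move=> n; apply/measurable_EFinP; exact: measurable_indic.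
apply: eq_eseriesr => k _; rewrite /occupation /prob Ex_indic// integral_indic// setIT//.
Qed.

Lemma green_upto_cvg y : green T Px X x y \is a fin_num -> (0 < deg T y)%N ->
  green_upto n y @[n --> \oo] --> fine (green T Px X x y).
Proof.
move=> gfin dy.
have d0 : 0 < (deg T y)%:R^-1 :> R by rewrite invr_gt0 ltr0n.
have H : (EFin \o green_upto^~ y) n @[n --> \oo] --> green T Px X x y.
  rewrite green_series.
  rewrite (_ : EFin \o _ = (fun n => (deg T y)%:R^-1%:E * \sum_(0 <= k < n)
    (occupation k y)%:E)%E); last first.
    by apply/funext => n; rewrite /= /green_upto mulrC EFinM -sumEFin big_mkord.
  apply: cvgeZl => //; apply: is_cvg_nneseries => k _ _.
  by rewrite lee_fin occupation_ge0.
by move: H; rewrite -{1}(fineK gfin) => /fine_cvgP[_].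
Qed.

Lemma green_upto_le n y : green T Px X x y \is a fin_num -> (0 < deg T y)%N ->
  green_upto n y <= fine (green T Px X x y).
Proof.
move=> gfin dy; have cv := green_upto_cvg gfin dy.
rewrite -(cvg_lim _ cv)//; apply: nondecreasing_cvgn_le; last by apply/cvg_ex; eexists; exact: cv.
apply/nondecreasing_seqP => m; rewrite /green_upto ler_wpM2r ?invr_ge0//.
by rewrite big_ord_recr lerDl occupation_ge0.
Qed.

Lemma green_upto0 y : green_upto 0 y = 0.
Proof. by rewrite /green_upto big_ord0 mul0r. Qed.

End Walk.

(** * Potential theory on a tree *)

Section Potential.
Context (R : realType) (c : vertex -> nat).
Notation T := (gw_tree c).
Notation nb := (neighbours c).
Hypothesis c_root : (0 < c [::])%N.
Variables (Gn : nat -> vertex -> vertex -> R) (G : vertex -> vertex -> R).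
Hypothesis Gn0 : forall x v, Gn 0 x v = 0.
Hypothesis GnS : forall n x v, T x -> T v ->
  (size (nb v))%:R * Gn n.+1 x v = (v == x)%:R + \sum_(z <- nb v) Gn n x z.
Hypothesis GnG : forall n x v, T x -> T v -> Gn n x v <= G x v.
Hypothesis Gcv : forall x v, T x -> T v -> Gn n x v @[n --> \oo] --> G x v.
Hypothesis Gsym : forall x y, T x -> T y -> G x y = G y x.

Lemma size_neighbours_gt0 v : T v -> (0 < size (nb v))%N.
Proof.
case/lastP: v => [_|u i _]; first by rewrite size_neighbours_root.
by rewrite size_neighbours_rcons.
Qed.

Let d_gt0 v : T v -> 0 < (size (nb v))%:R :> R.
Proof. by move=> /size_neighbours_gt0; rewrite ltr0n. Qed.

Let nbT v z : T v -> z \in nb v -> T z.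
Proof. by move=> Tv /(mem_neighbours _ Tv)[]. Qed.

Lemma green_ge0 x v : T x -> T v -> 0 <= G x v.
Proof. by move=> Tx Tv; rewrite -(Gn0 x v); exact: GnG. Qed.

Lemma green_equation x v : T x -> T v ->
  (size (nb v))%:R * G x v = (v == x)%:R + \sum_(z <- nb v) G x z.
Proof.
move=> Tx Tv.
have c1 : (size (nb v))%:R * Gn n.+1 x v @[n --> \oo] --> (size (nb v))%:R * G x v.
  by apply: cvgM; [exact: cvg_cst|rewrite (@cvg_shiftS _ (fun n => Gn n x v)); exact: Gcv].
suff c2 : (v == x)%:R + \sum_(z <- nb v) Gn n x z @[n --> \oo] -->
  (v == x)%:R + \sum_(z <- nb v) G x z.
  have E : (fun n => (size (nb v))%:R * Gn n.+1 x v) =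
      (fun n => (v == x)%:R + \sum_(z <- nb v) Gn n x z) by apply/funext => n; rewrite GnS.
  by rewrite E in c1; exact: (cvg_unique _ c1 c2).
apply: cvgD; first exact: cvg_cst.
have : forall z, z \in nb v -> T z by move=> z; exact: nbT.
elim: (nb v) => [|z s IH] sT.
  rewrite big_nil (_ : (fun n => _) = cst 0); first exact: cvg_cst.
  by apply/funext => n; rewrite big_nil.
rewrite big_cons (_ : (fun n => _) = (fun n => Gn n x z + \sum_(z <- s) Gn n x z)); last first.
  by apply/funext => n; rewrite big_cons.
apply: cvgD; first by apply: Gcv => //; apply: sT; exact: mem_head.
by apply: IH => z' z's; apply: sT; rewrite inE z's orbT.
Qed.

(** The Green function is the smallest nonnegative solution of its equation: on a set [A] whose
    only outer neighbour is [z], a nonnegative superharmonic [w] with [G x z <= w z] bounds the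
    finite-time Green functions, by induction on time, and hence their limit. *)
Lemma green_minimal (A : pred vertex) (z x : vertex) (w : vertex -> R) :
  T x -> T z -> ~~ A x -> (forall v, A v -> T v) ->
  (forall v u, A v -> u \in nb v -> A u \/ u = z) ->
  (forall v, A v -> 0 <= w v) -> G x z <= w z ->
  (forall v, A v -> \sum_(u <- nb v) w u <= (size (nb v))%:R * w v) ->
  forall v, A v -> G x v <= w v.
Proof.
move=> Tx Tz xA AT bA w0 wz ws v Av.
suff H n : forall v, A v -> Gn n x v <= w v.
  rewrite -(cvg_lim _ (Gcv Tx (AT v Av)))//; apply: limr_le.
    by apply/cvg_ex; eexists; exact: (Gcv Tx (AT v Av)).
  by apply: nearW => n; exact: H.
elim: n => [|n IH] {}v {}Av; first by rewrite Gn0; exact: w0.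
have Tv := AT v Av.
rewrite -(ler_pM2l (d_gt0 Tv)) GnS//.
have -> : (v == x) = false by apply/eqP => vx; rewrite -vx Av in xA.
rewrite add0r (le_trans _ (ws v Av))// big_seq [leRHS]big_seq.
apply: ler_sum => u uv; have [Au|->] := bA v u Av uv; first exact: IH.
by rewrite (le_trans _ wz)//; exact: GnG.
Qed.

(** The vertices of the tree below [y]; their only neighbour outside is the parent of [y]. *)
Let below (y : vertex) : pred vertex := fun v => prefix y v && `[< T v >].

Let below_T y v : below y v -> T v.
Proof. by move=> /andP[_ /asboolP]. Qed.

Let below_neighbours u i v z : below (rcons u i) v -> z \in nb v ->
  below (rcons u i) z \/ z = u.
Proof.
move=> /andP[yv /asboolP Tv] zv; have Tz := nbT Tv zv.
have ch : z \in children c v -> below (rcons u i) z.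
  move=> /mapP[j _ zE]; apply/andP; split; last exact/asboolP.
  by rewrite zE (prefix_trans yv)// prefix_rcons.
case/lastP: v => [|v j] in yv Tv zv ch *.
  by left; exact: ch.
move: zv; rewrite neighbours_rcons inE => /orP[/eqP zE|]; last by move/ch; left.
have /prefixP[s vE] := yv; case/lastP: s => [|s k] in vE.
  by right; rewrite zE; move: vE; rewrite cats0 => /rcons_inj[].
left; apply/andP; split; last exact/asboolP.
move: vE; rewrite -rcons_cat => /rcons_inj[vE _].
by rewrite zE vE prefix_prefix.
Qed.

(** The walk visits [u] at time [0]. *)
Lemma green_diag_gt0 u : T u -> (size (nb u))%:R^-1 <= G u u.
Proof.
move=> Tu; rewrite -[leLHS]mul1r ler_pdivrMr ?d_gt0// mulrC green_equation// eqxx.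
by rewrite lerDl big_seq sumr_ge0// => z zu; apply: green_ge0 => //; exact: nbT zu.
Qed.

Let diag_gt0 u : T u -> 0 < G u u.
Proof. by move=> Tu; rewrite (lt_le_trans _ (green_diag_gt0 Tu))// invr_gt0 d_gt0. Qed.

(** As functions of [v] in the subtree of [y = rcons u i], both sides are harmonic and agree at
    [u]. Each of [G x v] and [G u v] being minimal ([green_minimal]), each is at most the
    corresponding multiple of the other. *)
Lemma green_separation u i v x : T (rcons u i) -> T v -> T x ->
  prefix (rcons u i) v -> ~~ prefix (rcons u i) x ->
  G x v * G u u = G x u * G u v.
Proof.
move=> Ty Tv Tx yv yx.
have /gw_tree_rcons[Tu _] := Ty.
have Av : below (rcons u i) v by rewrite /below yv; exact/asboolP.
have nA z : ~~ prefix (rcons u i) z -> ~~ below (rcons u i) z.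
  by rewrite /below => /negbTE ->.
have yu : ~~ prefix (rcons u i) u by apply/negP => /size_prefix; rewrite size_rcons ltnn.
have harm z k v' : T z -> ~~ prefix (rcons u i) z -> below (rcons u i) v' ->
    \sum_(u' <- nb v') k * G z u' = (size (nb v'))%:R * (k * G z v').
  move=> Tz yz Av'; rewrite -mulr_sumr mulrCA green_equation//; last exact: below_T Av'.
  have -> : (v' == z) = false by apply/eqP => vz; move: (nA _ yz); rewrite -vz Av'.
  by rewrite add0r.
have guu := diag_gt0 Tu.
have le1 : G x v <= G x u / G u u * G u v.
  apply: (@green_minimal (below (rcons u i)) u x (fun v => G x u / G u u * G u v)) => //.
  - exact: nA.
  - exact: below_T.
  - exact: below_neighbours.
  - move=> v' /below_T Tv'; rewrite mulr_ge0 ?green_ge0// divr_ge0 ?green_ge0//.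
  - by rewrite divfK ?gt_eqF.
  - by move=> v' Av'; rewrite harm.
apply/eqP; rewrite eq_le; apply/andP; split.
  by rewrite -ler_pdivlMr// mulrAC.
have [gxu|gxu] := ltP 0 (G x u); last first.
  have -> : G x u = 0 by apply: le_anti; rewrite gxu green_ge0.
  by rewrite mul0r mulr_ge0// ?green_ge0// ltW.
rewrite mulrC -ler_pdivlMr//.
have -> : G x v * G u u / G x u = G u u / G x u * G x v by ring.
apply: (@green_minimal (below (rcons u i)) u u (fun v => G u u / G x u * G x v)) => //.
- exact: nA.
- exact: below_T.
- exact: below_neighbours.
- move=> v' /below_T Tv'; rewrite mulr_ge0 ?green_ge0// divr_ge0 ?green_ge0//.
- by rewrite divfK ?gt_eqF.
- by move=> v' Av'; rewrite harm.
Qed.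

(** The function [k v = G y v - G u y / G u u * G u v] is the Green function from [y] of the
    walk killed at [u]. It vanishes at [u], and by [green_separation] its values at the children
    of [y] are nonnegative multiples of [k y]; so the Green equation at [y] gives
    [deg y * k y >= 1]. *)
Lemma green_schur_lower u i : T (rcons u i) ->
  0 <= G (rcons u i) (rcons u i) - G u (rcons u i) ^+ 2 / G u u ->
  (size (nb (rcons u i)))%:R^-1 <= G (rcons u i) (rcons u i) - G u (rcons u i) ^+ 2 / G u u.
Proof.
set y := rcons u i => Ty; have /gw_tree_rcons[Tu _] := Ty.
pose k v := G y v - G u y / G u u * G u v.
have kyE : k y = G y y - G u y ^+ 2 / G u u by rewrite /k; ring.
rewrite -kyE => k0.
have guu := diag_gt0 Tu; have gyy := diag_gt0 Ty.
have ku : k u = 0 by rewrite /k divfK ?gt_eqF// Gsym// subrr.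
have kch z : z \in children c y -> 0 <= k z.
  move=> zy; have Tz := children_tree Ty zy.
  have /mapP[j _ zE] := zy.
  have sep : G u z * G y y = G u y * G y z.
    apply: (@green_separation y j) => //; rewrite -?zE//.
      by rewrite prefix_refl.
    by apply/negP => /size_prefix; rewrite zE !size_rcons ltnNge leqnSn.
  have -> : k z = G y z / G y y * k y.
    rewrite /k; have -> : G u z = G u y * G y z / G y y by rewrite -sep mulfK ?gt_eqF.
    by field; rewrite !gt_eqF.
  by rewrite mulr_ge0// divr_ge0 ?green_ge0// ltW.
have keq : (size (nb y))%:R * k y = 1 + \sum_(z <- nb y) k z.
  rewrite /k sumrB -mulr_sumr mulrBr mulrCA !green_equation// eqxx.
  have -> : (y == u) = false by apply/eqP => /(congr1 size)/eqP; rewrite size_rcons eqn_leq ltnn.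
  by rewrite /= add0r; ring.
rewrite -[leLHS]mul1r ler_pdivrMr ?d_gt0// mulrC keq lerDl.
rewrite neighbours_rcons big_cons ku add0r big_seq sumr_ge0// => z; exact: kch.
Qed.

End Potential.

(** * The free field above a level on a fixed tree *)

Section Uncorrelated.
Context d (W : measurableType d) (R : realType) (P : probability W R).

Lemma ExD_integrable f g : P.-integrable setT (EFin \o f) -> P.-integrable setT (EFin \o g) ->
  Ex P (fun w => f w + g w) = Ex P f + Ex P g.
Proof. exact: RintegralD. Qed.

Lemma ExZ_integrable k f : P.-integrable setT (EFin \o f) ->
  Ex P (fun w => k * f w) = k * Ex P f.
Proof. exact: RintegralZl. Qed.

Variables (I : eqType) (f : I -> W -> R).
Hypothesis f2 : forall i, L2 P (f i).

Lemma Ex_linear_combination s (t : I -> R) : (forall i, i \in s -> Ex P (f i) = 0) ->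
  Ex P (fun w => \sum_(i <- s) t i * f i w) = 0.
Proof.
elim: s => [|i s IH] H.
  by under eq_Ex do rewrite big_nil; rewrite Ex_cst.
under eq_Ex do rewrite big_cons.
have i1 : P.-integrable setT (EFin \o (fun w => t i * f i w)).
  by apply: L2_integrable; exact: L2Z.
rewrite ExD_integrable ?ExZ_integrable//; last 2 first.
- exact: L2_integrable.
- by apply: L2_integrable; apply: L2_sum => j; exact: L2Z.
rewrite H ?mem_head// mulr0 add0r IH// => j js; apply: H; by rewrite inE js orbT.
Qed.

Lemma Ex_product_combination g s (t : I -> R) : L2 P g ->
  (forall i, i \in s -> Ex P (fun w => g w * f i w) = 0) ->
  Ex P (fun w => g w * \sum_(i <- s) t i * f i w) = 0.
Proof.
move=> g2; elim: s => [|i s IH] H.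
  by under eq_Ex do rewrite big_nil mulr0; rewrite Ex_cst.
under eq_Ex do rewrite big_cons mulrDr mulrCA.
have i1 : P.-integrable setT (EFin \o (fun w => g w * f i w)) by exact: L2_integrableM.
rewrite ExD_integrable ?ExZ_integrable//; last 2 first.
- have h2 : L2 P (fun w => t i * f i w) by exact: L2Z.
  have := L2_integrableM g2 h2; apply: eq_integrable => //= w _.
  by rewrite mulrCA.
- by apply: L2_integrableM => //; apply: L2_sum => j; exact: L2Z.
rewrite H ?mem_head// mulr0 add0r IH// => j js; apply: H; by rewrite inE js orbT.
Qed.

Lemma uncorrelated_variance s (t : I -> R) : uniq s ->
  (forall i j, i \in s -> j \in s -> i != j -> Ex P (fun w => f i w * f j w) = 0) ->
  Ex P (fun w => (\sum_(i <- s) t i * f i w) ^+ 2) =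
  \sum_(i <- s) t i ^+ 2 * Ex P (fun w => f i w ^+ 2).
Proof.
elim: s => [_ _|i s IH /= /andP[is_ us] H].
  by rewrite big_nil; under eq_Ex do rewrite big_nil expr0n; rewrite Ex_cst.
have sum2 : L2 P (fun w => \sum_(j <- s) t j * f j w) by apply: L2_sum => j; exact: L2Z.
transitivity (Ex P (fun w => t i ^+ 2 * f i w ^+ 2 +
  (2 * t i * (f i w * \sum_(j <- s) t j * f j w) + (\sum_(j <- s) t j * f j w) ^+ 2))).
  by apply: eq_Ex => w; rewrite big_cons; ring.
have i1 : P.-integrable setT (EFin \o (fun w => f i w * \sum_(j <- s) t j * f j w)).
  exact: L2_integrableM.
have iZ k g : P.-integrable setT (EFin \o g) -> P.-integrable setT (EFin \o (fun w => k * g w)).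
  by move=> ig; have := integrableZl measurableT k ig; exact: eq_integrable.
have iD g1 g2 : P.-integrable setT (EFin \o g1) -> P.-integrable setT (EFin \o g2) ->
    P.-integrable setT (EFin \o (fun w => g1 w + g2 w)).
  by move=> ig1 ig2; have := integrableD measurableT ig1 ig2; exact: eq_integrable.
rewrite ExD_integrable; [|exact: iZ (f2 i).2|by apply: iD; [exact: iZ|exact: sum2.2]].
rewrite ExD_integrable; [|exact: iZ|exact: sum2.2].
rewrite !ExZ_integrable//; last exact: (f2 i).2.
rewrite Ex_product_combination//; last first.
  move=> j js; apply: H; rewrite ?mem_head// ?inE ?js ?orbT//.
  by apply: contraNneq is_ => ->.
rewrite mulr0 add0r big_cons IH// => j k js ks; apply: H; by rewrite inE ?js ?ks orbT.
Qed.

End Uncorrelated.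

Section Quenched.
Context (R : realType) (c : config).
Notation T := (gw_tree c).
Variables (rho h : R) (K : nat).
Hypothesis rho0 : 0 < rho.
Hypothesis h0 : 0 < h.
Hypothesis rho_le : rho <= 1 / 2 - h * K.+1%:R.
Let r (k : nat) : R := if (k <= K)%N then rho else 0.
Variable v0 : vertex.
Hypothesis Tv0 : T v0.
Hypothesis survive : 0 < theta_lim r (fun v => c (v0 ++ v)).
Context (dS : measure_display) (S : measurableType dS)
  (Px : vertex -> probability S R) (X : nat -> S -> vertex)
  (dG : measure_display) (Om : measurableType dG)
  (PG : probability Om R) (phi : vertex -> {RV PG >-> R}).
Hypothesis srw : is_srw T Px X.
Hypothesis gff : is_gff T (green T Px X) phi.

Let r01 k : 0 <= r k <= 1.
Proof.
rewrite /r; case: ifP => _; rewrite ?lexx ?ler01// (ltW rho0)/= (le_trans rho_le)//.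
have : 0 <= h * K.+1%:R by rewrite mulr_ge0// ltW.
lra.
Qed.

Let c_v0 : (0 < c v0)%N.
Proof.
have := lt_le_trans survive (theta_lim_le r01 1 (fun v => c (v0 ++ v))).
rewrite thetaS cats0 lt0n; apply: contraTneq => ->.
by rewrite big_ord0 subrr mulr0 ltxx.
Qed.

Let c_root : (0 < c [::])%N.
Proof.
move: Tv0 c_v0; case: (v0) => // i u /gw_tree_cons[ic _] _; exact: leq_ltn_trans ic.
Qed.

Let phi_gaussian x : T x -> gaussian PG (phi x).
Proof.
move=> Tx; have [/(_ [:: x] (fun=> 1)) + _ _] := gff.
have -> : (fun w => \sum_(x0 <- [:: x]) 1 * phi x0 w) = phi x.
  by apply/funext => w; rewrite big_seq1 mul1r.
by apply=> y; rewrite inE => /eqP ->.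
Qed.

Let phi_L2 x : T x -> L2 PG (phi x).
Proof. by move=> Tx; apply: gaussian_L2; [exact: measurable_funP|exact: phi_gaussian]. Qed.

Let phi_mean x : T x -> Ex PG (phi x) = 0.
Proof.
by move=> Tx; have [_ /(_ x Tx) + _] := gff; rewrite unlock => H; rewrite /Ex /Rintegral H.
Qed.

(** The covariance is taken as the real Green function. Its finiteness, that is transience,
    comes with the existence of the field. *)
Let G x y := Ex PG (fun w => phi x w * phi y w).

Let GE x y : T x -> T y -> green T Px X x y = (G x y)%:E.
Proof.
move=> Tx Ty; have [_ m0 /(_ x y Tx Ty) <-] := gff.
rewrite unlock (m0 x Tx) (m0 y Ty) /= /G /Ex /Rintegral fineK; last first.
  by have := integrable_fin_num measurableT (L2_integrableM (phi_L2 Tx) (phi_L2 Ty)).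
rewrite unlock; apply: eq_integral => w _.
by rewrite -[LHS]/(((phi x w - 0) * (phi y w - 0))%:E) !subr0.
Qed.

Let Gsym x y : G x y = G y x.
Proof. by apply: eq_Ex => w; rewrite mulrC. Qed.

Let Gn n x v := green_upto c Px X x n v.

Let deg_gt0 v : T v -> (0 < deg T v)%N.
Proof. by move=> Tv; rewrite deg_neighbours//; exact: size_neighbours_gt0. Qed.

Let Gfin x y : T x -> T y -> green T Px X x y \is a fin_num.
Proof. by move=> Tx Ty; rewrite GE. Qed.

Let Gn0 x v : Gn 0 x v = 0. Proof. exact: green_upto0. Qed.

Let GnS n x v : T x -> T v ->
  (size (neighbours c v))%:R * Gn n.+1 x v = (v == x)%:R + \sum_(z <- neighbours c v) Gn n x z.
Proof.
move=> Tx Tv; rewrite -deg_neighbours//.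
exact: (green_uptoS srw Tx n Tv (deg_gt0 Tv)).
Qed.

Let GnG n x v : T x -> T v -> Gn n x v <= G x v.
Proof.
move=> Tx Tv; have := green_upto_le srw n (Gfin Tx Tv) (deg_gt0 Tv).
by rewrite GE.
Qed.

Let Gcv x v : T x -> T v -> Gn n x v @[n --> \oo] --> G x v.
Proof.
move=> Tx Tv; have := green_upto_cvg srw (Gfin Tx Tv) (deg_gt0 Tv).
by rewrite GE.
Qed.

Let Gge0 x v : T x -> T v -> 0 <= G x v.
Proof. exact: (green_ge0 Gn0 GnG). Qed.

Let parentT x : T x -> T (parent x).
Proof. by move=> Tx; apply: gw_tree_prefix Tx; exact: prefix_take. Qed.

Let a y := G (parent y) y / G (parent y) (parent y).

(** The innovations below [v0]. At [v0] itself the field is not split further, so that the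
    construction starts afresh there. *)
Let psi y w := if y == v0 then phi y w else phi y w - a y * phi (parent y) w.

Let D y := `[< T y >] && prefix v0 y.

Let DP y : reflect (T y /\ prefix v0 y) (D y).
Proof. by apply: (iffP andP) => -[/asboolP]. Qed.

Let D_rcons y : D y -> y != v0 -> exists u i, [/\ y = rcons u i, D u & T y].
Proof.
case/lastP: y => [|u i] /DP[Ty py] yv.
  by move: py yv; rewrite prefixs0 eq_sym => ->.
exists u, i; split => //; have /gw_tree_rcons[Tu _] := Ty; apply/DP; split => //.
have /prefixP[s E] := py; case/lastP: s => [|s j] in E.
  by rewrite E cats0 eqxx in yv.
by move: E; rewrite -rcons_cat => /rcons_inj[-> _]; exact: prefix_prefix.
Qed.

Let Ex_lin x y z k : T x -> T y -> T z ->
  Ex PG (fun w => (phi x w - k * phi y w) * phi z w) = G x z - k * G y z.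
Proof.
move=> Tx Ty Tz.
have i1 := L2_integrableM (phi_L2 Tx) (phi_L2 Tz).
have i2 := L2_integrableM (phi_L2 Ty) (phi_L2 Tz).
transitivity (Ex PG (fun w => phi x w * phi z w + (- k) * (phi y w * phi z w))).
  by apply: eq_Ex => w; ring.
rewrite ExD_integrable ?ExZ_integrable//; first by rewrite mulNr.
by have := integrableZl measurableT (- k) i2; exact: eq_integrable.
Qed.

Let psi_L2 y : T y -> L2 PG (psi y).
Proof.
move=> Ty; rewrite /psi; case: eqP => _; first exact: phi_L2.
have := L2D (phi_L2 Ty) (L2Z (- a y) (phi_L2 (parentT Ty))).
by under eq_fun do rewrite mulNr.
Qed.

(** This is [green_separation] with [v = rcons u i]. *)
Let innovation_orthogonal u i z : T (rcons u i) -> T z -> ~~ prefix (rcons u i) z ->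
  Ex PG (fun w => (phi (rcons u i) w - a (rcons u i) * phi u w) * phi z w) = 0.
Proof.
move=> Ty Tz yz; have /gw_tree_rcons[Tu _] := Ty.
rewrite Ex_lin//; apply/eqP; rewrite subr_eq0; apply/eqP.
have guu : 0 < G u u.
  by rewrite (lt_le_trans _ (green_diag_gt0 c_root Gn0 GnS GnG Gcv Tu))// invr_gt0 ltr0n
    size_neighbours_gt0.
have := green_separation c_root Gn0 GnS GnG Gcv Ty Ty Tz (prefix_refl _) yz.
rewrite /a parent_rcons (Gsym (rcons u i) z) (Gsym u z) => E.
by rewrite mulrAC -(mulrC (G z u)) -E mulfK ?gt_eqF.
Qed.

Let innovation_variance u i : T (rcons u i) ->
  Ex PG (fun w => (phi (rcons u i) w - a (rcons u i) * phi u w) ^+ 2) =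
  G (rcons u i) (rcons u i) - G u (rcons u i) ^+ 2 / G u u.
Proof.
move=> Ty; have /gw_tree_rcons[Tu _] := Ty; set y := rcons u i.
have yu : ~~ prefix y u by apply/negP => /size_prefix; rewrite size_rcons ltnn.
have i1 : L2 PG (fun w => phi y w - a y * phi u w).
  have := L2D (phi_L2 Ty) (L2Z (- a y) (phi_L2 Tu)).
  by under eq_fun do rewrite mulNr.
transitivity (Ex PG (fun w => (phi y w - a y * phi u w) * phi y w + (- a y) *
  ((phi y w - a y * phi u w) * phi u w))).
  by apply: eq_Ex => w; ring.
rewrite ExD_integrable; last 2 first.
- by apply: L2_integrableM => //; exact: phi_L2.
- have := integrableZl measurableT (- a y) (L2_integrableM i1 (phi_L2 Tu)).
  exact: eq_integrable.
rewrite ExZ_integrable; last by apply: L2_integrableM => //; exact: phi_L2.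
rewrite (innovation_orthogonal Ty Tu yu) mulr0 addr0 Ex_lin// /a parent_rcons; ring.
Qed.

Let V y := Ex PG (fun w => psi y w ^+ 2).

(** The degree of [y] is at most [(c y).+1]; the bound is [green_schur_lower], or
    [green_diag_gt0] at [v0]. *)
Let V_lower y : D y -> (c y).+1%:R^-1 <= V y.
Proof.
move=> Dy; have /DP[Ty _] := Dy.
have [yv|yv] := eqVneq y v0.
  rewrite /V /psi yv eqxx.
  have -> : Ex PG (fun w => phi v0 w ^+ 2) = G v0 v0 by [].
  apply: le_trans (green_diag_gt0 c_root Gn0 GnS GnG Gcv Tv0).
  rewrite lef_pV2 ?posrE ?ltr0n ?size_neighbours_gt0// ler_nat.
  case/lastP: (v0) => [|u i]; first by rewrite size_neighbours_root.
  by rewrite size_neighbours_rcons.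
have [u [i [yE Du _]]] := D_rcons Dy yv.
rewrite yE in Ty yv *.
have VE : V (rcons u i) = G (rcons u i) (rcons u i) - G u (rcons u i) ^+ 2 / G u u.
  by rewrite -innovation_variance// /V /psi (negbTE yv) parent_rcons.
rewrite VE -size_neighbours_rcons.
apply: (green_schur_lower c_root Gn0 GnS GnG Gcv) => //.
by rewrite -VE; apply: Ex_ge0 => w; exact: sqr_ge0.
Qed.

Let V_gt0 y : D y -> 0 < V y.
Proof. by move=> /V_lower; apply: lt_le_trans; rewrite invr_gt0. Qed.

(** Of two distinct vertices one, say [y], is not above the other. Then neither [y'] nor its
    parent lies in the subtree of [y], and the innovation at [y] is orthogonal to the field at
    both. *)
Let psi_uncorrelated y y' : D y -> D y' -> y != y' -> Ex PG (fun w => psi y w * psi y' w) = 0.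
Proof.
(* The assumption costs nothing: two distinct labels cannot be prefixes of each other. *)
wlog yy' : y y' / ~~ prefix y y'.
  move=> H Dy Dy' ne; have [p|] := boolP (prefix y y'); last by move=> np; exact: H.
  under eq_Ex do rewrite mulrC.
  apply: H => //; last by rewrite eq_sym.
  apply/negP => p'; move/negP: ne; apply.
  move: p p'; rewrite prefixE => /eqP p /size_prefix s.
  by rewrite -p take_oversize.
move=> Dy Dy' ne; have /DP[Ty py] := Dy; have /DP[Ty' py'] := Dy'.
have yv : y != v0 by apply: contraNneq yy' => ->.
have [u [i [yE Du _]]] := D_rcons Dy yv.
rewrite yE in Ty yy' yv *.
have E w : psi (rcons u i) w = phi (rcons u i) w - a (rcons u i) * phi u w.
  by rewrite /psi (negbTE yv) parent_rcons.
under eq_Ex do rewrite E.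
have [y'v|y'v] := eqVneq y' v0.
  rewrite /psi y'v eqxx -y'v; exact: innovation_orthogonal.
have i1 : L2 PG (fun w => phi (rcons u i) w - a (rcons u i) * phi u w).
  by have := psi_L2 Ty; rewrite (funext E).
have pp : ~~ prefix (rcons u i) (parent y').
  by apply: contra yy' => /prefix_trans; apply; exact: prefix_take.
transitivity (Ex PG (fun w => (phi (rcons u i) w - a (rcons u i) * phi u w) * phi y' w +
   (- a y') * ((phi (rcons u i) w - a (rcons u i) * phi u w) * phi (parent y') w))).
  by apply: eq_Ex => w; rewrite /psi (negbTE y'v); ring.
have Tp := parentT Ty'.
rewrite ExD_integrable; last 2 first.
- by apply: L2_integrableM => //; exact: phi_L2.
- have := integrableZl measurableT (- a y') (L2_integrableM i1 (phi_L2 Tp)).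
  exact: eq_integrable.
rewrite ExZ_integrable; last by apply: L2_integrableM => //; exact: phi_L2.
by rewrite !innovation_orthogonal// mulr0 addr0.
Qed.

Let psi_mean y : T y -> Ex PG (psi y) = 0.
Proof.
move=> Ty; rewrite /psi; case: eqP => _; first exact: phi_mean.
have Tp := parentT Ty.
transitivity (Ex PG (fun w => phi y w + (- a y) * phi (parent y) w)).
  by apply: eq_Ex => w; rewrite mulNr.
rewrite ExD_integrable ?ExZ_integrable ?phi_mean ?mulr0 ?addr0//;
  try exact: L2_integrable (phi_L2 _).
by apply: L2_integrable; apply: L2Z; exact: phi_L2.
Qed.

(** A combination of innovations is a combination of values of the field; the coefficient of
    [phi x] in [psi y] is [k y x]. *)
Let psi_gaussian s (t : vertex -> R) : all D s ->
  gaussian PG (fun w => \sum_(y <- s) t y * psi y w).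
Proof.
move=> /allP Ds; have [gs _ _] := gff.
pose U := undup (s ++ map parent s).
pose k y x : R := (x == y)%:R - (if y == v0 then 0 else a y * (x == parent y)%:R).
have one y w : y \in U -> \sum_(x <- U) (x == y)%:R * phi x w = phi y w.
  move=> yU; rewrite (bigD1_seq y)//= ?undup_uniq// eqxx mul1r big1 ?addr0// => x /negbTE ->.
  by rewrite mul0r.
have -> : (fun w => \sum_(y <- s) t y * psi y w) =
    (fun w => \sum_(x <- U) (\sum_(y <- s) t y * k y x) * phi x w).
  apply/funext => w; under [RHS]eq_bigr do rewrite mulr_suml.
  rewrite exchange_big /= big_seq [RHS]big_seq; apply: eq_bigr => y ys.
  have yU : y \in U by rewrite mem_undup mem_cat ys.
  have pU : parent y \in U by rewrite mem_undup mem_cat map_f ?orbT.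
  under eq_bigr do rewrite -mulrA.
  rewrite -mulr_sumr; congr (_ * _); rewrite /psi /k.
  case: eqP => _; first by under eq_bigr do rewrite subr0; rewrite one.
  under eq_bigr do rewrite mulrBl -mulrA.
  by rewrite sumrB -mulr_sumr !one.
apply: gs => x; rewrite mem_undup mem_cat => /orP[/Ds /DP[]//|/mapP[y /Ds /DP[Ty _] ->]].
exact: parentT.
Qed.

(** Only the restriction of the field to the tree is Gaussian; outside, the innovation is
    replaced by a constant to have a family indexed by all labels. *)
Let psi' y := if `[< T y >] then psi y else cst 0.

Let psi'_L2 y : L2 PG (psi' y).
Proof. by rewrite /psi'; case: asboolP => [/psi_L2//|_]; exact: L2_cst. Qed.

Let psi'E y : D y -> psi' y = psi y.
Proof. by move=> /DP[Ty _]; rewrite /psi'; case: asboolP. Qed.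

Let comboE s (t : vertex -> R) : all D s ->
  (fun w => \sum_(y <- s) t y * psi' y w) = (fun w => \sum_(y <- s) t y * psi y w).
Proof.
move=> /allP Ds; apply/funext => w; rewrite big_seq [RHS]big_seq.
by apply: eq_bigr => y /Ds Dy; rewrite psi'E.
Qed.

Let combo s (t : vertex -> R) : uniq s -> all D s ->
  [/\ measurable_fun setT (fun w => \sum_(y <- s) t y * psi' y w),
   gaussian PG (fun w => \sum_(y <- s) t y * psi' y w),
   Ex PG (fun w => \sum_(y <- s) t y * psi' y w) = 0 &
   Ex PG (fun w => (\sum_(y <- s) t y * psi' y w) ^+ 2) = \sum_(y <- s) t y ^+ 2 * V y].
Proof.
move=> us Ds; have /allP Ds' := Ds; split.
- by apply: (L2_sum _ _).1 => y; exact: L2Z.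
- by rewrite comboE//; exact: psi_gaussian.
- apply: Ex_linear_combination => // y /Ds' Dy; rewrite psi'E//.
  by apply: psi_mean; have /DP[] := Dy.
- rewrite uncorrelated_variance//.
    by rewrite big_seq [RHS]big_seq; apply: eq_bigr => y /Ds' Dy; rewrite psi'E.
  by move=> y y' /Ds' Dy /Ds' Dy' ne; rewrite !psi'E//; exact: psi_uncorrelated.
Qed.

Let single y : D y -> [/\ gaussian PG (psi' y),
  Ex PG (psi' y) = 0 & Ex PG (fun w => psi' y w ^+ 2) = V y].
Proof.
move=> Dy; have [] := @combo [:: y] (fun=> 1) isT; first by rewrite /= Dy.
have -> : (fun w => \sum_(y0 <- [:: y]) 1 * psi' y0 w) = psi' y.
  by apply/funext => w; rewrite big_seq1 mul1r.
by move=> _ ? ? _; split => //; rewrite psi'E.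
Qed.

Let joint_cos s (t : vertex -> R) : uniq s -> all D s ->
  Ex PG (fun w => cos (\sum_(y <- s) t y * psi' y w)) =
    expR (- ((\sum_(y <- s) t y ^+ 2 * V y) / 2)).
Proof.
by move=> us Ds; have [m1 m2 m3 <-] := combo t us Ds; exact: gaussian_cos.
Qed.

Let joint_sin s (t : vertex -> R) : uniq s -> all D s ->
  Ex PG (fun w => sin (\sum_(y <- s) t y * psi' y w)) = 0.
Proof.
by move=> us Ds; have [m1 m2 m3 _] := combo t us Ds; exact: gaussian_sin.
Qed.

Let mpsi' y : measurable_fun setT (psi' y). Proof. exact: (psi'_L2 y).1. Qed.

Let atom y : D y -> PG (psi' y @^-1` [set h]) = 0%E.
Proof.
move=> Dy; have [g0 m0 vE] := single Dy.
by apply: (gaussian_atom (mpsi' y) g0 m0); rewrite vE; exact: V_gt0.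
Qed.

Let up y : set Om := psi' y @^-1` `[h, +oo[.

Let mup y : measurable (up y).
Proof. by rewrite -[X in measurable X]setTI; exact: mpsi'. Qed.

(** The value [1] off the subtree of [v0] lets the comparison with the retention probabilities
    [r] hold at every label. *)
Let e y (w : Om) : R := if D y then \1_(up y) w else 1.

Let be y : bdd (e y).
Proof. by rewrite /e; case: (D y); [exact: bdd_indic|exact: bdd_cst]. Qed.

Let e01 y w : 0 <= e y w <= 1.
Proof. by rewrite /e; case: (D y); rewrite ?ler01 ?lexx// indicE; case: (_ \in _);
  rewrite ?lexx ler01. Qed.

Let e_indep s : uniq s -> (forall u, u \in s -> D u) ->
  Ex PG (fun w => \prod_(u <- s) e u w) = \prod_(u <- s) Ex PG (e u).
Proof.
move=> us Ds.
have eE u : D u -> e u = \1_(up u) by move=> Du; rewrite /e Du.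
transitivity (Ex PG (fun w => \prod_(u <- s) (\1_(up u) w : R))).
  by apply: eq_Ex => w; rewrite big_seq [RHS]big_seq; apply: eq_bigr => u /Ds /eE ->.
rewrite (gaussian_halfline_independent mpsi' joint_cos joint_sin atom us); last exact/allP.
by rewrite big_seq [RHS]big_seq; apply: eq_bigr => u /Ds /eE ->.
Qed.

(** When [y] has at most [K] children, the variance of the innovation is at least [1 / (K + 1)],
    hence the normal density at [0] is at most [K + 1]. *)
Let Ex_e_lower y : r (c y) <= Ex PG (e y).
Proof.
have [Dy|nDy] := boolP (D y); last first.
  rewrite (_ : e y = fun=> 1) ?Ex_cst; first by case/andP: (r01 (c y)).
  by apply/funext => w; rewrite /e (negbTE nDy).
have -> : e y = \1_(up y) by apply/funext => w; rewrite /e Dy.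
rewrite /r; case: ifP => cK; last by apply: Ex_ge0 => w; rewrite indicE.
have [g0 m0 vE] := single Dy.
have v0' : 0 < Ex PG (fun w => psi' y w ^+ 2) by rewrite vE; exact: V_gt0.
have := gaussian_tail (mpsi' y) g0 m0 v0' (ltW h0).
rewrite vE -/(up y) -(Ex_indic PG (mup y)) lee_fin; apply: le_trans.
rewrite (le_trans rho_le)// lerD2l lerN2 ler_wpM2l ?(ltW h0)//.
have Vy : K.+1%:R^-1 <= V y.
  by rewrite (le_trans _ (V_lower Dy))// lef_pV2 ?posrE ?ltr0n// ler_nat ltnS.
rewrite -[leRHS]invrK lef_pV2 ?posrE ?invr_gt0 ?ltr0n//; last first.
  by rewrite sqrtr_gt0 mulrn_wgt0// mulr_gt0 ?pi_gt0// V_gt0.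
rewrite -[leLHS](@ger0_norm _ K.+1%:R^-1) ?invr_ge0// -sqrtr_sqr ler_wsqrtr//.
have k1 : K.+1%:R^-1 <= 1 :> R by rewrite invf_le1 ?ltr0n// ler1n.
have k0 : 0 <= K.+1%:R^-1 :> R by rewrite invr_ge0.
apply: (@le_trans _ _ (V y)); first by rewrite (le_trans _ Vy)// expr2 ler_piMr.
have V0 := V_gt0 Dy.
have pi1 : 1 <= pi :> R by rewrite (le_trans _ (pi_ge2 R))// ler1n.
rewrite mulr2n (le_trans (y := V y * pi))// ?ler_peMr ?(ltW V0)// lerDl.
by rewrite mulr_ge0 ?(ltW V0)// (le_trans _ pi1).
Qed.

Let f n w := perc n (fun v => e (v0 ++ v) w) (fun v => c (v0 ++ v)).

Let f01 n w : 0 <= f n w <= 1.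
Proof. by apply: perc_itv => u; exact: e01. Qed.

Let D_cat v : gw_tree (fun v => c (v0 ++ v)) v -> D (v0 ++ v).
Proof. by move=> tv; apply/DP; split; [exact/(gw_tree_cat _ Tv0)|exact: prefix_prefix]. Qed.

Let f_lower n : theta_lim r (fun v => c (v0 ++ v)) <= Ex PG (f n).
Proof.
have [_ ->] := perc_expectation be e_indep n D_cat.
apply: (le_trans (theta_lim_le r01 n _)).
apply: le_perc => u; first by case/andP: (r01 (c (v0 ++ u))).
  exact: Ex_e_lower.
rewrite -(Ex_cst PG 1); apply: le_Ex => //; first exact: bdd_cst.
by move=> w; case/andP: (e01 (v0 ++ u) w).
Qed.

Let bf n : bdd (f n).
Proof. by have [/multilinear_bdd + _] := perc_expectation be e_indep n D_cat; apply. Qed.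

Let F n : set Om := [set w | f n w != 0].

Let mF n : measurable (F n).
Proof.
rewrite (_ : F n = f n @^-1` (~` [set 0])).
  by rewrite -[X in measurable X]setTI; apply: (bf n).1 => //; exact: measurableC.
by apply/seteqP; split=> w /= /eqP.
Qed.

(** The expectation of the polynomial [f n] is [perc n] at the probabilities of the events [up],
    which are at least the retention probabilities of the thinning; then [n] tends to infinity
    along decreasing events. *)
Lemma percolation_probability :
  ((theta_lim r (fun v => c (v0 ++ v)))%:E <= PG (\bigcap_n F n))%E.
Proof.
have cv : (PG \o F) n @[n --> \oo] --> PG (\bigcap_n F n).
  apply: nonincreasing_cvg_mu => //.
  - by rewrite (le_lt_trans (probability_le1 PG (mF 0%N)))// ltry.
  - exact: bigcapT_measurable.
  - apply/nonincreasing_seqP => n; apply/subsetPset => w; rewrite /F /=.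
    move=> fn; have /andP[f0 _] := f01 n.+1 w.
    have : 0 < f n.+1 w by rewrite lt_neqAle eq_sym fn.
    move=> /lt_le_trans/(_ (perc_decr _ _ _)) H; rewrite gt_eqF//; apply: H => u; exact: e01.
rewrite -(cvg_lim _ cv)//; apply: lime_ge; first by apply/cvg_ex; eexists; exact: cv.
apply: nearW => n; rewrite /= -(Ex_indic PG (mF n)) lee_fin (le_trans (f_lower n))//.
apply: le_Ex => //; first exact: bdd_indic.
move=> w; have /andP[f0 f1] := f01 n w; rewrite indicE.
have [//|fn] := eqVneq (f n w) 0; first by move=> ->.
by rewrite mem_set.
Qed.

(** Along a path of high innovations the field stays above [h]: as [a] and the value at the
    parent are nonnegative, the value at a child is at least its innovation. *)
Let high_path w u : gw_tree (fun v => c (v0 ++ v)) u ->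
  (forall p, prefix p u -> e (v0 ++ p) w != 0) -> h <= phi (v0 ++ u) w.
Proof.
have high y : D y -> e y w != 0 -> h <= psi y w.
  move=> Dy; rewrite /e Dy indicE -(psi'E Dy).
  case: (boolP (w \in up y)); last by rewrite eqxx.
  by rewrite inE /up /= in_itv/= andbT.
elim/last_ind: u => [|u i IH] tu eu.
  have := high (v0 ++ [::]) (D_cat tu) (eu [::] (prefix_refl _)).
  by rewrite cats0 /psi eqxx.
have /gw_tree_rcons[tu' _] := tu.
have IHu : h <= phi (v0 ++ u) w.
  by apply: IH => // p pu; apply: eu; rewrite (prefix_trans pu)// prefix_rcons.
have := high _ (D_cat tu) (eu _ (prefix_refl _)).
have Ty : T (v0 ++ rcons u i) by have /DP[] := D_cat tu.
have ne : (v0 ++ rcons u i == v0) = false.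
  by apply/eqP => /(congr1 size); rewrite size_cat size_rcons; lia.
rewrite /psi ne -rcons_cat parent_rcons => H; apply: (le_trans H).
rewrite gerBl; apply: mulr_ge0; last exact: le_trans (ltW h0) IHu.
rewrite -rcons_cat in Ty; have /gw_tree_rcons[Tu _] := Ty.
by rewrite /a parent_rcons divr_ge0 ?Gge0.
Qed.

Let component_path w h' u : h' <= h -> gw_tree (fun v => c (v0 ++ v)) u ->
  (forall p, prefix p u -> e (v0 ++ p) w != 0) ->
  component [set x | T x /\ h' <= phi x w] v0 (v0 ++ u).
Proof.
move=> hh.
have inA v : gw_tree (fun v => c (v0 ++ v)) v ->
    (forall p, prefix p v -> e (v0 ++ p) w != 0) -> T (v0 ++ v) /\ h' <= phi (v0 ++ v) w.
  move=> tv ev; split; first exact/(gw_tree_cat _ Tv0).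
  by rewrite (le_trans hh)//; exact: high_path.
elim/last_ind: u => [|u i IH] tu eu.
  exists [::]; rewrite cats0; split => // z; rewrite inE => /eqP ->.
  by have := inA [::] tu eu; rewrite cats0.
have /gw_tree_rcons[tu' _] := tu.
have eu' p : prefix p u -> e (v0 ++ p) w != 0.
  by move=> pu; apply: eu; rewrite (prefix_trans pu)// prefix_rcons.
have [p [pp lp Ap]] := IH tu' eu'.
exists (rcons p (v0 ++ rcons u i)); split.
- by rewrite rcons_path pp lp /adj -rcons_cat last_rcons eqxx.
- by rewrite last_rcons.
- move=> z; rewrite -rcons_cons mem_rcons inE => /orP[/eqP ->|/Ap//].
  exact: inA.
Qed.

(** Below level [h] the component of [v0] contains the paths of high innovations, of all
    lengths, with positive probability; so no level [h' < h] qualifies in the infimum that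
    defines [hstar]. *)
Lemma hstar_lower_bound : (h%:E <= hstar T phi)%E.
Proof.
apply: le_ereal_inf_tmp => _ [h' [N [mN N0 sN]] <-]; rewrite lee_fin leNgt; apply/negP => hh.
have sub : \bigcap_n F n `<=` N.
  move=> w Fw; apply: sN => /= H.
  have T0 : gw_tree (fun v => c (v0 ++ v)) [::] by exact: gw_root.
  have F0 := Fw 0%N I; rewrite /F /f /= in F0.
  have hv0 : T v0 /\ h' <= phi v0 w.
    split => //; rewrite (le_trans (ltW hh))//; rewrite -[v0]cats0; apply: high_path => // p.
    by rewrite prefixs0 => /eqP ->.
  have /finite_seqP[s sE] := H v0 hv0.
  have [u [su tu eu]] := perc_path (Fw (\max_(x <- s) size x).+1 I).
  have : v0 ++ u \in s.
    have := component_path (ltW hh) tu eu; rewrite sE; exact.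
  move=> us; have := @leq_bigmax_seq _ s xpredT size (v0 ++ u) us isT; rewrite size_cat su.
  by rewrite leqNgt addnS ltnS leq_addl.
have : (PG (\bigcap_n F n) <= PG N)%E.
  by apply: le_measure sub; rewrite inE//; exact: bigcapT_measurable.
move=> /(le_trans percolation_probability).
by rewrite [X in (_ <= X)%E]N0 lee_fin leNgt survive.
Qed.

End Quenched.

(** * The random tree *)

Lemma finite_bounded_height c : finite_set (gw_tree c) -> bounded_height c.
Proof.
move=> /finite_seqP[s sE]; exists (\max_(x <- s) size x).+1 => u tu.
rewrite ltnS; apply: (@leq_bigmax_seq _ s xpredT size u) => //.
by move: tu; rewrite sE.
Qed.

Section ConfigLaw.
Context d (Omega : measurableType d) (R : realType) (P : probability Omega R)
  (nu : probability nat R) (N : vertex -> {RV P >-> nat}).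
Hypothesis N_law : forall u, distribution P (N u) = nu :> (set nat -> \bar R).
Hypothesis N_indep : mutually_independent N.

Definition config_of (w : Omega) : configT := fun u => N u w.

Lemma measurable_config_of : measurable_fun setT config_of.
Proof. by apply: measurable_config => u; exact: measurable_funP. Qed.

HB.instance Definition _ := isMeasurableFun.Build _ _ Omega configT config_of measurable_config_of.

(** Carrying the events over to the space of configurations makes the subtrees available as
    shifts. *)
Definition config_law : probability configT R := distribution P (config_of : {RV P >-> configT}).

Lemma config_law_cylinder s B : uniq s ->
  (config_law (cylinder s B) = \prod_(u <- s) nu (B u))%E.
Proof.
move=> us.
transitivity (P (\bigcap_(u in [set` s]) (N u @^-1` B u))).
  by congr (P _); apply/seteqP; split=> w H u us'; exact: H.
rewrite N_indep//; apply: eq_bigr => u _.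
by transitivity (distribution P (N u) (B u)) => //; rewrite N_law.
Qed.

End ConfigLaw.

Lemma truncated_mean (R : realType) (nu : probability nat R) :
  (2%:R%:E < mean nu)%E -> exists K, 2 < \sum_(k < K.+1) k%:R * fine (nu [set nat_of_ord k]).
Proof.
move=> m2; apply: contrapT => /forallNP H; move: m2; apply/negP; rewrite -leNgt.
apply: lime_le.
  apply: is_cvg_nneseries => k _ _; exact: mule_ge0.
apply: nearW => n.
have -> : (\sum_(0 <= k < n) k%:R%:E * nu [set k] =
  (\sum_(k < n) k%:R * fine (nu [set nat_of_ord k]))%:E)%E.
  rewrite big_mkord -sumEFin; apply: eq_bigr => k _.
  by rewrite EFinM fineK// fin_num_measure.
rewrite lee_fin; case: n => [|n]; first by rewrite big_ord0.
by rewrite leNgt; apply/negP; exact: H.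
Qed.

Local Open Scope ereal_scope.

Theorem theorem5p5 (R : realType) (nu : probability nat R)
    (mean_fin : mean nu < +oo) (mean_gt2 : 2%:R%:E < mean nu)
    (d : measure_display) (Omega : measurableType d) (P : probability Omega R)
    (N : vertex -> {RV P >-> nat})
    (N_law : forall u, distribution P (N u) = nu :> (set nat -> \bar R))
    (N_indep : mutually_independent N) :
  {ae cond_prob P [set w | infinite_set (gw_tree (fun u => N u w))],
   forall w, let T := gw_tree (fun u => N u w) in
     forall (dS : measure_display) (S : measurableType dS)
            (Px : vertex -> probability S R) (X : nat -> S -> vertex)
            (dG : measure_display) (G : measurableType dG)
            (PG : probability G R) (phi : vertex -> {RV PG >-> R}),
       is_srw T Px X -> is_gff T (green T Px X) phi -> 0 < hstar T phi}.
Proof.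
have [K HK] := truncated_mean mean_gt2.
set m := (\sum_(k < K.+1) _)%R in HK.
have m0 : (0 < m)%R by rewrite (lt_trans _ HK).
(* The midpoint of [1 / m] and [1 / 2], so that [rho m > 1] and [rho < 1 / 2]; then [h] is the
   largest level with [rho <= 1 / 2 - h (K + 1)]. *)
pose rho : R := ((1 / 2 + m^-1) / 2)%R.
pose h : R := ((1 / 2 - rho) / K.+1%:R)%R.
have minv : (m^-1 < 1 / 2)%R by rewrite div1r ltf_pV2 ?posrE.
have minv0 : (0 < m^-1)%R by rewrite invr_gt0.
have rho0 : (0 < rho)%R by rewrite /rho; lra.
have rho_half : (rho < 1 / 2)%R by rewrite /rho; lra.
have h0 : (0 < h)%R by rewrite /h divr_gt0// subr_gt0.
have rho_le : (rho <= 1 / 2 - h * K.+1%:R)%R by rewrite /h divfK// subKr.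
have super : (1 < rho * m)%R.
  by rewrite /rho mulrAC mulrDl mulVf ?gt_eqF//; lra.
pose r (k : nat) : R := if (k <= K)%N then rho else 0%R.
have rho01 : (0 < rho <= 1)%R by rewrite rho0 /=; lra.
have r01 k : (0 <= r k <= 1)%R.
  by rewrite /r; case: ifP => _; rewrite ?lexx ?ler01// (ltW rho0); case/andP: rho01.
have mD : measurable (dies r : set configT) by exact: measurable_dies.
have mE := measurable_bounded_height.
have mC := measurable_config_of N.
have Q0 := dies_extinct_ae (config_law_cylinder N_law N_indep) rho01 super.
exists (config_of N @^-1` (dies r)); split.
- by rewrite -[X in measurable X]setTI; exact: mC.
- rewrite /cond_prob.
  have -> : config_of N @^-1` (dies r) `&` [set w | infinite_set (gw_tree (fun u => N u w))] =
    config_of N @^-1` (dies r `\` bounded_height).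
    apply/seteqP; split=> w [Dw Iw]; split => //.
      by move=> /bounded_height_finite; exact: Iw.
    by move=> /finite_bounded_height; exact: Iw.
  by rewrite [X in X / _](_ : _ = 0)%E ?mul0e//; exact: Q0.
- move=> w bad; apply: contrapT => nD; apply: bad => dS S Px X dG G PG phi srw gff.
  have [v [Tv v0]] : exists v, gw_tree (config_of N w) v /\
    (0 < theta_lim r (fun u => N (v ++ u) w))%R.
    apply: contrapT => H; apply: nD => v Tv; apply/eqP; rewrite eq_le theta_lim_ge0// andbT leNgt.
    by apply/negP => v0; apply: H; exists v.
  have h_pos : 0 < h%:E by rewrite lte_fin.
  exact: lt_le_trans h_pos (hstar_lower_bound rho0 h0 rho_le Tv v0 srw gff).
Qed.
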